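(* Let $t_+\ge 0$, $f\in C([t_+,\infty)\times\mathbb R^n,\mathbb R^n)$, $\frac{\partial f}{\partial x}\in C([t_+,\infty)\times\mathbb R^n,\mathrm L(\mathbb R^n))$, $A,B\in C^1([t_+,\infty),\mathrm L(\mathbb R^n))$, let the pencil $\lambda A(t)+B(t)$ be regular for each $t\ge t_+$ and suppose there are functions $C_1,C_2\colon[t_+,\infty)\to(0,\infty)$ with $C_2\in C^1([t_+,\infty),(0,\infty))$ such that for each $t\in[t_+,\infty)$, $\|(\lambda A(t)+B(t))^{-1}\|\le C_1(t)$ for all $\lambda$ with $|\lambda|\ge C_2(t)$. With the notation $P_j,Q_j,X_j,Y_j,G,L_{t_+},\Phi$ of the context, suppose: (1) EITHER both of the following hold: (1a) for each $t\in[t_+,\infty)$ and each $x_{p_1}\in X_1(t)$ there exists a unique $x_{p_2}\in X_2(t)$ such that $(t,x_{p_1}+x_{p_2})\in L_{t_+}$; (1b) for each $t_*\in[t_+,\infty)$, $x_{p_1}^*\in X_1(t_* )$, $x_{p_2}^*\in X_2(t_* )$ with $(t_*,x_{p_1}^*+x_{p_2}^* )\in L_{t_+}$, the operator $\Phi_{t_*,x_{p_1}^*}(x_{p_2}^* )\colon X_2(t_* )\to Y_2(t_* )$ is invertible; OR both of the following hold: (1a') for each $t\in[t_+,\infty)$ and each $x_{p_1}\in X_1(t)$ there exists $x_{p_2}\in X_2(t)$ such that $(t,x_{p_1}+x_{p_2})\in L_{t_+}$; (1b') for each $t_*\in[t_+,\infty)$, $x_{p_1}^*\in X_1(t_* )$,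 $x_{p_2}^1,x_{p_2}^2\in X_2(t_* )$ with $(t_*,x_{p_1}^*+x_{p_2}^i)\in L_{t_+}$, $i=1,2$, the operator function $\Phi_{t_*,x_{p_1}^*}\colon X_2(t_* )\to\mathrm L(X_2(t_* ),Y_2(t_* ))$ is basis invertible on the segment $[x_{p_2}^1,x_{p_2}^2]$. (2) There exist $k\in C([t_+,\infty),\mathbb R)$, $U\in C((0,\infty),(0,\infty))$, a number $R>0$ and a positive definite function $V\in C^1([t_+,\infty)\times U_R^c(0),\mathbb R)$, where $U_R^c(0)=\{z\in\mathbb R^n:\|z\|\ge R\}$, such that $\int_{v_0}^\infty \frac{dv}{U(v)}=\infty$ (for some constant $v_0>0$); $V(t,z)\to\infty$ as $\|z\|\to\infty$ uniformly in $t$ on each finite interval $[a,b)\subset[t_+,\infty)$; and for all $t\in[t_+,\infty)$, $x_{p_1}\in X_1(t)$, $x_{p_2}\in X_2(t)$ with $(t,x_{p_1}+x_{p_2})\in L_{t_+}$ and $\|x_{p_1}\|\ge R$, $$\frac{\partial V}{\partial t}(t,x_{p_1})+\Big(\frac{\partial V}{\partial z}(t,x_{p_1}),\,[P_1'(t)-G^{-1}(t)Q_1(t)(A'(t)+B(t))]x_{p_1}+G^{-1}(t)Q_1(t)f(t,x_{p_1}+x_{p_2})\Big)\le k(t)\,U\big(V(t,x_{p_1})\big).$$ Let $t_0\ge t_+$ and $T>t_0$. In addition, let the operator $\Phi_{t_*,P_1(t_* )z_*}(P_2(t_* )u_* )\colon X_2(t_* )\to Y_2(t_* )$ be invertible for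 each point $(t_*,P_1(t_* )z_*+P_2(t_* )u_* )\in[t_0,T]\times\mathbb R^n$, and let $x_0\in\mathbb R^n$ be chosen so that $(t_0,x_0)\in L_{t_+}$. (No further smoothness of $f,A,B,C_2$ is required.) For $N\in\mathbb N$ put $h=(T-t_0)/N$, $t_i=t_0+ih$ ($i=0,\dots,N$). Then the method $$z_0=P_1(t_0)x_0,\qquad u_0=P_2(t_0)x_0,$$ $$\widetilde z_{i+1}=\Big[I+h\big(P_1'(t_i)-G^{-1}(t_i)Q_1(t_i)[A'(t_i)+B(t_i)]\big)P_1(t_i)\Big]z_i+h\,G^{-1}(t_i)Q_1(t_i)f(t_i,x_i),$$ $$\begin{aligned}\widetilde u_{i+1}=u_i-\Big[I-&G^{-1}(t_{i+1})Q_2(t_{i+1})\tfrac{\partial f}{\partial x}\big(t_{i+1},P_1(t_{i+1})\widetilde z_{i+1}+P_2(t_{i+1})u_i\big)P_2(t_{i+1})\Big]^{-1}\\ &\times\Big[u_i-G^{-1}(t_{i+1})Q_2(t_{i+1})\big[f\big(t_{i+1},P_1(t_{i+1})\widetilde z_{i+1}+P_2(t_{i+1})u_i\big)-A'(t_{i+1})P_1(t_{i+1})\widetilde z_{i+1}\big]\Big],\end{aligned}$$ $$\begin{aligned}z_{i+1}=&\Big[I+\tfrac h2\big(P_1'(t_i)-G^{-1}(t_i)Q_1(t_i)[A'(t_i)+B(t_i)]\big)P_1(t_i)\Big]z_i\\&+\tfrac h2\big(P_1'(t_{i+1})-G^{-1}(t_{i+1})Q_1(t_{i+1})[A'(t_{i+1})+B(t_{i+1})]\big)P_1(t_{i+1})\widetilde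 z_{i+1}\\&+\tfrac h2\Big[G^{-1}(t_i)Q_1(t_i)f(t_i,x_i)+G^{-1}(t_{i+1})Q_1(t_{i+1})f\big(t_{i+1},P_1(t_{i+1})\widetilde z_{i+1}+P_2(t_{i+1})\widetilde u_{i+1}\big)\Big],\end{aligned}$$ $$\begin{aligned}u_{i+1}=u_i-\Big[I-&G^{-1}(t_{i+1})Q_2(t_{i+1})\tfrac{\partial f}{\partial x}\big(t_{i+1},P_1(t_{i+1})z_{i+1}+P_2(t_{i+1})u_i\big)P_2(t_{i+1})\Big]^{-1}\\ &\times\Big[u_i-G^{-1}(t_{i+1})Q_2(t_{i+1})\big[f\big(t_{i+1},P_1(t_{i+1})z_{i+1}+P_2(t_{i+1})u_i\big)-A'(t_{i+1})P_1(t_{i+1})z_{i+1}\big]\Big],\end{aligned}$$ $$x_{i+1}=P_1(t_{i+1})z_{i+1}+P_2(t_{i+1})u_{i+1},\qquad i=0,\dots,N-1,$$ (where $I=I_{\mathbb R^n}$), which approximates on $[t_0,T]$ the initial value problem $\frac{d}{dt}[A(t)x(t)]+B(t)x(t)=f(t,x(t))$, $x(t_0)=x_0$, is convergent (but not necessarily of second order), that is, $\max_{1\le i\le N}\|x(t_i)-x_i\|\to0$ as $h\to0$, where $x(t)$ is an exact solution of this initial value problem.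
   Context: $\mathrm L(X,Y)$ is the space of (continuous) linear operators from $X$ to $Y$, $\mathrm L(X)=\mathrm L(X,X)$; $(\cdot,\cdot)$ is the inner product and $\|\cdot\|$ the norm on $\mathbb R^n$. The operators $A(t),B(t)$ may be noninvertible. Solution: a function $x\in C([t_0,t_1),\mathbb R^n)$ is a solution of $\frac{d}{dt}[A(t)x]+B(t)x=f(t,x)$ on $[t_0,t_1)$ if $A(t)x(t)$ is continuously differentiable on $[t_0,t_1)$ and $x$ satisfies the equation there; it solves the initial value problem if also $x(t_0)=x_0$. The exact solution considered is the global one, i.e. on $[t_0,\infty)$. Pencil: $\lambda A(t)+B(t)$ ($\lambda$ a complex parameter) is regular for a given $t$ if $(\lambda A(t)+B(t))^{-1}$ exists for some $\lambda$. Spectral projectors: for each $t\ge t_+$, $$P_1(t)=\frac1{2\pi \mathrm i}\oint_{|\lambda|=C_2(t)}(\lambda A(t)+B(t))^{-1}A(t)\,d\lambda,\quad Q_1(t)=\frac1{2\pi \mathrm i}\oint_{|\lambda|=C_2(t)}A(t)(\lambda A(t)+B(t))^{-1}\,d\lambda,$$ $P_2(t)=I_{\mathbb R^n}-P_1(t)$, $Q_2(t)=I_{\mathbb R^n}-Q_1(t)$. These are real projectors; $X_j(t)=P_j(t)\mathbb R^n$, $Y_j(t)=Q_j(t)\mathbb R^n$ ($j=1,2$), so $\mathbb R^n=X_1(t)\dot+X_2(t)=Y_1(t)\dot+Y_2(t)$, and $A(t),B(t)$ map $X_j(t)$ into $Y_j(t)$. The operator $G(t)=A(t)+B(t)P_2(t)\in\mathrm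 L(\mathbb R^n)$ is invertible and $G(t)X_j(t)=Y_j(t)$. The operator functions $P_j,Q_j,G,G^{-1}$ have the same smoothness in $t$ as $A,B,C_2$; primes denote $d/dt$. Consistency manifold: $$L_{t_+}=\{(t,x)\in[t_+,\infty)\times\mathbb R^n: Q_2(t)[A'(t)P_1(t)x+B(t)x-f(t,x)]=0\}.$$ Operator function $\Phi$: for $t_*\in[t_+,\infty)$, $x_{p_1}^*\in X_1(t_* )$, $x_{p_2}\in X_2(t_* )$, $$\Phi_{t_*,x_{p_1}^*}(x_{p_2})=\Big[\frac{\partial}{\partial x}\big[Q_2(t_* )f(t_*,x_{p_1}^*+x_{p_2})\big]-B(t_* )\Big]P_2(t_* )\colon X_2(t_* )\to Y_2(t_* ).$$ Basis invertibility: an additive resolution of the identity in an $s$-dimensional space $Z$ is a system of $s$ projectors $\Theta_k\in \mathrm L(Z)$ with $\Theta_i\Theta_j=\delta_{ij}\Theta_i$ and $\sum_{k=1}^s\Theta_k=I_Z$. For $s$-dimensional spaces $W,Z$ and $D\subset W$, an operator function $\Phi\colon D\to\mathrm L(W,Z)$ is basis invertible on an interval (segment) $J\subset D$ if for some additive resolution of the identity $\{\Theta_k\}_{k=1}^s$ in $Z$ and for any set $\{w^k\}_{k=1}^s\subset J$ the operator $\sum_{k=1}^s\Theta_k\Phi(w^k)\in\mathrm L(W,Z)$ is invertible. Positive definite function: $V$ on $[t_+,\infty)\times U_R^c(0)$ is positive definite in the usual (Lyapunov) sense, i.e. $V(t,z)\ge W(z)$ for some continuous function $W$ with $W(z)>0$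 for $z\in U_R^c(0)$. *)

(* Defs.v *)
From HB Require Import structures.
From mathcomp Require Import all_boot all_order all_algebra.
From mathcomp Require Import complex.
From mathcomp Require Import all_classical all_reals all_analysis.

Set Implicit Arguments.
Unset Strict Implicit.
Unset Printing Implicit Defensive.

Import Order.TTheory GRing.Theory Num.Theory.
Import numFieldNormedType.Exports.

Local Open Scope classical_set_scope.
Local Open Scope ring_scope.

(* The ambient topology on column vectors and matrices is the library one
   (entrywise max norm).  Wherever the value of a norm matters, the Euclidean
   norm [enorm] below is used. *)
Section EuclideanNorm.
Context {R : realType} {n : nat}.
Implicit Types (u v : 'cV[R]_n) (w : 'cV[R[i]]_n).

Definition dotv u v : R := \sum_i u i 0 * v i 0.
Definition enorm v : R := Num.sqrt (dotv v v).

Definition cnorm w : R :=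
  Num.sqrt (\sum_i (complex.Re (w i 0) ^+ 2 + complex.Im (w i 0) ^+ 2)).
Definition opnorm (M : 'M[R[i]]_n) : R :=
  sup [set cnorm (M *m w) | w in [set w | cnorm w <= 1]].

End EuclideanNorm.

Section Calculus.
Context {R : realType}.

(* For D = [a, +oo[ the limit at the endpoint a is one-sided. *)
Definition diff_quotient {V : normedModType R} (F : R -> V) (t s : R) : V :=
  (s - t)^-1 *: (F s - F t).
Definition derive_within {V : normedModType R} (D : set R) (F : R -> V)
    (t : R) : V :=
  lim (diff_quotient F t s @[s --> within D t^']).
Definition C1_on {V : normedModType R} (D : set R) (F : R -> V) : Prop :=
  (forall t, D t -> cvg (diff_quotient F t s @[s --> within D t^'])) /\
  {within D, continuous (derive_within D F)}.

(* Matrix of the Frechet derivative of g at x, acting on columns from the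
   left (the library's [jacobian] acts on row vectors from the right). *)
Definition jac {m n} (g : 'cV[R]_n -> 'cV[R]_m) (x : 'cV[R]_n) : 'M[R]_(m, n) :=
  \matrix_(i, j) ('d g x (delta_mx j 0 : 'cV[R]_n)) i 0.

(* V is C^1 on D with partial derivative Vt in t and gradient Vz in z.  The
   expansion is taken relative to D, so that it makes sense on the boundary
   of [t_+, +oo[ x {z | r <= ||z||}, where it still determines Vt and Vz. *)
Definition C1_joint {n} (D : set (R * 'cV[R]_n)) (V Vt : R -> 'cV[R]_n -> R)
    (Vz : R -> 'cV[R]_n -> 'cV[R]_n) : Prop :=
  [/\ forall p, D p -> forall e : R, 0 < e ->
        \forall q \near within D (nbhs p),
          `|V q.1 q.2 - V p.1 p.2 - Vt p.1 p.2 * (q.1 - p.1)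
            - dotv (Vz p.1 p.2) (q.2 - p.2)| <= e * `|q - p|,
      {within D, continuous (fun p => Vt p.1 p.2)} &
      {within D, continuous (fun p => Vz p.1 p.2)}].

Definition circle (r theta : R) : R[i] :=
  Complex (r * cos theta) (r * sin theta).

(* Counterclockwise integral of F over |lambda| = r:
   d lambda = i r e^(i theta) d theta. *)
Definition circle_integral (r : R) (F : R[i] -> R[i]) : R[i] :=
  let g theta := F (circle r theta) * (Complex 0 1 * circle r theta) in
  Complex (\int[lebesgue_measure]_(theta in `[0, 2 * pi]) complex.Re (g theta))
          (\int[lebesgue_measure]_(theta in `[0, 2 * pi]) complex.Im (g theta)).

Definition circle_integral_mx {n} (r : R) (F : R[i] -> 'M[R[i]]_n) :
    'M[R[i]]_n :=
  \matrix_(j, k) circle_integral r (fun lam => F lam j k).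

End Calculus.

Section Subspaces.
Context {R : realType} {n : nat}.

Definition image_mx (P : 'M[R]_n) : set 'cV[R]_n := range (mulmx P).

(* Linear operators between subspaces W, Z of R^n are represented by matrices
   carrying W into Z; only their restrictions to W matter. *)
Definition invertible_between (W Z : set 'cV[R]_n) (M : 'M[R]_n) : Prop :=
  set_bij W Z (mulmx M).

Definition additive_resolution (s : nat) (Z : set 'cV[R]_n)
    (Theta : 'I_s -> 'M[R]_n) : Prop :=
  [/\ forall k z, Z z -> Z (Theta k *m z),
      forall i j z, Z z ->
        Theta i *m (Theta j *m z) = if i == j then Theta i *m z else 0 &
      forall z, Z z -> \sum_k Theta k *m z = z].

Definition segment (w1 w2 : 'cV[R]_n) : set 'cV[R]_n :=
  [set (1 - a) *: w1 + a *: w2 | a in `[0, 1]].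

(* [s] is the common dimension of W and Z. *)
Definition basis_invertible (s : nat) (W Z : set 'cV[R]_n)
    (Phi : 'cV[R]_n -> 'M[R]_n) (J : set 'cV[R]_n) : Prop :=
  exists2 Theta : 'I_s -> 'M[R]_n, additive_resolution Z Theta &
    forall w : 'I_s -> 'cV[R]_n, (forall k, J (w k)) ->
      invertible_between W Z (\sum_k Theta k *m Phi (w k)).

End Subspaces.

Section SemilinearDAE.
Context {R : realType} {n : nat}.
Variables (A B : R -> 'M[R]_n) (C2 : R -> R) (f : R -> 'cV[R]_n -> 'cV[R]_n).
Variable tp : R.
Implicit Types (t : R) (x z u : 'cV[R]_n).

Definition pencil t (lam : R[i]) : 'M[R[i]]_n :=
  lam *: map_mx (real_complex R) (A t) + map_mx (real_complex R) (B t).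

Definition regular_pencil t : Prop := exists lam, pencil t lam \in unitmx.

Definition P1C t : 'M[R[i]]_n :=
  (2 * real_complex R pi * Complex 0 1)^-1 *: circle_integral_mx (C2 t)
    (fun lam => invmx (pencil t lam) *m map_mx (real_complex R) (A t)).
Definition Q1C t : 'M[R[i]]_n :=
  (2 * real_complex R pi * Complex 0 1)^-1 *: circle_integral_mx (C2 t)
    (fun lam => map_mx (real_complex R) (A t) *m invmx (pencil t lam)).

(* The contour integrals are real matrices (conjugating lambda conjugates the
   integrand); [Re] only transports them to 'M[R]_n. *)
Definition P1 t : 'M[R]_n := map_mx (@complex.Re R) (P1C t).
Definition Q1 t : 'M[R]_n := map_mx (@complex.Re R) (Q1C t).
Definition P2 t : 'M[R]_n := 1%:M - P1 t.
Definition Q2 t : 'M[R]_n := 1%:M - Q1 t.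

Definition X1 t : set 'cV[R]_n := image_mx (P1 t).
Definition X2 t : set 'cV[R]_n := image_mx (P2 t).
Definition Y2 t : set 'cV[R]_n := image_mx (Q2 t).

Definition G t : 'M[R]_n := A t + B t *m P2 t.
Definition Ginv t : 'M[R]_n := invmx (G t).

Definition A' : R -> 'M[R]_n := derive_within `[tp, +oo[ A.
Definition P1' : R -> 'M[R]_n := derive_within `[tp, +oo[ P1.

Definition consistency_manifold : set (R * 'cV[R]_n) :=
  [set p | tp <= p.1 /\
    Q2 p.1 *m (A' p.1 *m P1 p.1 *m p.2 + B p.1 *m p.2 - f p.1 p.2) = 0].

Definition Phi t (xp1 xp2 : 'cV[R]_n) : 'M[R]_n :=
  (jac (fun x => Q2 t *m f t x) (xp1 + xp2) - B t) *m P2 t.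

Definition is_solution (t0 : R) (x0 : 'cV[R]_n) (x : R -> 'cV[R]_n) : Prop :=
  [/\ {within `[t0, +oo[, continuous x},
      C1_on `[t0, +oo[ (fun t => A t *m x t),
      forall t, t0 <= t ->
        derive_within `[t0, +oo[ (fun s => A s *m x s) t + B t *m x t
        = f t (x t) &
      x t0 = x0].

(* The first alternative of condition (1). *)
Definition uniquely_solvable_condition : Prop :=
  (forall t xp1, tp <= t -> X1 t xp1 ->
     exists! xp2, X2 t xp2 /\ consistency_manifold (t, xp1 + xp2)) /\
  (forall t xp1 xp2, tp <= t -> X1 t xp1 -> X2 t xp2 ->
     consistency_manifold (t, xp1 + xp2) ->
     invertible_between (X2 t) (Y2 t) (Phi t xp1 xp2)).

(* The second alternative of condition (1); dim Y_2(t) = \rank (Q_2(t)). *)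
Definition basis_invertible_condition : Prop :=
  (forall t xp1, tp <= t -> X1 t xp1 ->
     exists xp2, X2 t xp2 /\ consistency_manifold (t, xp1 + xp2)) /\
  (forall t xp1 xp2 xp2', tp <= t -> X1 t xp1 -> X2 t xp2 -> X2 t xp2' ->
     consistency_manifold (t, xp1 + xp2) ->
     consistency_manifold (t, xp1 + xp2') ->
     basis_invertible (\rank (Q2 t)) (X2 t) (Y2 t) (Phi t xp1)
       (segment xp2 xp2')).

(* [Vt] and [Vz] are the partial derivatives of [V]. *)
Definition lyapunov_condition : Prop :=
  exists (k U : R -> R) (r : R) (V Vt : R -> 'cV[R]_n -> R)
         (Vz : R -> 'cV[R]_n -> 'cV[R]_n),
  [/\ {within `[tp, +oo[, continuous k} /\
      ({within `]0, +oo[, continuous U} /\ forall v, 0 < v -> 0 < U v),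
      0 < r /\
      C1_joint [set p | tp <= p.1 /\ r <= enorm p.2] V Vt Vz,
      (exists W : 'cV[R]_n -> R,
         [/\ {within [set z | r <= enorm z], continuous W},
             forall z, r <= enorm z -> 0 < W z &
             forall t z, tp <= t -> r <= enorm z -> W z <= V t z]),
      (exists2 v0 : R, 0 < v0 &
         (\int[lebesgue_measure]_(v in `[v0, +oo[) (U v)^-1%:E = +oo)%E) /\
      (forall a b M : R, tp <= a -> a < b ->
         exists rho : R, forall t z, a <= t -> t < b -> r <= enorm z ->
           rho <= enorm z -> M <= V t z) &
      forall t xp1 xp2, tp <= t -> X1 t xp1 -> X2 t xp2 ->
        consistency_manifold (t, xp1 + xp2) -> r <= enorm xp1 ->
        Vt t xp1
        + dotv (Vz t xp1)
            ((P1' t - Ginv t *m Q1 t *m (A' t + B t)) *m xp1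
             + Ginv t *m Q1 t *m f t (xp1 + xp2))
        <= k t * U (V t xp1)].

Definition drift t : 'M[R]_n :=
  (P1' t - Ginv t *m Q1 t *m (A' t + B t)) *m P1 t.

(* One Newton step at time t for the algebraic component, started from u. *)
Definition newton_step t z u : 'cV[R]_n :=
  let y := P1 t *m z + P2 t *m u in
  u - invmx (1%:M - Ginv t *m Q2 t *m jac (f t) y *m P2 t)
      *m (u - Ginv t *m Q2 t *m (f t y - A' t *m P1 t *m z)).

(* (z_i, u_i, x_i); x_0 is the initial value itself. *)
Record state := State { zc : 'cV[R]_n; uc : 'cV[R]_n; xc : 'cV[R]_n }.

Definition method_init (t0 : R) (x0 : 'cV[R]_n) : state :=
  State (P1 t0 *m x0) (P2 t0 *m x0) x0.

(* From t_i = t to t_(i+1) = t'. *)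
Definition method_step (h t t' : R) (s : state) : state :=
  let zt := (1%:M + h *: drift t) *m zc s
            + h *: (Ginv t *m Q1 t *m f t (xc s)) in
  let ut := newton_step t' zt (uc s) in
  let z := (1%:M + (h / 2) *: drift t) *m zc s
           + (h / 2) *: (drift t' *m zt)
           + (h / 2) *: (Ginv t *m Q1 t *m f t (xc s)
                         + Ginv t' *m Q1 t' *m f t' (P1 t' *m zt + P2 t' *m ut))
  in
  let u := newton_step t' z (uc s) in
  State z u (P1 t' *m z + P2 t' *m u).

Definition grid (t0 h : R) (i : nat) : R := t0 + i%:R * h.

Fixpoint method (t0 : R) (x0 : 'cV[R]_n) (h : R) (i : nat) : state :=
  if i is j.+1 then
    method_step h (grid t0 h j) (grid t0 h j.+1) (method t0 x0 h j)
  else method_init t0 x0.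

End SemilinearDAE.

(* Main.v *)
Require Import Defs.
From HB Require Import structures.
From mathcomp Require Import all_boot all_order all_algebra.
From mathcomp Require Import complex.
From mathcomp Require Import all_classical all_reals all_analysis.
From mathcomp Require Import ring lra.
Import Order.TTheory GRing.Theory Num.Theory.
Import numFieldNormedType.Exports.
Local Open Scope classical_set_scope.
Local Open Scope ring_scope.

(* Fix t, put mu = C2(t), H = mu A + B and K = H^-1 A, a real matrix.  The
   resolvent bound forces ker K^2 = ker K.  On |lam| >= mu the function
   lam (lam A + B)^-1 A is a rational function of 1/lam without poles, so the
   contour integral P1 is its value at infinity, the projector onto im K along
   ker K.  Since P1 is an explicit polynomial in K whose coefficients involve
   the lowest nonvanishing coefficient of the characteristic polynomial of K,
   P1 is C^1 in t once the multiplicity of the eigenvalue 0 is constant; this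
   holds because the nonzero eigenvalues of K are at least 1/(2 C2(t)) in
   absolute value.

   Hence z = P1 x solves z' = drift z + G^-1 Q1 f(t, x), and u = P2 x is the
   zero of the equation that newton_step linearises.  In a tube around the
   solution over [t0, T] one Newton step maps an error (dz, du) to at most
   du / 2 + C dz, so a predictor-corrector step multiplies a common error bound
   a by 1 + O(h), as soon as a dominates the moduli of continuity of z' and u
   at scale h.  These moduli tend to 0 with h. *)

(** * Mean values of rational functions over circles *)

(** Differentiating the contour integrals in [t] would mean handling a resolvent on a moving circle.
    The polynomial formula in [K] avoids this, at the price of dividing by a coefficient whose index
    might jump with [t]. At a jump that coefficient would pass through small nonzero values. The
    eigenvalue bound excludes this: multiplied by a power of [2 * C2 t + 1], the coefficient is 0 or
    of absolute value at least 1, and [[tp, +oo[] is connected.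

    In the error analysis [z'] and [u] are merely continuous, so the trapezoidal corrector gains no
    order, and the local defect of [z] is only [h] times a modulus of continuity [d]. The bound
    therefore starts at [d] instead of 0 and grows geometrically. Newton's iteration starts from the
    old [u_i], which misses the new exact value by the old error plus the modulus of [u]; a
    contraction by 1/2 absorbs both once the error of [u] may be a fixed multiple of that of [z].
    The factor 1/2 dictates the Taylor constant, and the Taylor constant dictates the radius of the
    tube. *)

Section CircleIntegral.
Context {R : realType}.
Implicit Types (g k : R -> R[i]) (p : {poly R[i]}).
Local Notation Re := complex.Re.
Local Notation Im := complex.Im.
Local Notation normc := ComplexField.Normc.normc.

(** The contour integral is a pair of real Lebesgue integrals, so continuity is asked of the two
    real components. *)
Definition ccont g := continuous (fun x => Re (g x)) /\ continuous (fun x => Im (g x)).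

Definition cint g : R[i] :=
  Complex (\int[lebesgue_measure]_(x in `[0, 2 * pi]) Re (g x))
          (\int[lebesgue_measure]_(x in `[0, 2 * pi]) Im (g x)).

Lemma ReM (a b : R[i]) : Re (a * b) = Re a * Re b - Im a * Im b.
Proof. by case: a; case: b. Qed.
Lemma ImM (a b : R[i]) : Im (a * b) = Re a * Im b + Im a * Re b.
Proof. by case: a; case: b. Qed.
Lemma ReD (a b : R[i]) : Re (a + b) = Re a + Re b.
Proof. by case: a; case: b. Qed.
Lemma ImD (a b : R[i]) : Im (a + b) = Im a + Im b.
Proof. by case: a; case: b. Qed.

Lemma ccont_cst c : ccont (fun=> c).
Proof. by split=> x; exact: cvg_cst. Qed.

Lemma ccontD g k : ccont g -> ccont k -> ccont (fun x => g x + k x).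
Proof.
move=> [g1 g2] [k1 k2]; split=> x.
  by under eq_fun do rewrite ReD; apply: cvgD; [exact: g1|exact: k1].
by under eq_fun do rewrite ImD; apply: cvgD; [exact: g2|exact: k2].
Qed.

Lemma ccontM g k : ccont g -> ccont k -> ccont (fun x => g x * k x).
Proof.
move=> [g1 g2] [k1 k2]; split=> x.
  under eq_fun do rewrite ReM; apply: cvgB; apply: cvgM;
  by [exact: g1|exact: k1|exact: g2|exact: k2].
under eq_fun do rewrite ImM; apply: cvgD; apply: cvgM;
by [exact: g1|exact: k1|exact: g2|exact: k2].
Qed.

Lemma ccontV g : ccont g -> (forall x, g x != 0) -> ccont (fun x => (g x)^-1).
Proof.
move=> [g1 g2] g0.
have n0 x : Re (g x) ^+ 2 + Im (g x) ^+ 2 != 0.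
  have := g0 x; case: (g x) => a b /=; apply: contraNneq => /eqP.
  rewrite paddr_eq0 ?sqr_ge0// !sqrf_eq0 => /andP[/eqP -> /eqP ->].
  by [].
have nc : continuous (fun x => (Re (g x) ^+ 2 + Im (g x) ^+ 2)^-1).
  move=> x; apply: cvgV => //; rewrite !expr2.
  by apply: cvgD; apply: cvgM; by [exact: g1|exact: g2].
have E x : (g x)^-1 = Complex (Re (g x) * (Re (g x) ^+ 2 + Im (g x) ^+ 2)^-1)
                     (- (Im (g x) * (Re (g x) ^+ 2 + Im (g x) ^+ 2)^-1)).
  by case: (g x).
split=> x; under eq_fun do rewrite E /=.
  by apply: cvgM; [exact: g1|exact: nc].
by apply: cvgN; apply: cvgM; [exact: g2|exact: nc].
Qed.

Lemma ccontX g n : ccont g -> ccont (fun x => g x ^+ n).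
Proof.
move=> gc; elim: n => [|n IH].
  by under eq_fun do rewrite expr0; exact: ccont_cst.
by under eq_fun do rewrite exprS; exact: ccontM.
Qed.

Lemma ccont_sum (I : Type) (r : seq I) (P : pred I) (F : I -> R -> R[i]) :
  (forall i, ccont (F i)) -> ccont (fun x => \sum_(i <- r | P i) F i x).
Proof.
move=> Fc; elim: r => [|i r IH].
  by under eq_fun do rewrite big_nil; exact: ccont_cst.
under eq_fun do rewrite big_cons; case: (P i) => //; exact: ccontD.
Qed.

Lemma ccont_horner p g : ccont g -> ccont (fun x => p.[g x]).
Proof.
move=> gc; under eq_fun do rewrite horner_coef.
apply: ccont_sum => i; apply: ccontM; [exact: ccont_cst|exact: ccontX].
Qed.

Lemma integrable_continuous (f : R -> R) : continuous f ->
  lebesgue_measure.-integrable `[0, 2 * pi] (EFin \o f).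
Proof.
move=> fc; apply: continuous_compact_integrable; first exact: segment_compact.
exact: continuous_subspaceT.
Qed.

Lemma cintD g k : ccont g -> ccont k -> cint (fun x => g x + k x) = cint g + cint k.
Proof.
move=> [g1 g2] [k1 k2]; rewrite /cint.
under eq_Rintegral do rewrite ReD.
under [X in Complex _ X]eq_Rintegral do rewrite ImD.
rewrite !RintegralD//; exact: integrable_continuous.
Qed.

Lemma cintZ c g : ccont g -> cint (fun x => c * g x) = c * cint g.
Proof.
move=> [g1 g2]; rewrite /cint.
have I1 : forall r, lebesgue_measure.-integrable `[0, 2 * pi] (EFin \o (fun x => r * Re (g x))).
  move=> r; apply: integrable_continuous => x; apply: cvgM; [exact: cvg_cst|exact: g1].
have I2 : forall r, lebesgue_measure.-integrable `[0, 2 * pi] (EFin \o (fun x => r * Im (g x))).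
  move=> r; apply: integrable_continuous => x; apply: cvgM; [exact: cvg_cst|exact: g2].
under eq_Rintegral do rewrite ReM.
under [X in Complex _ X]eq_Rintegral do rewrite ImM.
rewrite RintegralB// RintegralD// !RintegralZl//; try exact: integrable_continuous.
by case: c.
Qed.

Lemma cint_sum (I : Type) (r : seq I) (F : I -> R -> R[i]) :
  (forall i, ccont (F i)) ->
  cint (fun x => \sum_(i <- r) F i x) = \sum_(i <- r) cint (F i).
Proof.
move=> Fc; elim: r => [|i r IH].
  rewrite big_nil /cint; under eq_Rintegral do rewrite big_nil.
  under [X in Complex _ X]eq_Rintegral do rewrite big_nil.
  by rewrite /= Rintegral_cst// mul0r.
rewrite big_cons -IH -cintD//; last exact: ccont_sum.
by congr cint; apply/funext => x; rewrite big_cons.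
Qed.

Lemma Rintegral_circle_cst (r : R) :
  \int[lebesgue_measure]_(x in `[0, 2 * pi]) r = r * (2 * pi).
Proof.
rewrite Rintegral_cst//; congr (r * _).
transitivity (fine (lebesgue_measure (`[0, 2 * pi]%classic : set R))); first by [].
by rewrite lebesgue_measure_itv/= lte_fin mulr_gt0 ?pi_gt0//= oppr0 addr0.
Qed.

Lemma cint_cst c : cint (fun=> c) = (2 * real_complex R pi) * c.
Proof.
rewrite /cint !Rintegral_circle_cst; case: c => a b /=.
apply/eqP; rewrite eq_complex/= !(mul0r, mulr0, addr0, subr0).
by rewrite !(mulrC _ (2 * pi)) !eqxx.
Qed.

Lemma normc_le_ReIm (z : R[i]) : normc z <= `|Re z| + `|Im z|.
Proof.
case: z => a b /=; rewrite -[leRHS]ger0_norm ?addr_ge0// -sqrtr_sqr.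
rewrite ler_wsqrtr// sqrrD !real_normK ?num_real// lerD2r lerDl.
by rewrite mulrn_wge0// mulr_ge0.
Qed.

Lemma normc_ge_ReIm (z : R[i]) : `|Re z| <= normc z /\ `|Im z| <= normc z.
Proof.
case: z => a b /=; split; rewrite -sqrtr_sqr ler_wsqrtr//.
  by rewrite lerDl sqr_ge0.
by rewrite lerDr sqr_ge0.
Qed.

(** The factor 2 comes from estimating a modulus by [|Re| + |Im|]; it is harmless, since the bound
    is later multiplied by powers tending to 0. *)
Lemma cint_bound g M : ccont g ->
  (forall x, x \in `[0, 2 * pi] -> normc (g x) <= M) ->
  normc (cint g) <= 2 * (M * (2 * pi)).
Proof.
move=> [g1 g2] gM.
have pi2 : 0 < 2 * pi :> R by rewrite mulr_gt0// pi_gt0.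
have leI (f : R -> R) : continuous f -> (forall x, x \in `[0, 2 * pi] -> `|f x| <= M) ->
    `|\int[lebesgue_measure]_(x in `[0, 2 * pi]) f x| <= M * (2 * pi).
  move=> fc fM; apply: le_trans (le_normr_Rintegral _ _) _ => //.
    exact: integrable_continuous.
  apply: (@le_trans _ _ (\int[lebesgue_measure]_(x in `[0, 2 * pi]) M)).
    apply: le_Rintegral => //.
      by apply: integrable_continuous => x; apply: cvg_norm; exact: fc.
    by apply: integrable_continuous => x; exact: cvg_cst.
  by rewrite Rintegral_circle_cst.
apply: (le_trans (normc_le_ReIm _)); rewrite mulr_natl mulr2n; apply: lerD; apply: leI => // x xI.
  exact: le_trans (normc_ge_ReIm _).1 (gM x xI).
exact: le_trans (normc_ge_ReIm _).2 (gM x xI).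
Qed.

Lemma ccont_bounded g : ccont g ->
  exists2 M, 0 <= M & forall x, x \in `[0, 2 * pi] -> normc (g x) <= M.
Proof.
move=> [g1 g2].
have pi2 : 0 <= 2 * pi :> R by rewrite mulr_ge0// pi_ge0.
have [] := @EVT_max _ (fun x => `|Re (g x)|) _ _ pi2.
  by apply: continuous_subspaceT => x; apply: cvg_norm; exact: g1.
move=> c1 _ M1; have [] := @EVT_max _ (fun x => `|Im (g x)|) _ _ pi2.
  by apply: continuous_subspaceT => x; apply: cvg_norm; exact: g2.
move=> c2 _ M2; exists (`|Re (g c1)| + `|Im (g c2)|); first exact: addr_ge0.
move=> x xI; apply: (le_trans (normc_le_ReIm _)); apply: lerD; [exact: M1|exact: M2].
Qed.

Lemma Rintegral_periodic_derivative (F f : R -> R) : continuous f ->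
  (forall x : R, is_derive x (1 : R) F (f x)) -> F (2 * pi) = F 0 ->
  \int[lebesgue_measure]_(x in `[0, 2 * pi]) f x = 0.
Proof.
move=> fc dF F0.
have pi2 : 0 < 2 * pi :> R by rewrite mulr_gt0// pi_gt0.
have Fc : continuous F.
  by move=> x; apply/differentiable_continuous/derivable1_diffP; have [] := dF x.
rewrite /Rintegral (@continuous_FTC2 _ f F)//.
- by rewrite F0 subee.
- exact: continuous_subspaceT.
- split; first by move=> x _; have [] := dF x.
    exact/cvg_at_right_filter/Fc.
  exact/cvg_at_left_filter/Fc.
- by move=> x _; rewrite derive1E; have [_] := dF x.
Qed.

Lemma moivre (r x : R) (k : nat) :
  Complex (r * cos x) (- (r * sin x)) ^+ k =
  Complex (r ^+ k * cos (k%:R * x)) (- (r ^+ k * sin (k%:R * x))).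
Proof.
elim: k => [|k IH]; first by rewrite !expr0 mul0r cos0 sin0 !mulr0 oppr0 mulr1.
rewrite exprS IH -natr1 mulrDl mul1r cosD sinD.
apply/eqP; rewrite eq_complex/= exprS; apply/andP; split; apply/eqP; ring.
Qed.

Lemma cint_expw (r : R) (k : nat) :
  cint (fun x => Complex (r * cos x) (- (r * sin x)) ^+ k.+1) = 0.
Proof.
rewrite /cint.
under eq_Rintegral do rewrite moivre.
under [X in Complex _ X]eq_Rintegral do rewrite moivre.
rewrite /=; set m : R := k.+1%:R; set c := r ^+ k.+1.
have m0 : m != 0 by rewrite pnatr_eq0.
have dm (x : R) : is_derive x (1 : R) ( *%R m) m.
  by rewrite -[X in is_derive _ _ _ X]mulr1; exact: is_deriveZ.
have m2pi : m * (2 * pi) = 0 + (pi *+ 2) *+ k.+1.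
  by rewrite add0r -[in RHS]mulr_natl -[pi *+ 2]mulr_natl.
have contcs (h : R -> R) : continuous h -> continuous (fun x => h (m * x)).
  move=> hc x; apply: continuous_comp; last exact: hc.
  exact: mulrl_continuous.
apply/eqP; rewrite eq_complex; apply/andP; split; apply/eqP.
- apply: (@Rintegral_periodic_derivative (fun x => c * m^-1 * sin (m * x))).
  + by move=> x; apply: cvgM; [exact: cvg_cst|exact/contcs/continuous_cos].
  + move=> x; have := is_deriveZ (c * m^-1) (is_derive1_comp (is_derive_sin (m * x)) (dm x)).
    by move=> /is_derive_eq; apply; rewrite /GRing.scale/=; field.
  + by rewrite m2pi (periodicn (@sinD2pi R)) mulr0.
- apply: (@Rintegral_periodic_derivative (fun x => c * m^-1 * cos (m * x))).
  + move=> x; apply: cvgN; apply: cvgM; [exact: cvg_cst|exact/contcs/continuous_sin].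
  + move=> x; have := is_deriveZ (c * m^-1) (is_derive1_comp (is_derive_cos (m * x)) (dm x)).
    by move=> /is_derive_eq; apply; rewrite /GRing.scale/=; field.
  + by rewrite m2pi (periodicn (@cosD2pi R)) mulr0.
Qed.
End CircleIntegral.

Section CircleMeanValue.
Context {R : realType}.
Implicit Types (p : {poly R[i]}).
Local Notation Re := complex.Re.
Local Notation Im := complex.Im.
Local Notation normc := ComplexField.Normc.normc.
Import ComplexField.Normc.

(** As [lam] runs over a circle of radius [1/r], [lam^-1] runs over this one, clockwise; hence the
    sign of the sine. *)
Definition rcircle (r x : R) : R[i] := Complex (r * cos x) (- (r * sin x)).

Lemma rcircleV (r x : R) : (circle r x)^-1 = rcircle r^-1 x.
Proof.
rewrite /circle /rcircle; apply/eqP; rewrite eq_complex/=.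
rewrite !exprMn -mulrDr cos2Dsin2 mulr1.
have [->|r0] := eqVneq r 0; first by rewrite !(invr0, mul0r, oppr0, mulr0) eqxx.
by apply/andP; split; apply/eqP; field.
Qed.

Lemma normc_rcircle (r x : R) : 0 <= r -> normc (rcircle r x) = r.
Proof.
move=> r0; rewrite /= sqrrN !exprMn -mulrDr cos2Dsin2 mulr1 sqrtr_sqr.
by rewrite ger0_norm.
Qed.

Lemma ccont_rcircle r : ccont (rcircle r).
Proof.
split=> x /=.
  by apply: cvgM; [exact: cvg_cst|exact: continuous_cos].
by apply: cvgN; apply: cvgM; [exact: cvg_cst|exact: continuous_sin].
Qed.

Lemma geometric_bound (q y C : R) : 0 <= q < 1 ->
  (forall k, y <= q ^+ k * C) -> y <= 0.
Proof.
move=> /andP[q0 q1] yq.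
have : (fun k => q ^+ k * C) @ \oo --> 0 * C.
  by apply: cvgM; [apply: cvg_expr; rewrite ger0_norm|exact: cvg_cst].
rewrite mul0r => cv; have <- := cvg_lim _ cv; last exact: norm_hausdorff.
apply: limr_ge; first by apply/cvg_ex; exists 0.
exact: nearW.
Qed.

Lemma cint_rcircle_poly (r : R) p :
  cint (fun x => rcircle r x * p.[rcircle r x]) = 0.
Proof.
have -> : (fun x => rcircle r x * p.[rcircle r x]) =
   (fun x => \sum_(i < size p) p`_i * rcircle r x ^+ i.+1).
  apply/funext => x; rewrite horner_coef mulr_sumr; apply: eq_bigr => i _.
  by rewrite exprS mulrCA.
have ce i : ccont (fun x => rcircle r x ^+ i) by exact/ccontX/ccont_rcircle.
rewrite cint_sum; last by move=> i; apply: ccontM => //; exact: ccont_cst.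
by apply: big1 => i _; rewrite cintZ// cint_expw mulr0.
Qed.

Lemma ccont_rational (r : R) (s : seq R[i]) p : 0 <= r ->
  (forall a, a \in s -> normc a * r < 1) ->
  ccont (fun x => rcircle r x * p.[rcircle r x] / \prod_(a <- s) (1 - a * rcircle r x)).
Proof.
move=> r0 sr.
have cw := ccont_rcircle r.
apply: ccontM; first by apply: ccontM => //; exact: ccont_horner.
apply: ccontV.
  elim: s {sr} => [|a s IH].
    by under eq_fun do rewrite big_nil; exact: ccont_cst.
  under eq_fun do rewrite big_cons; apply: ccontM => //.
  apply: (@ccontD _ (fun=> 1) (fun x => - (a * rcircle r x))); first exact: ccont_cst.
  under eq_fun do rewrite -mulNr; apply: ccontM => //; exact: ccont_cst.
move=> x; rewrite prodf_seq_neq0; apply/allP => a /sr; apply: contraTneq => /eqP.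
rewrite subr_eq0 => /eqP /(congr1 (@normc R)); rewrite normc1 normcM normc_rcircle// => <-.
by rewrite ltxx.
Qed.

(* Expanding one factor as [1 / (1 - a w) = 1 + a w / (1 - a w)] relates the
   integral for [p] to [a] times the integral for ['X * p]; iterating gains
   a factor [a r] of modulus less than 1 each time. *)
Lemma cint_rational_eq0 (r : R) (s : seq R[i]) p : 0 <= r ->
  (forall a, a \in s -> normc a * r < 1) ->
  cint (fun x => rcircle r x * p.[rcircle r x] / \prod_(a <- s) (1 - a * rcircle r x)) = 0.
Proof.
move=> r0; elim: s p => [|a s IH] p sr.
  under eq_fun do rewrite big_nil divr1; exact: cint_rcircle_poly.
have srs b : b \in s -> normc b * r < 1 by move=> bs; apply: sr; rewrite inE bs orbT.
have ar : normc a * r < 1 by apply: sr; rewrite mem_head.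
have cr q := @ccont_rational r (a :: s) q r0 sr.
have crs q := @ccont_rational r s q r0 srs.
pose I q := cint (fun x => rcircle r x * q.[rcircle r x] /
  \prod_(a <- a :: s) (1 - a * rcircle r x)).
have step q : I q = a * I ('X * q).
  rewrite -cintZ//; rewrite /I -[RHS]add0r -(IH q srs) -cintD//; last first.
    by apply: ccontM => //; exact: ccont_cst.
  congr cint; apply/funext => x; rewrite !big_cons hornerM hornerX.
  set w := rcircle r x.
  have w0 : 1 - a * w != 0.
    apply: contraTneq ar => /eqP; rewrite subr_eq0 => /eqP /(congr1 (@normc R)).
    by rewrite normc1 normcM normc_rcircle// => <-; rewrite ltxx.
  rewrite invfM; set Q := (\prod_(j <- s) _)^-1.
  by field.
have stepk k : I p = a ^+ k * I ('X^k * p).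
  elim: k => [|k IHk]; first by rewrite !expr0 !mul1r.
  by rewrite IHk step mulrA -exprSr mulrA -exprS.
have [M M0 Mb] := ccont_bounded _ (cr p).
apply/eq0_normc/eqP; rewrite eq_le; apply/andP; split; last first.
  by rewrite -/(I p); case: (I p) => ? ?; exact: sqrtr_ge0.
apply: (@geometric_bound (normc a * r) _ (2 * (M * (2 * pi)))).
  by rewrite ar mulr_ge0//; case: (a) => ? ?; exact: sqrtr_ge0.
move=> k; rewrite -/(I p) (stepk k) normcM.
have -> : normc (a ^+ k) = normc a ^+ k.
  by elim: k => [|k IHk]; rewrite ?expr0 ?normc1// !exprS normcM IHk.
rewrite exprMn -mulrA ler_wpM2l ?exprn_ge0//; first by case: (a) => ? ?; exact: sqrtr_ge0.
have -> : r ^+ k * (2 * (M * (2 * pi))) = 2 * (r ^+ k * M * (2 * pi)) by ring.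
apply: cint_bound => // x xI.
have -> : rcircle r x * ('X^k * p).[rcircle r x] / \prod_(a <- a :: s) (1 - a * rcircle r x) =
   rcircle r x ^+ k * (rcircle r x * p.[rcircle r x] / \prod_(a <- a :: s) (1 - a * rcircle r x)).
  by rewrite hornerM hornerXn; ring.
rewrite normcM; have -> : normc (rcircle r x ^+ k) = r ^+ k.
  by elim: k => [|k IHk]; rewrite ?expr0 ?normc1// !exprS normcM IHk normc_rcircle.
by rewrite ler_wpM2l ?exprn_ge0// Mb.
Qed.

(** The mean value property for [p/q], which has no pole in the closed disc. Subtracting
    [(p(0)/q(0)) q] from [p] leaves a numerator divisible by ['X], and such quotients have mean
    0. *)
Lemma cint_rational (r : R) (p q : {poly R[i]}) : 0 <= r ->
  (forall w, normc w <= r -> q.[w] != 0) ->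
  ccont (fun x => p.[rcircle r x] / q.[rcircle r x]) /\
  cint (fun x => p.[rcircle r x] / q.[rcircle r x]) =
  (2 * real_complex R pi) * (p.[0] / q.[0]).
Proof.
move=> r0 q0.
have [s qE] := closed_field_poly_normal q.
have q00 : q.[0] != 0 by apply: q0; rewrite normc0.
have lq0 : lead_coef q != 0.
  by rewrite lead_coef_eq0; apply: contra_neq q00 => ->; rewrite horner0.
have sr z : z \in s -> r < normc z.
  move=> zs; rewrite ltNge; apply: contraL zs => /q0.
  rewrite qE hornerZ mulf_eq0 negb_or => /andP[_].
  by rewrite -[_ == _]/(root _ z) root_prod_XsubC.
have s0 z : z \in s -> z != 0.
  by move=> /sr; apply: contraTneq => ->; rewrite normc0 -leNgt.
(* Normalising by [q(0)] instead of the leading coefficient gives factors [1 - a w], with [a] the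
   inverse of a root, so that [|a| r < 1]. *)
have qw w : q.[w] = q.[0] * \prod_(a <- map (fun z => z^-1) s) (1 - a * w).
  rewrite qE !hornerZ -mulrA; congr (_ * _); rewrite big_map !horner_prod.
  rewrite -big_split/= !big_seq; apply: eq_bigr => z /s0 z0.
  by rewrite !hornerXsubC; field.
have sr' a : a \in map (fun z => z^-1) s -> normc a * r < 1.
  move=> /mapP[z zs ->]; rewrite normcV; have zr := sr z zs.
  by rewrite mulrC ltr_pdivrMr ?mul1r// (le_lt_trans r0).
pose p' := p - (p.[0] / q.[0]) *: q.
have /factor_theorem[p2 p2E] : root p' 0.
  by rewrite /root !hornerE mulrVK ?unitfE// subrr.
have E : (fun x => p.[rcircle r x] / q.[rcircle r x]) =
  (fun x => p.[0] / q.[0] + q.[0]^-1 *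
     (rcircle r x * p2.[rcircle r x] / \prod_(a <- map (fun z => z^-1) s) (1 - a * rcircle r x))).
  apply/funext => x; set w := rcircle r x.
  have w0 : q.[w] != 0 by apply: q0; rewrite normc_rcircle.
  have -> : p.[w] = p'.[w] + p.[0] / q.[0] * q.[w].
    by rewrite /p' !hornerE subrK.
  rewrite mulrDl mulfK// addrC p2E; congr (_ + _).
  by rewrite hornerM hornerXsubC subr0 (qw w) invfM; ring.
rewrite E; have c2 := @ccont_rational r _ p2 r0 sr'.
split.
  by apply: ccontD; [|apply: ccontM => //]; exact: ccont_cst.
rewrite cintD; [|exact: ccont_cst|by apply: ccontM => //; exact: ccont_cst].
by rewrite cint_cst cintZ// cint_rational_eq0// mulr0 addr0.
Qed.
End CircleMeanValue.

(** * The spectral projectors *)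

Section ResolventMean.
Context {R : realType}.
Local Notation C := R[i].
Local Notation normc := ComplexField.Normc.normc.
Import ComplexField.Normc.

(** By Cramer's rule the entries of [(1 + w L)^-1] are rational in [w = lam^-1], with denominator
    [det (1 + w L)]. The factor [lam^-1] cancels the [lam] in [d lam = i lam d theta], so the
    integral is a mean over a circle, given by the value at [w = 0]. *)
Lemma circle_integral_mx_mean n (L M1 M2 : 'M[C]_n) (r : R) : 0 < r ->
  (forall w : C, normc w <= r^-1 -> 1%:M + w *: L \in unitmx) ->
  circle_integral_mx r
    (fun lam => lam^-1 *: (M1 *m invmx (1%:M + lam^-1 *: L) *m M2)) =
  (2 * real_complex R pi * Complex 0 1) *: (M1 *m M2).
Proof.
move=> r0 Lu; apply/matrixP => j k; rewrite mxE [RHS]mxE.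
pose PL : 'M[{poly C}]_n := 1%:M + 'X *: map_mx polyC L.
pose q := \det PL.
pose p := (map_mx polyC M1 *m \adj PL *m map_mx polyC M2) j k.
have PLw w : map_mx (horner_eval w) PL = 1%:M + w *: L.
  rewrite map_mxD map_mx1 map_mxZ /= /horner_eval hornerX; congr (_ + _ *: _).
  by apply/matrixP => a b; rewrite !mxE /= hornerC.
have qw w : q.[w] = \det (1%:M + w *: L).
  by rewrite -PLw det_map_mx.
have Mw (M : 'M[C]_n) w : map_mx (horner_eval w) (map_mx polyC M) = M.
  by apply/matrixP => a b; rewrite !mxE /= /horner_eval hornerC.
have pw w : p.[w] = (M1 *m \adj (1%:M + w *: L) *m M2) j k.
  rewrite -PLw -map_mx_adj -{1}(Mw M1 w) -{1}(Mw M2 w) -!map_mxM.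
  by rewrite [RHS]mxE.
have r0' : 0 <= r^-1 by rewrite invr_ge0 ltW.
have q0 w : normc w <= r^-1 -> q.[w] != 0.
  by move=> /Lu; rewrite unitmxE unitfE qw.
have [cc ci] := @cint_rational R r^-1 p q r0' q0.
transitivity (Complex 0 1 * cint (fun x => p.[rcircle r^-1 x] / q.[rcircle r^-1 x])).
  rewrite -cintZ//; rewrite /circle_integral -/(cint _); congr cint.
  apply/funext => x; rewrite rcircleV; set w := rcircle r^-1 x.
  have wr : normc w <= r^-1 by rewrite normc_rcircle.
  have lamE : circle r x = w^-1 by rewrite -[LHS]invrK rcircleV.
  have w0 : w != 0.
    have : normc w != 0 by rewrite normc_rcircle// invr_neq0// gt_eqF.
    by apply: contra_neq => ->; rewrite normc0.
  rewrite mxE lamE /invmx Lu// -scalemxAr -scalemxAl mxE -pw -qw.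
  have := q0 w wr; set a := p.[_]; set b := q.[_] => b0.
  by field; rewrite w0 b0.
rewrite ci qw pw scale0r addr0 det1 divr1.
have -> : \adj (1%:M : 'M[C]_n) = 1%:M.
  by rewrite -[LHS]mul1mx mul_mx_adj det1.
by rewrite mulmx1; ring.
Qed.

End ResolventMean.

Lemma drop_low_coefs {F : fieldType} {p : {poly F}} {j} :
  (forall i, (i < j)%N -> p`_i = 0) -> p = drop_poly j p * 'X^j.
Proof.
move=> p0; rewrite -[LHS](@poly_take_drop _ j) [take_poly j p](_ : _ = 0) ?add0r//.
by apply/polyP => i; rewrite coef_take_poly coef0; case: ifP => // /p0.
Qed.

Section GroupInverse.
Context {F : fieldType} {n : nat}.
Implicit Types K M : 'M[F]_n.+1.

(* If [char_poly K = q * 'X^m] with [c] its coefficients, this is [q(K) / q(0)];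
   when [K^2] and [K] have the same kernel it projects onto [ker K] along
   [im K]. *)
Definition kernel_projector (c : nat -> F) (m : nat) K : 'M[F]_n.+1 :=
  (c m)^-1 *: \sum_(i < n.+2) c (m + i)%N *: K ^+ i.

(** Cayley-Hamilton gives [K^m q(K) = 0], and the kernel hypothesis lowers [K^m] to [K], so
    [K E = 0]. Since [q(X) - q(0)] is divisible by [X], [E = 1 + K s] with [s] a polynomial in [K],
    and the remaining identities follow. [Ks] is the group inverse of [K]. *)
Lemma kernel_projectorP K m :
  (forall M, K * (K * M) = 0 -> K * M = 0) ->
  (forall i, (i < m)%N -> (char_poly K)`_i = 0) -> (char_poly K)`_m != 0 ->
  let E := kernel_projector (fun i => (char_poly K)`_i) m K in
  exists Ks : 'M[F]_n.+1,
    [/\ K * E = 0, E * K = 0, E * E = E, K * Ks = 1 - E & Ks * K = 1 - E] /\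
    Ks * E = 0 /\ E * Ks = 0.
Proof.
set X := char_poly K => Kker c0 cm E.
pose q := drop_poly m X.
have Xq : X = q * 'X^m by exact: drop_low_coefs.
have sX : size X = n.+2 by rewrite size_char_poly.
have hq (p : {poly F}) : (size p <= n.+2)%N ->
    horner_mx K p = \sum_(i < n.+2) p`_i *: K ^+ i.
  move=> sp; have {1}-> : p = \poly_(i < n.+2) p`_i.
    apply/polyP => i; rewrite coef_poly; case: ltnP => // ni.
    by rewrite nth_default// (leq_trans sp).
  rewrite poly_def rmorph_sum/=; apply: eq_bigr => i _.
  by rewrite horner_mxZ rmorphXn/= horner_mx_X.
have EE : E = (X`_m)^-1 *: horner_mx K q.
  rewrite hq; last by rewrite size_drop_poly sX leq_subr.
  congr (_ *: _); apply: eq_bigr => i _; by rewrite coef_drop_poly addnC.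
have Kpow j M : K ^+ j.+1 * M = 0 -> K * M = 0.
  elim: j M => [|j IH] M; first by rewrite expr1.
  by rewrite exprS exprSr -!mulrA mulrA -exprS => /IH/Kker.
have Kq : K * horner_mx K q = 0.
  have := Cayley_Hamilton K; rewrite -/X Xq rmorphM rmorphXn/= horner_mx_X.
  have -> : horner_mx K q * K ^+ m = K ^+ m * horner_mx K q.
    by have := comm_horner_mx2 K q 'X^m; rewrite rmorphXn/= horner_mx_X.
  case: (m) => [|j]; first by rewrite expr0 mul1r => ->; rewrite mulr0.
  exact: Kpow.
have q0 : q`_0 = X`_m by rewrite coef_drop_poly.
pose r := horner_mx K (drop_poly 1 q).
have rK : r * K = K * r.
  by have := comm_horner_mx2 K (drop_poly 1 q) 'X; rewrite horner_mx_X.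
have qE : horner_mx K q = X`_m *: 1 + K * r.
  rewrite -{1}[q](@poly_take_drop _ 1) expr1 rmorphD rmorphM/= horner_mx_X rK.
  congr (_ + _); rewrite -q0 [take_poly 1 q](_ : _ = (q`_0)%:P).
    by rewrite horner_mx_C -[RHS]/(_ *: 1%:M) scalemx1.
  by apply/polyP => -[|i]; rewrite coef_take_poly coefC.
have E1 : E = 1 + K * ((X`_m)^-1 *: r).
  by rewrite EE qE scalerDr scalerA mulVf// scale1r scalerAr.
set s := _ *: r in E1.
have sK : s * K = K * s by rewrite /s -scalerAl rK scalerAr.
have KE : K * E = 0 by rewrite EE -scalerAr Kq scaler0.
have EK : E * K = 0 by rewrite E1 mulrDl mul1r -mulrA sK -[X in X + _]mulr1 -mulrDr -E1.
have EEE : E * E = E by rewrite {1}E1 mulrDl mul1r -sK -mulrA KE mulr0 addr0.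
have PE : 1 - E = - (K * s) by rewrite E1 opprD addrA subrr add0r.
have PP : (1 - E) * (1 - E) = 1 - E by rewrite mulrBr mulr1 mulrBl mul1r EEE subrr subr0.
have KP : K * (1 - E) = K by rewrite mulrBr mulr1 KE subr0.
have PK : (1 - E) * K = K by rewrite mulrBl mul1r EK subr0.
have PE0 : (1 - E) * E = 0 by rewrite mulrBl mul1r EEE subrr.
have EP : E * (1 - E) = 0 by rewrite mulrBr mulr1 EEE subrr.
(* As [1 - E = - K s], the matrix [- s] inverts [K] on [im K]; the outer factors [1 - E] make the
   inverse vanish on [ker K]. *)
exists (- ((1 - E) * s * (1 - E))); split; split=> //.
- by rewrite mulrN !mulrA KP -mulNr -PE PP.
- by rewrite mulNr -(mulrA _ _ K) PK -(mulrA _ _ K) sK -mulrN -PE PP.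
- by rewrite mulNr -(mulrA _ _ E) PE0 mulr0 oppr0.
- by rewrite mulrN !mulrA EP !mul0r oppr0.
Qed.
End GroupInverse.

Section Projectors.
Context {R : realType} {n : nat}.
Local Notation C := R[i].
Local Notation normc := ComplexField.Normc.normc.
Import ComplexField.Normc.
Local Notation cmx := (map_mx (real_complex R)).
Variables (A B : R -> 'M[R]_n.+1) (C2 : R -> R) (t : R).

Definition shifted_pencil : 'M[R]_n.+1 := C2 t *: A t + B t.
Definition shifted_resolvent : 'M[R]_n.+1 := invmx shifted_pencil *m A t.

Local Notation H := shifted_pencil.
Local Notation K := shifted_resolvent.

Hypothesis C2_gt0 : 0 < C2 t.
Hypothesis pencil_unit : forall lam : C,
  real_complex R (C2 t) <= `|lam| -> pencil A B t lam \in unitmx.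

Lemma normc_norm (z : C) : `|z| = real_complex R (normc z).
Proof. by []. Qed.

Lemma pencil_real (a : R) : pencil A B t (real_complex R a) = cmx (a *: A t + B t).
Proof. by rewrite map_mxD map_mxZ. Qed.

Lemma shifted_pencil_unit : H \in unitmx.
Proof.
rewrite -(map_unitmx (real_complex R)) -pencil_real; apply: pencil_unit.
by rewrite normc_norm lecR /= expr0n addr0 sqrtr_sqr ler_norm.
Qed.

Let Hu := shifted_pencil_unit.

Lemma shifted_AE : A t = H *m K.
Proof. by rewrite mulKVmx. Qed.

Lemma shifted_BE : B t = H *m (1%:M - C2 t *: K).
Proof.
by rewrite mulmxBr mulmx1 -scalemxAr -shifted_AE /shifted_pencil addrC addKr.
Qed.

(** [A] and [B] are both [H] times a polynomial in [K], so the whole pencil at time [t] is governed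
    by the single matrix [K]. *)
Lemma pencil_shiftedE lam : pencil A B t lam =
  cmx H *m (1%:M + (lam - real_complex R (C2 t)) *: cmx K).
Proof.
rewrite /pencil shifted_BE [in LHS]shifted_AE; move: H K => h k.
rewrite !map_mxM map_mxB map_mx1 map_mxZ.
by rewrite mulmxBr mulmxDr -!scalemxAr !mulmx1 scalerBl [LHS]addrCA.
Qed.

Variables (E Ks : 'M[R]_n.+1).
Hypotheses (KE : K * E = 0) (EK : E * K = 0) (EE : E * E = E).
Hypotheses (KsK : Ks * K = 1 - E) (KsE : Ks * E = 0).

Let Kc : 'M[C]_n.+1 := cmx K.
Let Ec : 'M[C]_n.+1 := cmx E.
Let Ksc : 'M[C]_n.+1 := cmx Ks.
Let mu : C := real_complex R (C2 t).
Let L : 'M[C]_n.+1 := Ksc - mu *: (1 - Ec).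
Let V (lam : C) := invmx (1%:M + (lam - mu) *: Kc).

Let T_unit (lam : C) : mu <= `|lam| -> 1%:M + (lam - mu) *: Kc \in unitmx.
Proof.
by move=> /pencil_unit; rewrite pencil_shiftedE unitmx_mul => /andP[].
Qed.

Let cm (M N : 'M[R]_n.+1) : (cmx M : 'M[C]_n.+1) * cmx N = cmx (M * N).
Proof. exact: (esym (map_mxM _ _ _)). Qed.
Let cm0 : cmx (0 : 'M[R]_n.+1) = 0.
Proof. exact: map_mx0. Qed.
Let cm1E : cmx (1 - E) = 1 - Ec.
Proof. by rewrite map_mxB; congr (_ - _); exact: map_mx1. Qed.

(* With [w = lam^-1], [1 + w L] is [w * H^-1 (lam A + B)] on [im K] and the
   identity on [ker K]; unlike the pencil it stays invertible at [w = 0], so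
   the mean value property applies to its inverse. *)
Lemma deflated_inverse (w : C) : w != 0 -> normc w <= (C2 t)^-1 ->
  1%:M + w *: L \in unitmx /\
  (1 - Ec) * invmx (1%:M + w *: L) = w^-1 *: (V w^-1 * Kc) /\
  V w^-1 * Kc = Kc * V w^-1.
Proof.
move=> w0 wC.
have wl : mu <= `|w^-1|.
  rewrite normc_norm lecR normcV -[C2 t]invrK lef_pV2 ?posrE ?invr_gt0//.
  rewrite lt_neqAle; case: (w) w0 => a b /= w0; rewrite sqrtr_ge0 andbT eq_sym.
  by apply: contraNneq w0 => /(@eq0_normc _ (Complex a b))/eqP.
have TV : (1%:M + (w^-1 - mu) *: Kc) * V w^-1 = 1.
  by rewrite -[LHS]/(_ *m invmx _) mulmxV// T_unit.
have VT : V w^-1 * (1%:M + (w^-1 - mu) *: Kc) = 1.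
  by rewrite -[LHS]/(invmx _ *m _) mulVmx// T_unit.
set T := 1%:M + _ in TV VT; set W := V _ in TV VT *.
have TK : T * Kc = Kc * T by rewrite mulrDl mulrDr mul1r mulr1 -scalerAl -scalerAr.
have WK : W * Kc = Kc * W.
  by rewrite -[Kc in LHS]mulr1 -TV !mulrA -(mulrA W) -TK mulrA VT mul1r.
have KsTE : Ksc * T * Ec = 0.
  by rewrite -mulrA mulrDl mul1r -scalerAl cm KE cm0 scaler0 addr0 cm KsE cm0.
(* With [T = H^-1 (lam A + B)], this shows [1 + w L] as a block sum: the identity on [ker K] and
   [w Ks T] on [im K]. The inverse [E + w^-1 W K] used in [main] is read off block by block. *)
have LT : 1%:M + w *: L = Ec + w *: (Ksc * T).
  rewrite mulrDr mulr1 -scalerAr cm KsK cm1E /L.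
  have -> : (1%:M : 'M[C]_n.+1) = Ec + (1 - Ec) by rewrite [RHS]addrC subrK.
  move: (1 - Ec) => P; rewrite scalerBr scalerDr !scalerA mulrBr mulfV//.
  by rewrite scalerBl scale1r -[LHS]addrA; congr (_ + _); rewrite addrCA.
clearbody T.
have main : (1%:M + w *: L) * (Ec + w^-1 *: (W * Kc)) = 1.
  rewrite LT WK mulrDl !mulrDr cm EE -!scalerAl -!scalerAr KsTE.
  have -> : Ec * (Kc * W) = 0 by rewrite mulrA cm EK cm0 mul0r.
  have -> : Ksc * T * (Kc * W) = 1 - Ec.
    by rewrite mulrA -(mulrA _ T Kc) TK mulrA -(mulrA _ T W) TV mulr1 cm KsK cm1E.
  by rewrite !scaler0 addr0 add0r scalerA mulfV// scale1r addrC subrK.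
have [u1 _] := mulmx1_unit main; split => //; split=> //.
have -> : invmx (1%:M + w *: L) = Ec + w^-1 *: (W * Kc).
  by rewrite -[RHS](mulKmx u1) -[X in _ = _ *m X]/(_ * _) main mulmx1.
have PE0 : (1 - Ec) * Ec = 0 by rewrite mulrBl mul1r cm EE subrr.
rewrite mulrDr PE0 add0r -scalerAr mulrBl mul1r WK mulrA cm EK cm0 mul0r.
by rewrite subr0.
Qed.

Lemma deflated_unit (w : C) : normc w <= (C2 t)^-1 -> 1%:M + w *: L \in unitmx.
Proof.
have [->|w0 wC] := eqVneq w 0; first by rewrite scale0r addr0 unitmx1.
exact: (deflated_inverse _ w0 wC).1.
Qed.

Lemma circle_integral_mx_ext (r : R) (f g : C -> 'M[C]_n.+1) :
  (forall x, f (circle r x) = g (circle r x)) ->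
  circle_integral_mx r f = circle_integral_mx r g.
Proof.
move=> fg; apply/matrixP => i j; rewrite !mxE /circle_integral.
by congr Complex; apply: eq_Rintegral => x _; rewrite fg.
Qed.

Lemma circle_wP x : let w := (circle (C2 t) x)^-1 in
  w != 0 /\ normc w <= (C2 t)^-1.
Proof.
cbv zeta; rewrite rcircleV; have Ci : 0 <= (C2 t)^-1 by rewrite invr_ge0 ltW.
have nw := normc_rcircle (C2 t)^-1 x Ci; rewrite nw; split=> //.
have : normc (rcircle (C2 t)^-1 x) != 0 by rewrite nw invr_neq0// gt_eqF.
by apply: contra_neq => ->; rewrite normc0.
Qed.

Let pi_unit : (2 * real_complex R pi * Complex 0 1 : C) != 0.
Proof.
rewrite !mulf_neq0 ?pnatr_eq0//; last by rewrite eq_complex/= oner_eq0 andbF.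
by rewrite fmorph_eq0 gt_eqF ?pi_gt0.
Qed.

Lemma Re_cmx (M : 'M[R]_n.+1) : map_mx (@complex.Re R) (cmx M) = M.
Proof. by apply/matrixP => i j; rewrite !mxE. Qed.

Lemma invmx_pencil lam : mu <= `|lam| ->
  invmx (pencil A B t lam) = V lam * cmx (invmx H).
Proof.
move=> /T_unit Tu; rewrite pencil_shiftedE.
have Hcu : cmx H \in unitmx by rewrite map_unitmx.
transitivity (V lam * invmx (cmx H)); first exact: invrM.
by congr (_ * _); exact: (esym (map_invmx _ _)).
Qed.

Lemma circle_norm x : mu <= `|circle (C2 t) x|.
Proof.
rewrite normc_norm lecR /= !exprMn -mulrDr cos2Dsin2 mulr1 sqrtr_sqr.
exact: ler_norm.
Qed.

Lemma deflated_circle (x : R) (lam := circle (C2 t) x) :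
  lam^-1 *: ((1 - Ec) * invmx (1%:M + lam^-1 *: L)) = V lam * Kc /\
  V lam * Kc = Kc * V lam.
Proof.
have [] := circle_wP x; rewrite -/lam => w0 wC.
have [_ [-> VK]] := deflated_inverse _ w0 wC; move: VK; rewrite invrK => VK.
have l0 : lam != 0 by rewrite -invr_eq0.
by split=> //; rewrite scalerA mulVf// scale1r.
Qed.

(** On the circle [(lam A + B)^-1 A] equals [lam^-1 (1 - E) (1 + lam^-1 L)^-1], and the mean value
    property evaluates the last factor at [lam^-1 = 0], where it is the identity. *)
Lemma P1_shifted : P1 A B C2 t = 1 - E.
Proof.
rewrite /P1 /P1C.
rewrite (@circle_integral_mx_ext _ _
  (fun lam => lam^-1 *: ((1 - Ec) *m invmx (1%:M + lam^-1 *: L) *m 1%:M))).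
  rewrite (circle_integral_mx_mean _ _ _ _ _ C2_gt0 deflated_unit).
  by rewrite scalerA mulVf// scale1r mulmx1 -cm1E Re_cmx.
move=> x; rewrite mulmx1; transitivity (V (circle (C2 t) x) * Kc); last first.
  exact: (esym (deflated_circle x).1).
rewrite invmx_pencil ?circle_norm// [in LHS]shifted_AE map_mxM.
transitivity (V (circle (C2 t) x) * (cmx (invmx H) * (cmx H * Kc))).
  exact: (esym (mulrA _ _ _)).
congr (_ * _); rewrite mulrA cm.
have -> : invmx H * H = 1 by exact: mulVmx.
by rewrite -[RHS]mul1r; congr (_ * _); exact: map_mx1.
Qed.

(** The integrand is [H K V H^-1]. Because [V] commutes with [K], it is the integrand of [P1]
    conjugated by [H]. *)
Lemma Q1_shifted : Q1 A B C2 t = H * (1 - E) * invmx H.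
Proof.
rewrite /Q1 /Q1C.
rewrite (@circle_integral_mx_ext _ _ (fun lam => lam^-1 *:
    ((cmx H * (1 - Ec)) *m invmx (1%:M + lam^-1 *: L) *m cmx (invmx H)))).
  rewrite (circle_integral_mx_mean _ _ _ _ _ C2_gt0 deflated_unit).
  rewrite scalerA mulVf// scale1r -cm1E.
  transitivity (map_mx (@complex.Re R) (cmx (H * (1 - E) * invmx H))).
    by rewrite !map_mxM.
  exact: Re_cmx.
move=> x; have [d1 d2] := deflated_circle x.
set lam := circle _ x in d1 d2 *.
transitivity (cmx H * (V lam * Kc) * cmx (invmx H)); last first.
  rewrite -d1 -scalerAr -scalerAl; congr (_ *: _).
  by rewrite mulrA.
rewrite d2 invmx_pencil ?circle_norm// [in LHS]shifted_AE map_mxM.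
transitivity (cmx H * Kc * (V lam * cmx (invmx H))); first by [].
by rewrite !mulrA.
Qed.

End Projectors.

(** * Operator norm and consequences of the resolvent bound *)

Lemma sqrt_sum_sqr_le (R : rcfType) (I : finType) (a : I -> R) :
  (forall i, 0 <= a i) -> Num.sqrt (\sum_i a i ^+ 2) <= \sum_i a i.
Proof.
move=> a0; have s0 : 0 <= \sum_i a i by exact: sumr_ge0.
rewrite -[leRHS](ger0_norm s0) -sqrtr_sqr ler_wsqrtr// expr2 mulr_suml.
apply: ler_sum => i _; rewrite expr2 ler_wpM2l// (bigD1 i)//= lerDl.
exact: sumr_ge0.
Qed.

Section OperatorNorm.
Context {R : realType} {n : nat}.
Local Notation C := R[i].
Local Notation normc := ComplexField.Normc.normc.
Import ComplexField.Normc.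
Implicit Types (u : 'cV[C]_n).

Lemma normc_ge0 (z : C) : 0 <= normc z.
Proof. by case: z => ? ?; exact: sqrtr_ge0. Qed.

Lemma normc_sqr (z : C) : normc z ^+ 2 = complex.Re z ^+ 2 + complex.Im z ^+ 2.
Proof. by case: z => a b /=; rewrite sqr_sqrtr// addr_ge0 ?sqr_ge0. Qed.

Lemma cnormE u : cnorm u = Num.sqrt (\sum_i normc (u i 0) ^+ 2).
Proof. by congr Num.sqrt; apply: eq_bigr => i _; rewrite normc_sqr. Qed.

Lemma normc_le_cnorm u i : normc (u i 0) <= cnorm u.
Proof.
rewrite cnormE -[leLHS](ger0_norm (normc_ge0 _)) -sqrtr_sqr ler_wsqrtr//.
by rewrite (bigD1 i)//= lerDl sumr_ge0// => j _; exact: sqr_ge0.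
Qed.

Lemma cnorm_le_sum u : cnorm u <= \sum_i normc (u i 0).
Proof. by rewrite cnormE; apply: sqrt_sum_sqr_le => i; exact: normc_ge0. Qed.

Lemma cnormZ (a : R) u : 0 <= a -> cnorm (real_complex R a *: u) = a * cnorm u.
Proof.
move=> a0; rewrite !cnormE -[a in RHS](ger0_norm a0) -sqrtr_sqr -sqrtrM ?sqr_ge0//.
congr Num.sqrt; rewrite mulr_sumr; apply: eq_bigr => i _.
rewrite mxE normcM exprMn; congr (_ * _).
by rewrite /= expr0n addr0 sqrtr_sqr real_normK// num_real.
Qed.

Lemma normc_sum (I : finType) (F : I -> C) : normc (\sum_i F i) <= \sum_i normc (F i).
Proof.
elim/big_rec2 : _ => [|i y x _ yx]; first by rewrite normc0.
by apply: le_trans (le_normcD _ _) _; rewrite lerD2l.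
Qed.

(** The [+ 1] keeps the rescaling factor positive even at [u = 0]; the intended use only needs the
    images of one fixed vector to stay bounded. *)
Lemma cnorm_mulmx_le (M : 'M[C]_n) u : cnorm (M *m u) <= opnorm M * (cnorm u + 1).
Proof.
have cu : 0 < cnorm u + 1 by rewrite ltr_pwDr// sqrtr_ge0.
pose v := real_complex R (cnorm u + 1)^-1 *: u.
have uv : u = real_complex R (cnorm u + 1) *: v.
  rewrite /v scalerA -rmorphM/= mulfV ?gt_eqF//.
  by rewrite (_ : real_complex R 1 = 1)// scale1r.
rewrite [in leLHS]uv -scalemxAr cnormZ; last exact: ltW.
rewrite mulrC ler_wpM2r//; first exact: ltW.
apply: ub_le_sup; last first.
  exists v => //=; rewrite cnormZ; last by rewrite invr_ge0 ltW.
  rewrite mulrC ler_pdivrMr// mul1r.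
  by rewrite lerDl.
(* The set whose supremum is [opnorm M] must be bounded above for the supremum to dominate its
   elements. *)
exists (\sum_i \sum_j normc (M i j)) => _ [w /= w1 <-].
apply: le_trans (cnorm_le_sum _) _; apply: ler_sum => i _; rewrite mxE.
apply: le_trans (normc_sum _ _) _; apply: ler_sum => j _; rewrite normcM.
by rewrite ler_piMr ?normc_ge0// (le_trans (normc_le_cnorm _ _)).
Qed.

End OperatorNorm.

Section BoundedResolvent.
Context {R : realType} {n : nat}.
Local Notation C := R[i].
Local Notation normc := ComplexField.Normc.normc.
Import ComplexField.Normc.
Local Notation cmx := (map_mx (real_complex R)).
Variables (A B : R -> 'M[R]_n.+1) (C2 : R -> R) (t : R).
Local Notation H := (shifted_pencil A B C2 t).
Local Notation K := (shifted_resolvent A B C2 t).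

Hypothesis C2_gt0 : 0 < C2 t.

(* If [K^2 v = 0] then the resolvent at [C2 + s] maps [H v] to [v - s K v],
   which stays bounded only if [K v = 0]. *)
Lemma bounded_resolvent_ker (C1 : R) :
  (forall lam : C, real_complex R (C2 t) <= `|lam| ->
     pencil A B t lam \in unitmx /\ opnorm (invmx (pencil A B t lam)) <= C1) ->
  forall M, K * (K * M) = 0 -> K * M = 0.
Proof.
move=> bd.
have pu lam : real_complex R (C2 t) <= `|lam| -> pencil A B t lam \in unitmx.
  by move=> /bd[].
have Hu := shifted_pencil_unit _ _ _ _ pu.
suff Kv (v : 'cV[R]_n.+1) : K *m (K *m v) = 0 -> K *m v = 0.
  move=> M KKM; apply/matrixP => i j.
  have : K *m (K *m col j M) = 0.
    have KKM' : K *m (K *m M) = 0 by [].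
    by rewrite colE (mulmxA K M) mulmxA KKM' mul0mx.
  by move=> /Kv /matrixP/(_ i 0); rewrite colE mulmxA -colE !mxE.
move=> KKv; apply/matrixP => i j; rewrite ord1 [RHS]mxE.
pose Q := C1 * (cnorm (cmx (H *m v)) + 1) + `|v i 0|.
have bound (s : R) : 0 <= s -> s * `|(K *m v) i 0| <= Q.
  move=> s0; pose lam : C := real_complex R (C2 t + s).
  have laml : real_complex R (C2 t) <= `|lam|.
    rewrite normc_norm lecR /= expr0n addr0 sqrtr_sqr.
    by apply: le_trans (ler_norm _); rewrite lerDl.
  have [u b] := bd _ laml.
  have e : pencil A B t lam *m cmx (v - s *: (K *m v)) = cmx (H *m v).
    rewrite pencil_real -map_mxM; congr (cmx _).
    have -> : (C2 t + s) *: A t + B t = H + s *: (H *m K).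
      by rewrite -(shifted_AE A B C2 t pu) /shifted_pencil scalerDl addrAC.
    move: (H) (K) KKv => h k kkv.
    rewrite mulmxDl !mulmxBr -!scalemxAr -!scalemxAl -!mulmxA kkv !(mulmx0, scaler0) subr0.
    by rewrite subrK.
  have e2 : cmx (v - s *: (K *m v)) = invmx (pencil A B t lam) *m cmx (H *m v).
    by rewrite -e mulKmx.
  have := normc_le_cnorm (cmx (v - s *: (K *m v))) i.
  rewrite [in leRHS]e2 => /le_trans/(_ (cnorm_mulmx_le _ _)) le1.
  have {le1} : `|v i 0 - s * (K *m v) i 0| <= C1 * (cnorm (cmx (H *m v)) + 1).
    have -> : `|v i 0 - s * (K *m v) i 0| = normc (cmx (v - s *: (K *m v)) i 0).
      by rewrite !mxE /= expr0n addr0 sqrtr_sqr.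
    apply: le_trans le1 _; rewrite ler_wpM2r//; last exact: addr_ge0 (sqrtr_ge0 _) ler01.
  move=> le1; rewrite -[s]ger0_norm// -normrM.
  have -> : s * (K *m v) i 0 = v i 0 - (v i 0 - s * (K *m v) i 0) by rewrite subKr.
  by apply: le_trans (ler_normB _ _) _; rewrite addrC lerD2r.
apply/eqP; apply: contraT => k0; have k1 : 0 < `|(K *m v) i 0| by rewrite normr_gt0.
have Q0 : 0 <= Q by have := bound 0 (lexx _); rewrite mul0r.
have := bound ((Q + 1) / `|(K *m v) i 0|).
rewrite divfK ?gt_eqF// => /(_ _)/wrap[]; first by rewrite divr_ge0// addr_ge0.
by rewrite leNgt ltrDl ltr01.
Qed.

(** A nonzero eigenvalue [k] of [K] makes the pencil singular at [lam = C2 - k^-1]. If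
    [|k| < 1/(2 C2)], then [|lam| >= 1/|k| - C2 > C2], where the pencil is invertible. *)
Lemma shifted_eigenvalue_gt (k : C) :
  (forall lam : C, real_complex R (C2 t) <= `|lam| -> pencil A B t lam \in unitmx) ->
  k != 0 -> root (char_poly (cmx K)) k -> (2 * C2 t)^-1 <= normc k.
Proof.
move=> pu k0; rewrite -eigenvalue_root_char => /eigenvalueP[v vk v0].
rewrite leNgt; apply/negP => kC.
pose lam : C := real_complex R (C2 t) - k^-1.
have : real_complex R (C2 t) <= `|lam|.
  have : `|k^-1| - real_complex R (C2 t) <= `|lam|.
    rewrite /lam distrC; apply: le_trans (lerB_dist _ _); rewrite lerD2l lerN2.
    by rewrite normc_norm lecR /= expr0n addr0 sqrtr_sqr ger0_norm// ltW.
  apply: le_trans; rewrite normc_norm -rmorphB lecR normcV.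
  rewrite lerBrDr -mulr2n -mulr_natl -[2 * C2 t]invrK lef_pV2 ?posrE; first exact: ltW.
    by rewrite invr_gt0 mulr_gt0.
  by rewrite lt_neqAle normc_ge0 andbT eq_sym; apply: contraNneq k0 => /eq0_normc ->.
move=> /pu; rewrite (pencil_shiftedE A B C2 t pu) unitmx_mul => /andP[_].
rewrite /lam addrAC subrr add0r => Tu.
move/eqP: v0; apply; rewrite -[v](mulmxK Tu) mulmxDr mulmx1 -scalemxAr vk.
by rewrite scalerA mulNr mulVf// scaleN1r subrr mul0mx.
Qed.

End BoundedResolvent.

Set Implicit Arguments.
Unset Strict Implicit.
Unset Printing Implicit Defensive.

(** * Smoothness of matrix functions *)

(** Continuity and continuous differentiability are both stable under field operations, and
    determinants, inverses and characteristic coefficients are built from these. Abstracting the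
    class transfers both properties to matrices at once. [fc_ext] looks only at [D], because the
    formulas for the projectors hold only there. *)
Record function_class {T : Type} {R : realType} (D : set T) (S : (T -> R) -> Prop) := {
  fc_ext : forall f g, (forall x, D x -> f x = g x) -> S f -> S g;
  fc_cst : forall c, S (fun=> c);
  fc_add : forall f g, S f -> S g -> S (fun x => f x + g x);
  fc_mul : forall f g, S f -> S g -> S (fun x => f x * g x);
  fc_inv : forall f, (forall x, D x -> f x != 0) -> S f -> S (fun x => (f x)^-1)
}.

Section FunctionClass.
Context {T : Type} {R : realType} (D : set T) (S : (T -> R) -> Prop).
Hypothesis fc : function_class D S.

Definition mx_class {m n} (F : T -> 'M[R]_(m, n)) := forall i j, S (fun x => F x i j).

Lemma fc_opp f : S f -> S (fun x => - f x).
Proof.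
move=> Sf; under eq_fun do rewrite -mulN1r.
exact: (fc_mul fc (fc_cst fc (-1)) Sf).
Qed.

Lemma fc_exp f k : S f -> S (fun x => f x ^+ k).
Proof.
move=> Sf; elim: k => [|k IH].
  by under eq_fun do rewrite expr0; exact: (fc_cst fc).
by under eq_fun do rewrite exprS; exact: (fc_mul fc).
Qed.

Lemma fc_sum (I : Type) (r : seq I) (P : pred I) (F : I -> T -> R) :
  (forall i, S (F i)) -> S (fun x => \sum_(i <- r | P i) F i x).
Proof.
move=> SF; elim: r => [|i r IH].
  by under eq_fun do rewrite big_nil; exact: (fc_cst fc).
by under eq_fun do rewrite big_cons; case: (P i) => //; exact: (fc_add fc).
Qed.

Lemma fc_prod (I : Type) (r : seq I) (P : pred I) (F : I -> T -> R) :
  (forall i, S (F i)) -> S (fun x => \prod_(i <- r | P i) F i x).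
Proof.
move=> SF; elim: r => [|i r IH].
  by under eq_fun do rewrite big_nil; exact: (fc_cst fc).
by under eq_fun do rewrite big_cons; case: (P i) => //; exact: (fc_mul fc).
Qed.

Lemma mxc_ext {m n} (F G : T -> 'M[R]_(m, n)) :
  (forall x, D x -> F x = G x) -> mx_class F -> mx_class G.
Proof. by move=> FG SF i j; apply: (fc_ext fc) (SF i j) => x /FG ->. Qed.

Lemma mxc_cst {m n} (M : 'M[R]_(m, n)) : mx_class (fun=> M).
Proof. by move=> i j; exact: (fc_cst fc). Qed.

Lemma mxc_add {m n} (F G : T -> 'M[R]_(m, n)) :
  mx_class F -> mx_class G -> mx_class (fun x => F x + G x).
Proof. by move=> SF SG i j; under eq_fun do rewrite mxE; exact: (fc_add fc). Qed.

Lemma mxc_sub {m n} (F G : T -> 'M[R]_(m, n)) :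
  mx_class F -> mx_class G -> mx_class (fun x => F x - G x).
Proof.
move=> SF SG i j; under eq_fun do rewrite !mxE; apply: (fc_add fc) => //.
exact: fc_opp.
Qed.

Lemma mxc_scale {m n} (f : T -> R) (F : T -> 'M[R]_(m, n)) :
  S f -> mx_class F -> mx_class (fun x => f x *: F x).
Proof. by move=> Sf SF i j; under eq_fun do rewrite mxE; exact: (fc_mul fc). Qed.

Lemma mxc_mul {m n p} (F : T -> 'M[R]_(m, n)) (G : T -> 'M[R]_(n, p)) :
  mx_class F -> mx_class G -> mx_class (fun x => F x *m G x).
Proof.
move=> SF SG i j; under eq_fun do rewrite mxE.
by apply: fc_sum => k; exact: (fc_mul fc).
Qed.

Lemma mxc_sum {m n} (I : Type) (r : seq I) (F : I -> T -> 'M[R]_(m, n)) :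
  (forall i, mx_class (F i)) -> mx_class (fun x => \sum_(i <- r) F i x).
Proof.
move=> SF i j; under eq_fun do rewrite summxE.
by apply: fc_sum => k; exact: SF.
Qed.

Lemma mxc_exp {n} (F : T -> 'M[R]_n.+1) k :
  mx_class F -> mx_class (fun x => F x ^+ k).
Proof.
move=> SF; elim: k => [|k IH].
  by under eq_fun do rewrite expr0; exact: mxc_cst.
by under eq_fun do rewrite exprS -mulmxE; exact: mxc_mul.
Qed.

Lemma fc_det {n} (F : T -> 'M[R]_n) : mx_class F -> S (fun x => \det (F x)).
Proof.
move=> SF; rewrite /determinant; apply: fc_sum => s.
by apply: (fc_mul fc (fc_cst fc _)); apply: fc_prod => i; exact: SF.
Qed.

Lemma mxc_invmx {n} (F : T -> 'M[R]_n) : (forall x, D x -> F x \in unitmx) ->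
  mx_class F -> mx_class (fun x => invmx (F x)).
Proof.
move=> Fu SF; apply: (@mxc_ext _ _ (fun x => (\det (F x))^-1 *: \adj (F x))).
  by move=> x /Fu; rewrite /invmx => ->.
apply: mxc_scale.
  apply: (fc_inv fc); last exact: fc_det.
  by move=> x /Fu; rewrite unitmxE unitfE.
move=> i j; under eq_fun do rewrite mxE /cofactor.
apply: (fc_mul fc (fc_cst fc _)).
by apply: fc_det => a b; under eq_fun do rewrite !mxE; exact: SF.
Qed.

(** The determinant lives over [{poly R}], so the Leibniz expansion is followed through polynomials
    all of whose coefficients belong to the class. *)
Lemma fc_char_poly {n} (F : T -> 'M[R]_n) k : mx_class F ->
  S (fun x => (char_poly (F x))`_k).
Proof.
move=> SF; rewrite /char_poly /determinant.
under eq_fun do rewrite coef_sum; apply: fc_sum => s.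
pose PS (p : T -> {poly R}) := forall k, S (fun x => (p x)`_k).
have PM p q : PS p -> PS q -> PS (fun x => p x * q x).
  move=> Sp Sq i; under eq_fun do rewrite coefM.
  by apply: fc_sum => j; exact: (fc_mul fc).
have Pc (p : {poly R}) : PS (fun=> p) by move=> i; exact: (fc_cst fc).
suff gen (c : {poly R}) (e : 'I_n -> 'I_n) :
    PS (fun x => c * \prod_(i < n) char_poly_mx (F x) i (e i)) by exact: gen.
apply: (PM (fun=> c)); first exact: Pc.
elim: (index_enum _) => [|i r IH].
  by under eq_fun do rewrite big_nil; exact: Pc.
under eq_fun do rewrite big_cons; apply: PM => // j.
under eq_fun do rewrite !mxE coefB coefC.
apply: (fc_add fc (fc_cst fc _)); apply: fc_opp.
by case: (j == 0%N); [exact: SF|exact: (fc_cst fc)].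
Qed.
End FunctionClass.

Section MatrixNorm.
Context {R : realType} {m n : nat}.
Implicit Types M : 'M[R]_(m, n).

Lemma mx_norm_leP M (e : R) : 0 <= e -> `|M| <= e <-> forall i j, `|M i j| <= e.
Proof.
move=> e0; rewrite /Num.norm/= mx_normrE; split=> [Me i j|Me].
  by apply: le_trans Me; exact: (le_bigmax _ (fun k => `|M k.1 k.2|) (i, j)).
by apply: bigmax_le => // -[i j] _; exact: Me.
Qed.

Lemma mx_norm_ltP M (e : R) : 0 < e -> `|M| < e <-> forall i j, `|M i j| < e.
Proof.
move=> e0; rewrite /Num.norm/= mx_normrE; split=> [Me i j|Me].
  by apply: le_lt_trans Me; exact: (le_bigmax _ (fun k => `|M k.1 k.2|) (i, j)).
by apply: bigmax_lt => // -[i j] _; exact: Me.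
Qed.

Lemma mx_entry_le M i j : `|M i j| <= `|M|.
Proof. by move: i j; apply/mx_norm_leP. Qed.

Lemma mx_cvgP (T : Type) (F : set_system T) (FF : Filter F) (f : T -> 'M[R]_(m, n)) (L : 'M[R]_(m, n)) :
  f @ F --> L <-> forall i j, (fun x => f x i j) @ F --> L i j.
Proof.
split=> [/cvgrPdist_lt fL i j|fL].
  apply/cvgrPdist_lt => e e0; near=> x.
  have : `|L - f x| < e by near: x; exact: fL.
  by move=> /(mx_norm_ltP _ e0)/(_ i j); rewrite !mxE.
apply/cvgrPdist_lt => e e0.
suff : \forall x \near F, forall i, i \in enum 'I_m -> forall j, j \in enum 'I_n -> `|L i j - f x i j| < e.
  apply: filterS => x fx; apply/mx_norm_ltP => // i j.
  by rewrite !mxE; apply: fx; rewrite mem_enum.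
elim: (enum 'I_m) => [|i r IH]; first by apply: nearW.
have : \forall x \near F, forall j, j \in enum 'I_n -> `|L i j - f x i j| < e.
  elim: (enum 'I_n) => [|j s IHs]; first by apply: nearW.
  have /cvgrPdist_lt/(_ e e0) := fL i j; move: IHs; apply: filterS2 => x H1 H2 k.
  by rewrite inE => /predU1P[->//|]; exact: H1.
move: IH; apply: filterS2 => x H1 H2 k.
by rewrite inE => /predU1P[->//|]; exact: H1.
Unshelve. all: by end_near. Qed.

End MatrixNorm.

Lemma cvg_near_eq (T : Type) (U : nbhsType) (F : set_system T) (FF : Filter F)
    (f g : T -> U) (l : U) :
  (\forall x \near F, f x = g x) -> f @ F --> l -> g @ F --> l.
Proof.
move=> fg; apply: cvg_trans; apply: near_eq_cvg.
by apply: filterS fg => x.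
Qed.

Section ContinuousClass.
Context {T : topologicalType} {R : realType}.
Variable D : set T.

Definition cts {V : topologicalType} (f : T -> V) :=
  forall x, D x -> f y @[y --> within D (nbhs x)] --> f x.

Lemma ctsP {V : topologicalType} (f : T -> V) : {within D, continuous f} <-> cts f.
Proof. exact: subspace_continuousP. Qed.

Lemma cts_class : function_class D (fun f : T -> R => cts f).
Proof.
split=> [f g fg fc x Dx|c x Dx|f g fc gc x Dx|f g fc gc x Dx|f f0 fc x Dx].
- rewrite -fg//; apply: cvg_trans (fc x Dx); apply: near_eq_cvg.
  by near=> y; apply: fg; near: y; exact: withinT.
- exact: cvg_cst.
- by apply: cvgD; [exact: fc|exact: gc].
- by apply: cvgM; [exact: fc|exact: gc].
- by apply: cvgV; [exact: f0|exact: fc].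
Unshelve. all: by end_near. Qed.

Lemma mx_cts {m n} (F : T -> 'M[R]_(m, n)) :
  cts F <-> mx_class (fun f : T -> R => cts f) F.
Proof.
split=> [Fc i j x Dx|Fc x Dx].
  by have /mx_cvgP := Fc x Dx; exact.
by apply/mx_cvgP => i j; exact: Fc.
Qed.

End ContinuousClass.

Section C1Class.
Context {R : realType}.
Variable D : set R.

Definition has_slope (f : R -> R) (t l : R) :=
  (s - t)^-1 * (f s - f t) @[s --> within D t^'] --> l.

(** The derivative is an existential witness, which spares the closure proofs any computation with
    [lim]. *)
Definition C1s (f : R -> R) :=
  exists2 f' : R -> R, (forall t, D t -> has_slope f t (f' t)) & cts D f'.

Lemma near_neq (t : R) : \forall s \near within D t^', s != t.
Proof. by apply: filterS (nbhs_dnbhs_neq t) => s. Qed.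

Lemma slope_cvg f t l : has_slope f t l -> f s @[s --> within D t^'] --> f t.
Proof.
move=> fl.
have st : (fun s => s - t) @ within D t^' --> (0 : R).
  apply: (@cvg_trans _ ((fun s => s - t) @ nbhs t)).
    by apply: cvg_app; apply: cvg_trans; [exact: cvg_within|exact: nbhs_dnbhs].
  by rewrite -(subrr t); apply: cvgB; [exact: cvg_id|exact: cvg_cst].
have : (fun s => (s - t) * ((s - t)^-1 * (f s - f t)) + f t) @ within D t^' --> 0 * l + f t.
  by apply: cvgD; [exact: cvgM|exact: cvg_cst].
rewrite mul0r add0r; apply: cvg_trans; apply: near_eq_cvg.
by near=> s; rewrite mulrA mulfV ?subr_eq0 ?mul1r ?subrK//; near: s; exact: near_neq.
Unshelve. all: by end_near. Qed.

Lemma within_dnbhs_cvg {V : topologicalType} (f : R -> V) t :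
  f s @[s --> within D t^'] --> f t -> f s @[s --> within D (nbhs t)] --> f t.
Proof.
move=> ft U /[dup] Uft /ft; rewrite /nbhs/= /within/= /dnbhs/= /within/= => H.
near=> s => Ds; have [->|st] := eqVneq s t; first exact: nbhs_singleton.
by move: st Ds; near: s.
Unshelve. all: by end_near. Qed.

Lemma C1s_cts f : C1s f -> cts D f.
Proof. by move=> [f' fd _] t Dt; apply/within_dnbhs_cvg/slope_cvg/fd. Qed.

Lemma C1_class : function_class D C1s.
Proof.
have slope_ext f g t l : D t -> (forall x, D x -> f x = g x) -> has_slope f t l -> has_slope g t l.
  move=> Dt fg; apply: cvg_trans; apply: near_eq_cvg.
  by near=> s; rewrite !fg//; near: s; exact: withinT.
split=> [f g fg [f' fd fc]|c|f g [f' fd fc] [g' gd gc]|f g Cf Cg|f f0 Cf].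
- by exists f' => // t Dt; apply: slope_ext (fd t Dt).
- exists (fun=> 0) => [t _|t _]; last exact: cvg_cst.
  by rewrite /has_slope; under eq_fun do rewrite subrr mulr0; exact: cvg_cst.
- exists (fun x => f' x + g' x) => [t Dt|]; last exact: (fc_add (cts_class D) fc gc).
  have : (fun s => (s - t)^-1 * (f s - f t) + (s - t)^-1 * (g s - g t))
      @ within D t^' --> f' t + g' t by apply: cvgD; [exact: fd|exact: gd].
  by apply: cvg_near_eq; near=> s; ring.
- have fc := C1s_cts Cf; have gc := C1s_cts Cg.
  move: Cf Cg => [f' fd fc'] [g' gd gc'].
  exists (fun x => f' x * g x + f x * g' x) => [t Dt|]; last first.
    exact: (fc_add (cts_class D) (fc_mul (cts_class D) fc' gc) (fc_mul (cts_class D) fc gc')).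
  have : (fun s => (s - t)^-1 * (f s - f t) * g s + f t * ((s - t)^-1 * (g s - g t)))
      @ within D t^' --> f' t * g t + f t * g' t.
    apply: cvgD; apply: cvgM; [exact: fd|exact: slope_cvg (gd t Dt)|exact: cvg_cst|exact: gd].
  apply: cvg_near_eq.
  by near=> s; rewrite /=; ring.
- have fc := C1s_cts Cf; move: Cf => [f' fd fc'].
  exists (fun x => - (f' x * ((f x)^-1 * (f x)^-1))) => [t Dt|]; last first.
    apply: (fc_opp (cts_class D)); apply: (fc_mul (cts_class D)) => //.
    by apply: (fc_mul (cts_class D)); exact: (fc_inv (cts_class D)).
  have ft0 := f0 t Dt.
  have : (fun s => - ((s - t)^-1 * (f s - f t) * ((f s)^-1 * (f t)^-1)))
      @ within D t^' --> - (f' t * ((f t)^-1 * (f t)^-1)).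
    apply: cvgN; apply: cvgM; first exact: fd.
    by apply: cvgM; [exact: cvgV ft0 (slope_cvg (fd t Dt))|exact: cvg_cst].
  apply: cvg_near_eq; near=> s.
  have fs0 : f s != 0 by apply: f0; near: s; exact: withinT.
  have st : s - t != 0 by rewrite subr_eq0; near: s; exact: near_neq.
  by rewrite /=; field; rewrite fs0 st ft0.
Unshelve. all: by end_near. Qed.

End C1Class.

Section DeriveWithin.
Context {R : realType} {m n : nat}.
Variable a : R.
Local Notation D := `[a, +oo[%classic.
Implicit Types F : R -> 'M[R]_(m, n).

(** Every point of the half-line, its endpoint included, is approached from the right; this makes
    limits unique, so that [lim] in [derive_within] can be identified. *)
Lemma within_dnbhs_proper (t : R) : a <= t -> ProperFilter (within D t^').
Proof.
move=> at_; apply: Build_ProperFilter_ex.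
move=> P; rewrite /within/= /dnbhs/= /within/= => /nbhs_ballP[e /= e0 Pe].
exists (t + e / 2); apply: Pe.
- by rewrite /ball/= opprD addrA subrr add0r normrN gtr0_norm ?divr_gt0// ltr_pdivrMr// ltr_pMr// ltr1n.
- by rewrite gt_eqF// ltrDl divr_gt0.
- by rewrite in_itv/= andbT (le_trans at_)// lerDl divr_ge0// ltW.
Qed.

Lemma C1_on_entries F : C1_on D F -> mx_class (C1s D) F.
Proof.
move=> [Fd /ctsP Fc] i j; exists (fun t => derive_within D F t i j).
  move=> t Dt; have at_ : a <= t by move: Dt; rewrite /= in_itv/= andbT.
  have PF := within_dnbhs_proper at_.
  have /mx_cvgP/(_ i j) := Fd t Dt.
  by apply: cvg_trans; apply: near_eq_cvg; apply: nearW => s; rewrite /diff_quotient !mxE.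
by move=> t Dt; have /mx_cvgP := Fc t Dt; exact.
Qed.

Lemma derive_within_unique F t L : a <= t ->
  diff_quotient F t s @[s --> within D t^'] --> L -> derive_within D F t = L.
Proof.
by move=> at_ FL; have PF := within_dnbhs_proper at_; exact: cvg_lim.
Qed.

Lemma entries_C1_on F : mx_class (C1s D) F ->
  (forall t, a <= t -> diff_quotient F t s @[s --> within D t^'] --> derive_within D F t) /\
  cts D (derive_within D F).
Proof.
move=> FC.
have /choice[F' FF'] : forall ij : 'I_m * 'I_n, exists f' : R -> R,
    (forall t, D t -> has_slope D (fun x => F x ij.1 ij.2) t (f' t)) /\ cts D f'.
  by move=> [i j]; have [f' ? ?] := FC i j; exists f'.
pose dF t : 'M[R]_(m, n) := \matrix_(i, j) F' (i, j) t.
have dqF t : a <= t -> diff_quotient F t s @[s --> within D t^'] --> dF t.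
  move=> at_; apply/mx_cvgP => i j; rewrite mxE.
  have Dt : D t by rewrite /= in_itv/= at_.
  have := (FF' (i, j)).1 t Dt.
  by apply: cvg_trans; apply: near_eq_cvg; apply: nearW => s; rewrite /diff_quotient !mxE.
have dE t : a <= t -> derive_within D F t = dF t by move=> at_; apply/derive_within_unique/dqF.
split=> [t at_|]; first by rewrite dE//; exact: dqF.
apply/mx_cts; apply: (mxc_ext (cts_class D) (F := dF)).
  by move=> t; rewrite /= in_itv/= andbT => /dE.
move=> i j; rewrite (_ : (fun x => dF x i j) = F' (i, j)); first exact: (FF' (i, j)).2.
by apply/funext => t; rewrite mxE.
Qed.

End DeriveWithin.

Lemma C1_on_C1s (R : realType) (a : R) (f : R -> R) :
  C1_on `[a, +oo[ f -> C1s `[a, +oo[ f.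
Proof.
by move=> [fd /ctsP fc]; exists (derive_within `[a, +oo[ f).
Qed.

(** * Constant multiplicity of the eigenvalue 0 and smoothness of the projectors *)

Section LowestCoefficient.
Context {R : realType}.
Local Notation C := R[i].
Local Notation normc := ComplexField.Normc.normc.
Import ComplexField.Normc.

(** Up to sign the constant coefficient is the product of the roots. Taking [d <= 1] allows the
    number of roots to be replaced by its bound [N]. *)
Lemma monic_coef0_ge (q : {poly C}) (d : R) N : q \is monic -> 0 < d <= 1 ->
  (size q <= N.+1)%N -> (forall z, root q z -> d <= normc z) ->
  d ^+ N <= normc q`_0.
Proof.
move=> /monicP qm /andP[d0 d1] sq qz.
have [s qE] := closed_field_poly_normal q.
rewrite qm scale1r in qE.
have ss : (size s <= N)%N by rewrite -ltnS -(size_prod_XsubC s id) -qE.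
have sz z : z \in s -> d <= normc z by move=> zs; apply: qz; rewrite qE root_prod_XsubC.
apply: (@le_trans _ _ (d ^+ size s)); first by rewrite ler_wiXn2l// ltW.
rewrite -horner_coef0 qE horner_prod; elim: s sz {qE ss} => [|z s IH] sz.
  by rewrite big_nil expr0 normc1.
rewrite big_cons hornerXsubC sub0r normcM normcN /= exprS.
apply: ler_pM; rewrite ?exprn_ge0 ?(ltW d0)//; first by rewrite sz ?mem_head.
by apply: IH => y ys; rewrite sz// inE ys orbT.
Qed.

Variable n : nat.
Variables (A B : R -> 'M[R]_n.+1) (C2 : R -> R) (t : R).
Local Notation K := (shifted_resolvent A B C2 t).

(** Up to sign this coefficient is the product of the nonzero eigenvalues of [K], each at least
    [1/(2 C2)] in modulus. The added 1 brings the base below 1, so that the exponent can be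
    uniform. *)
Lemma lowest_coef_ge j : 0 < C2 t ->
  (forall lam : C, real_complex R (C2 t) <= `|lam| -> pencil A B t lam \in unitmx) ->
  (forall i, (i < j)%N -> (char_poly K)`_i = 0) -> (char_poly K)`_j != 0 ->
  (2 * C2 t + 1)^-1 ^+ n.+1 <= `|(char_poly K)`_j|.
Proof.
move=> C0 pu c0 cj.
set X := char_poly K in c0 cj *.
have XE := drop_low_coefs c0.
pose q := drop_poly j X.
have qm : q \is monic by have := char_poly_monic K; rewrite -/X XE monicMr// monicXn.
pose qc := map_poly (real_complex R) q.
have -> : `|X`_j| = normc qc`_0.
  by rewrite coef_map coef_drop_poly add0n /= expr0n addr0 sqrtr_sqr.
have c1 : 0 < 2 * C2 t + 1 by rewrite addr_gt0// mulr_gt0.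
apply: monic_coef0_ge.
- by rewrite map_monic.
- by rewrite invr_gt0 c1 invf_le1// lerDr mulr_ge0// ltW.
- by rewrite size_map_poly size_drop_poly (leq_trans (leq_subr _ _))// size_char_poly.
move=> z qz; apply: (@le_trans _ _ (2 * C2 t)^-1).
  by rewrite lef_pV2 ?posrE ?mulr_gt0// lerDl.
apply: (@shifted_eigenvalue_gt _ _ A B) => //.
  apply: contraTneq qz => ->; rewrite /root horner_coef0 coef_map coef_drop_poly.
  by rewrite fmorph_eq0.
by rewrite -map_char_poly -/X XE rmorphM rootM qz.
Qed.

End LowestCoefficient.

Section Structure.
Context {R : realType} {n : nat}.
Variables (A B : R -> 'M[R]_n.+1) (C1 C2 : R -> R) (tp : R).
Local Notation D := `[tp, +oo[%classic.
Hypothesis A_C1 : C1_on D A.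
Hypothesis B_C1 : C1_on D B.
Hypothesis C2_gt0 : forall t, tp <= t -> 0 < C2 t.
Hypothesis C2_C1 : C1_on D C2.
Hypothesis resolvent_bound : forall t (lam : R[i]), tp <= t ->
  real_complex R (C2 t) <= `|lam| ->
  pencil A B t lam \in unitmx /\ opnorm (invmx (pencil A B t lam)) <= C1 t.

Local Notation H := (shifted_pencil A B C2).
Local Notation K := (shifted_resolvent A B C2).

Let pu t (tpt : tp <= t) (lam : R[i]) : real_complex R (C2 t) <= `|lam| ->
  pencil A B t lam \in unitmx.
Proof. by move=> /(resolvent_bound tpt)[]. Qed.

Let DE t : D t = (tp <= t) :> Prop.
Proof. by rewrite /= in_itv/= andbT. Qed.

Let Hu t : D t -> H t \in unitmx.
Proof. by rewrite DE => tpt; exact: shifted_pencil_unit (pu tpt). Qed.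

Let cl := C1_class D.

Let HC1 : mx_class (C1s D) H.
Proof.
apply: (mxc_add cl); last exact: C1_on_entries.
by apply: (mxc_scale cl); [exact: C1_on_C1s|exact: C1_on_entries].
Qed.

Let HiC1 : mx_class (C1s D) (fun t => invmx (H t)).
Proof. exact: (mxc_invmx cl). Qed.

Let KC1 : mx_class (C1s D) K.
Proof. by apply: (mxc_mul cl) => //; exact: C1_on_entries. Qed.

Let coef t j := (char_poly (K t))`_j.

Let coefC1 j : C1s D (fun t => coef t j).
Proof. exact: (fc_char_poly cl). Qed.

(* As long as the lower coefficients vanish, [coef t j] is either 0 or
   bounded below by a positive continuous function of [t]. *)
Let coef_dichotomy j : (forall i t, (i < j)%N -> D t -> coef t i = 0) ->
  (exists2 t, D t & coef t j != 0) -> forall t, D t -> coef t j != 0.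
Proof.
move=> c0 [t2 Dt2 ct2] t1 Dt1; apply/negP => /eqP ct1.
(* The scaling turns the lower bound into 1: [psi] takes the value 0 or values at least 1, so a
   change from one case to the other would produce the impossible value 1/2. *)
pose psi t := `|coef t j| * (2 * C2 t + 1) ^+ n.+1.
have psiP t : D t -> coef t j != 0 -> 1 <= psi t.
  move=> Dt ct; have tpt : tp <= t by rewrite -DE.
  have c1 : 0 < 2 * C2 t + 1 by rewrite addr_gt0 ?mulr_gt0// C2_gt0.
  rewrite /psi -[leLHS](mulVf (_ : (2 * C2 t + 1) ^+ n.+1 != 0)); last by rewrite expf_neq0// gt_eqF.
  apply: ler_wpM2r; first exact/exprn_ge0/ltW.
  rewrite -exprVn; apply: (lowest_coef_ge (C2_gt0 tpt) (pu tpt)) => // i ij.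
  exact: c0.
have psic : cts D psi.
  have cc := C1s_cts (coefC1 j).
  apply: (fc_mul (cts_class D)); first by move=> t Dt; apply: cvg_norm; exact: cc.
  apply: (fc_exp (cts_class D)); apply: (fc_add (cts_class D)).
    by apply: (fc_mul (cts_class D) (fc_cst (cts_class D) _)); exact/C1s_cts/C1_on_C1s.
  exact: (fc_cst (cts_class D)).
have p1 : psi t1 = 0 by rewrite /psi ct1 normr0 mul0r.
have p2 := psiP _ Dt2 ct2.
suff [c Dc pc] : exists2 c, D c & psi c = 2^-1.
  have [cc|cc] := eqVneq (coef c j) 0.
    by move: pc; rewrite /psi cc normr0 mul0r => /esym/eqP; rewrite invr_eq0 pnatr_eq0.
  by have := psiP _ Dc cc; rewrite pc invf_ge1// lern1.
have ivt a b : D a -> a <= b -> (psi a = 0 /\ 1 <= psi b) \/ (psi b = 0 /\ 1 <= psi a) ->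
    exists2 c, D c & psi c = 2^-1.
  move=> Da ab pab.
  have sub : `[a, b]%classic `<=` D.
    move=> s; move: Da; rewrite !DE => Da /=; rewrite in_itv/= => /andP[as_ _].
    exact: le_trans as_.
  have [] := @IVT _ psi a b 2^-1 ab.
  - by apply: continuous_subspaceW sub _; apply/ctsP.
  - have h1 : (2^-1 : R) <= 1 by rewrite invf_le1// ler1n.
    have h0 : 0 <= (2^-1 : R) by rewrite invr_ge0.
    rewrite ge_min le_max; case: pab => -[-> p].
      by rewrite h0/= (le_trans h1 p) orbT.
    by rewrite h0 orbT (le_trans h1 p).
  - by move=> c cab <-; exists c => //; apply: sub.
by have [t12|/ltW t21] := leP t1 t2; [apply: (ivt t1 t2)|apply: (ivt t2 t1)] => //;
  [left|right].
Qed.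

(** If no index worked, the dichotomy and induction would make every coefficient vanish on all of
    [D], against the leading coefficient 1. *)
Lemma constant_multiplicity : exists m, forall t, D t ->
  (forall i, (i < m)%N -> (char_poly (K t))`_i = 0) /\ (char_poly (K t))`_m != 0.
Proof.
apply: contrapT => nm.
suff low j : forall i t, (i < j)%N -> D t -> coef t i = 0.
  have Dtp : D tp by rewrite DE.
  have := low n.+2 n.+1 tp (ltnSn _) Dtp.
  have := char_poly_monic (K tp); rewrite monicE lead_coefE size_char_poly /= /coef.
  by move=> /eqP -> /eqP; rewrite oner_eq0.
elim: j => [|j IH] // i t; rewrite ltnS leq_eqVlt => /predU1P[->|]; last exact: IH.
move=> Dt; apply/eqP; apply: contraT => ct; exfalso; apply: nm; exists j => s Ds.
split=> [i0 i0j|]; first exact: IH.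
by apply: coef_dichotomy => //; exists t.
Qed.

Definition splitting t : Prop :=
  [/\ A t *m P1 A B C2 t = A t, Q1 A B C2 t *m A t = A t &
      B t *m P1 A B C2 t = Q1 A B C2 t *m B t] /\
  [/\ P1 A B C2 t *m P1 A B C2 t = P1 A B C2 t, G A B C2 t \in unitmx,
      Ginv A B C2 t *m A t = P1 A B C2 t,
      Ginv A B C2 t *m B t *m P2 A B C2 t = P2 A B C2 t &
      Ginv A B C2 t *m Q1 A B C2 t = P1 A B C2 t *m Ginv A B C2 t].

(** Everything is computed in [K], [E] and [Ks]: [P2 = E], [Q1 = H (1 - E) H^-1] and
    [G = H (K + E)]. Since [K] and [E] act on complementary subspaces, [Ks + E] inverts [K + E]. *)
Lemma splittingP : [/\ forall t, tp <= t -> splitting t,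
  mx_class (C1s D) (P1 A B C2), mx_class (C1s D) (Q1 A B C2) &
  mx_class (C1s D) (Ginv A B C2)].
Proof.
have [m mP] := constant_multiplicity.
pose E t := kernel_projector (coef t) m (K t).
have EP t : tp <= t -> exists Ks : 'M[R]_n.+1,
    [/\ K t * E t = 0, E t * K t = 0, E t * E t = E t, K t * Ks = 1 - E t & Ks * K t = 1 - E t] /\
    Ks * E t = 0 /\ E t * Ks = 0.
  move=> tpt; have Dt : D t by rewrite DE.
  have [c0 cm] := mP t Dt; apply: kernel_projectorP => //.
  apply: (bounded_resolvent_ker A B C2 t (C1 t)) => lam; exact: resolvent_bound.
have P1E t : tp <= t -> P1 A B C2 t = 1 - E t.
  move=> tpt; have [Ks [[KE EK EE KKs KsK] [KsE EKs]]] := EP t tpt.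
  exact: (P1_shifted A B C2 t (C2_gt0 tpt) (pu tpt) (E t) Ks).
have Q1E t : tp <= t -> Q1 A B C2 t = H t * (1 - E t) * invmx (H t).
  move=> tpt; have [Ks [[KE EK EE KKs KsK] [KsE EKs]]] := EP t tpt.
  exact: (Q1_shifted A B C2 t (C2_gt0 tpt) (pu tpt) (E t) Ks).
(* Here a single [m] for all [t] is essential: the division is by the coefficient of that index. *)
have EC1 : mx_class (C1s D) E.
  apply: (mxc_scale cl).
    by apply: (fc_inv cl); [move=> t /mP[]|exact: coefC1].
  apply: (mxc_sum cl) => i; apply: (mxc_scale cl); first exact: coefC1.
  exact: (mxc_exp cl).
have P1C1 : mx_class (C1s D) (P1 A B C2).
  apply: (mxc_ext cl (F := fun t => 1%:M - E t)).
    by move=> t; rewrite DE => /P1E ->.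
  by apply: (mxc_sub cl) => //; exact: (mxc_cst cl).
have Q1C1 : mx_class (C1s D) (Q1 A B C2).
  apply: (mxc_ext cl (F := fun t => H t *m (1%:M - E t) *m invmx (H t))).
    by move=> t; rewrite DE => /Q1E ->.
  apply: (mxc_mul cl) => //; apply: (mxc_mul cl) => //.
  by apply: (mxc_sub cl) => //; exact: (mxc_cst cl).
have sp t : tp <= t -> splitting t.
  move=> tpt; have [Ks [[KE EK EE KKs KsK] [KsE EKs]]] := EP t tpt.
  have hu : H t \in unitmx by apply: Hu; rewrite DE.
  have AE : A t = H t * K t by exact: (shifted_AE A B C2 t (pu tpt)).
  have BE : B t = H t * (1 - C2 t *: K t) by exact: (shifted_BE A B C2 t (pu tpt)).
  have HH : invmx (H t) * H t = 1 by exact: mulVmx.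
  move: (H t) (K t) (E t) HH AE BE KE EK EE KKs KsK KsE EKs (Q1E t tpt) (P1E t tpt) hu
    => h k e hh AE BE KE EK EE KKs KsK KsE EKs Q1e P1e hu.
  have P2e : P2 A B C2 t = e by rewrite /P2 P1e subKr.
  have GE : G A B C2 t = h * (k + e).
    rewrite /G P2e AE BE -[_ *m e]/(_ * e).
    by rewrite -mulrA mulrBl mul1r -scalerAl KE scaler0 subr0 mulrDr.
  have ke : (k + e) * (Ks + e) = 1.
    by rewrite mulrDl !mulrDr KKs KE EKs EE addr0 add0r subrK.
  have gu : G A B C2 t \in unitmx.
    by rewrite GE unitmx_mul hu; have [] := mulmx1_unit ke.
  have Ag : A t = G A B C2 t * (1 - e).
    by rewrite GE mulrBr mulr1 -mulrA mulrDl KE EE add0r mulrDr addrK.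
  have Be : B t * e = G A B C2 t * e.
    by rewrite BE GE -!mulrA mulrBl mulrDl mul1r -scalerAl KE scaler0 subr0 EE add0r.
  have Qg : Q1 A B C2 t * G A B C2 t = G A B C2 t * (1 - e).
    rewrite -Ag Q1e GE -!mulrA (mulrA (invmx h)) hh mul1r.
    by rewrite mulrBl mul1r (mulrDr e) EK EE add0r addrK AE.
  have Gi : Ginv A B C2 t * G A B C2 t = 1 by exact: mulVmx.
  have iG : G A B C2 t * Ginv A B C2 t = 1 by exact: mulmxV.
  have mE (M N : 'M[R]_n.+1) : M *m N = M * N by [].
  rewrite /splitting P2e P1e !mE; split; split=> //.
  - by rewrite AE -mulrA mulrBr mulr1 KE subr0.
  - rewrite Q1e AE -!mulrA (mulrA (invmx h)) hh mul1r mulrBl mul1r EK subr0 //.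
  - rewrite Q1e BE -!mulrA (mulrA (invmx h)) hh mul1r; congr (_ * _).
    rewrite mulrBl mul1r [in RHS]mulrBl mul1r !mulrBr !mulr1 -scalerAl -scalerAr.
    by rewrite KE EK scaler0 !subr0 addrAC.
  - by rewrite mulrBr mulr1 mulrBl mul1r EE subrr subr0.
  - by rewrite Ag mulrA Gi mul1r.
  - by rewrite -mulrA Be mulrA Gi mul1r.
  - have : Q1 A B C2 t = G A B C2 t * (1 - e) * Ginv A B C2 t.
      by rewrite -Qg -mulrA iG mulr1.
    by move=> ->; rewrite !mulrA Gi mul1r.
split=> //; apply: (mxc_invmx cl); first by move=> t; rewrite DE => /sp[_ []].
apply: (mxc_add cl); first exact: C1_on_entries.
apply: (mxc_mul cl); first exact: C1_on_entries.
by apply: (mxc_sub cl) => //; exact: (mxc_cst cl).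
Qed.

End Structure.

(** * The decoupled equations *)

Section MatrixLimits.
Context {R : realType} {T : Type} {F : set_system T} {FF : Filter F}.

Lemma cvg_mulmx {m n p} (f : T -> 'M[R]_(m, n)) (g : T -> 'M[R]_(n, p)) (M : 'M[R]_(m, n)) (N : 'M[R]_(n, p)) :
  f @ F --> M -> g @ F --> N -> f x *m g x @[x --> F] --> M *m N.
Proof.
move=> /mx_cvgP fM /mx_cvgP gN; apply/mx_cvgP => i j.
suff sums (r : seq 'I_n) : (fun x => \sum_(k <- r) f x i k * g x k j) @ F -->
    \sum_(k <- r) M i k * N k j.
  by rewrite [X in _ --> X]mxE; apply: cvg_near_eq (sums _); apply: nearW => x; rewrite mxE.
elim: r => [|k r IH].
  by rewrite big_nil; under eq_fun do rewrite big_nil; exact: cvg_cst.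
rewrite big_cons; under eq_fun do rewrite big_cons.
by apply: cvgD => //; apply: cvgM; [exact: fM|exact: gN].
Qed.

End MatrixLimits.

Section ProductRule.
Context {R : realType}.
Variable D : set R.

Lemma within_dnbhs_sub (D' : set R) (t : R) : D `<=` D' ->
  within D t^' `=>` within D' t^'.
Proof. by move=> DD' P; apply: (@filterS _ t^') => s PD' /DD'. Qed.

Lemma diff_quotient_mulmx {m n p} (f : R -> 'M[R]_(m, n)) (g : R -> 'M[R]_(n, p)) t (M : 'M[R]_(m, n)) (N : 'M[R]_(n, p)) :
  diff_quotient f t s @[s --> within D t^'] --> M ->
  diff_quotient g t s @[s --> within D t^'] --> N ->
  diff_quotient (fun x => f x *m g x) t s @[s --> within D t^'] --> M *m g t + f t *m N.
Proof.
move=> fM gN.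
have gt : g s @[s --> within D t^'] --> g t.
  apply/mx_cvgP => i j; apply: (@slope_cvg _ _ (fun s => g s i j) t (N i j)).
  have /mx_cvgP/(_ i j) := gN; apply: cvg_near_eq; apply: nearW => s.
  by rewrite !mxE.
apply: cvg_near_eq (cvgD (cvg_mulmx fM gt) (cvg_mulmx (cvg_cst (f t)) gN)).
near=> s.
rewrite /diff_quotient -[LHS]/(_ *m _ + _ *m _) -scalemxAl -scalemxAr -scalerDr.
by rewrite mulmxBl mulmxBr addrA subrK.
Unshelve. all: by end_near. Qed.

End ProductRule.

(** Multiplying [A z' = y - B x - A' z] by [G^-1 Q1] isolates [P1 z'], which together with the
    differentiated identity [z = P1 z] gives the differential equation. Multiplying by [Q2] kills
    [A z'] and leaves the algebraic one. *)
Lemma split_equation (F : fieldType) n (A B P1 Q1 Gi A' P1' : 'M[F]_n)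
    (x z z' y : 'cV[F]_n) :
  Q1 *m A = A -> B *m P1 = Q1 *m B -> P1 *m P1 = P1 -> Gi *m A = P1 ->
  Gi *m B *m (1%:M - P1) = 1%:M - P1 ->
  z = P1 *m x -> z' = P1' *m z + P1 *m z' ->
  A *m z' = y - B *m x - A' *m z ->
  z' = (P1' - Gi *m Q1 *m (A' + B)) *m P1 *m z + Gi *m Q1 *m y /\
  (1%:M - P1) *m x = Gi *m (1%:M - Q1) *m (y - A' *m P1 *m z).
Proof.
move=> Q1A BP1 PP GA GBP zE z'E Az'.
have zP : P1 *m z = z by rewrite zE mulmxA PP.
have Q1B : Q1 *m (B *m x) = B *m z by rewrite mulmxA -BP1 zE mulmxA.
have Q1Bz : Q1 *m (B *m z) = B *m z by rewrite mulmxA -BP1 -mulmxA zP.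
have P1z' : P1 *m z' = Gi *m Q1 *m (y - B *m x - A' *m z).
  by rewrite -Az' -mulmxA (mulmxA Q1) Q1A mulmxA GA.
split.
  rewrite z'E P1z' -(mulmxA _ P1 z) zP mulmxBl -[RHS]addrA; congr (_ + _).
  rewrite [RHS]addrC -(mulmxA _ (A' + B)) -mulmxBr -!(mulmxA Gi); congr (_ *m _).
  by rewrite mulmxDl opprD addrA !mulmxBr Q1B Q1Bz addrAC.
have Q2z : (1%:M - Q1) *m (y - B *m x - A' *m z) = 0.
  by rewrite -Az' mulmxBl mul1mx mulmxA Q1A subrr.
have GQB : Gi *m ((1%:M - Q1) *m (B *m x)) = (1%:M - P1) *m x.
  rewrite mulmxBl mul1mx Q1B zE -[in RHS]GBP -!mulmxA; congr (_ *m _).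
  by rewrite mulmxBl mul1mx mulmxBr.
rewrite -mulmxA -(mulmxA A') zP -GQB; congr (_ *m _); apply/eqP.
by rewrite eq_sym -subr_eq0 -mulmxBr addrAC; apply/eqP.
Qed.

Section ExactSolution.
Context {R : realType} {n : nat}.
Variables (A B : R -> 'M[R]_n.+1) (C2 : R -> R) (f : R -> 'cV[R]_n.+1 -> 'cV[R]_n.+1).
Variables (tp t0 : R).
Hypothesis tp_le_t0 : tp <= t0.
Local Notation D := `[tp, +oo[%classic.
Local Notation D0 := `[t0, +oo[%classic.
Local Notation P1 := (P1 A B C2).
Local Notation P2 := (P2 A B C2).
Local Notation Q1 := (Q1 A B C2).
Local Notation Q2 := (Q2 A B C2).
Local Notation Ginv := (Ginv A B C2).
Hypothesis A_C1 : C1_on D A.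
Hypothesis splits : forall t, tp <= t -> splitting A B C2 t.
Hypothesis P1C1 : mx_class (C1s D) P1.
Hypothesis GiC1 : mx_class (C1s D) Ginv.
Variables (x0 : 'cV[R]_n.+1) (x : R -> 'cV[R]_n.+1).
Hypothesis x_sol : is_solution A B f t0 x0 x.

Definition z_rhs t (z y : 'cV[R]_n.+1) : 'cV[R]_n.+1 :=
  drift A B C2 tp t *m z + Ginv t *m Q1 t *m f t y.

(** Only [A x] is known to be differentiable, [x] itself being merely continuous. The component
    [z = P1 x] is differentiable because [P1 = G^-1 A] with [G^-1] smooth; then [z = P1 z] and
    [A x = A z] are differentiated by the product rule. *)
Lemma exact_solution_split t : t0 <= t ->
  diff_quotient (fun s => P1 s *m x s) t s @[s --> within D0 t^'] -->
    z_rhs t (P1 t *m x t) (x t) /\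
  P2 t *m x t = Ginv t *m Q2 t *m (f t (x t) - A' A tp t *m P1 t *m (P1 t *m x t)).
Proof.
move=> t0t; have tpt : tp <= t := le_trans tp_le_t0 t0t.
have [_ AxC1 xeq _] := x_sol.
have D0D : D0 `<=` D.
  by move=> s; rewrite /= !in_itv/= !andbT; exact: le_trans.
have PF := within_dnbhs_proper t0t.
(* Derivatives of the data are relative to [[tp, +oo[], those of the solution to [[t0, +oo[]; a
   limit along the larger set restricts to the smaller one. *)
have toD0 (m' n' : nat) (F : R -> 'M[R]_(m', n')) (L : 'M[R]_(m', n')) :
    diff_quotient F t s @[s --> within D t^'] --> L ->
    diff_quotient F t s @[s --> within D0 t^'] --> L.
  by move=> FL; apply: cvg_trans FL; apply: cvg_app; exact: within_dnbhs_sub.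
have dA : diff_quotient A t s @[s --> within D0 t^'] --> A' A tp t.
  exact: (toD0 _ _ _ _ ((entries_C1_on (C1_on_entries A_C1)).1 t tpt)).
have dP1 : diff_quotient P1 t s @[s --> within D0 t^'] --> P1' A B C2 tp t.
  exact: (toD0 _ _ _ _ ((entries_C1_on P1C1).1 t tpt)).
have [Gi' dGi] : exists L : 'M[R]_n.+1, diff_quotient Ginv t s @[s --> within D0 t^'] --> L.
  by exists (derive_within D Ginv t); exact: (toD0 _ _ _ _ ((entries_C1_on GiC1).1 t tpt)).
pose z s := P1 s *m x s.
have GAx s : tp <= s -> Ginv s *m (A s *m x s) = z s.
  by move=> /splits[_ [_ _ GAs _ _]]; rewrite mulmxA GAs.
have Pz s : tp <= s -> P1 s *m z s = z s.
  by move=> /splits[_ [PPs _ _ _ _]]; rewrite /z mulmxA PPs.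
have Az s : tp <= s -> A s *m z s = A s *m x s.
  by move=> /splits[[APs _ _] _]; rewrite /z mulmxA APs.
have dAx : diff_quotient (fun s => A s *m x s) t s @[s --> within D0 t^'] -->
    f t (x t) - B t *m x t.
  have <- : derive_within D0 (fun s => A s *m x s) t = f t (x t) - B t *m x t.
    by rewrite -xeq// addrK.
  by have [+ _] := AxC1; apply; rewrite /= in_itv/= t0t.
have [z' dz] : exists L : 'cV[R]_n.+1, diff_quotient z t s @[s --> within D0 t^'] --> L.
  exists (Gi' *m (A t *m x t) + Ginv t *m (f t (x t) - B t *m x t)).
  apply: cvg_near_eq (diff_quotient_mulmx dGi dAx).
  near=> s; have ts : t0 <= s.
    have : D0 s by near: s; exact: withinT.
    by rewrite /= in_itv/= andbT.
  have tps := le_trans tp_le_t0 ts.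
  rewrite /diff_quotient.
  congr (_ *: (_ - _)).
    exact: GAx.
  exact: GAx.
have [[AP1 Q1A BP1] [PP Gu GA GBP GQ]] := splits tpt.
have zP := Pz t tpt.
have z'E : z' = P1' A B C2 tp t *m z t + P1 t *m z'.
  rewrite -[LHS](derive_within_unique t0t dz); apply: derive_within_unique => //.
  apply: cvg_near_eq (diff_quotient_mulmx dP1 dz).
  near=> s; have ts : t0 <= s.
    have : D0 s by near: s; exact: withinT.
    by rewrite /= in_itv/= andbT.
  rewrite /diff_quotient.
  congr (_ *: (_ - _)) => //.
  exact: Pz (le_trans tp_le_t0 ts).
have Az'E : A t *m z' = f t (x t) - B t *m x t - A' A tp t *m z t.
  apply/eqP; rewrite eq_sym subr_eq eq_sym addrC; apply/eqP.
  rewrite -[RHS](derive_within_unique t0t dAx); apply/esym/derive_within_unique => //.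
  apply: cvg_near_eq (diff_quotient_mulmx dA dz).
  near=> s; have ts : t0 <= s.
    have : D0 s by near: s; exact: withinT.
    by rewrite /= in_itv/= andbT.
  rewrite /diff_quotient.
  congr (_ *: (_ - _)); last exact: Az.
  exact: Az (le_trans tp_le_t0 ts).
have [e1 e2] := split_equation Q1A BP1 PP GA GBP erefl z'E Az'E.
split; last exact: e2.
by rewrite /z_rhs /drift -e1.
Unshelve. all: by end_near. Qed.

End ExactSolution.

(** * Uniform estimates on a segment *)

Lemma mulmx_norm_le (R : realType) m n p (M : 'M[R]_(m, n)) (N : 'M[R]_(n, p)) :
  `|M *m N| <= n%:R * `|M| * `|N|.
Proof.
apply/mx_norm_leP => [|i j]; first by rewrite !mulr_ge0.
rewrite mxE; apply: le_trans (ler_norm_sum _ _ _) _.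
rewrite -mulrA mulr_natl -[X in _ *+ X]card_ord -sumr_const; apply: ler_sum => k _.
by rewrite normrM ler_pM// mx_entry_le.
Qed.

Section IncrementBounds.
Context {R : realType}.

Lemma is_derive_cvg (V W : normedModType R) (f : V -> W) a v l :
  (fun h => h^-1 *: ((f \o shift a) (h *: v) - f a)) @ 0^' --> l ->
  is_derive a v f l.
Proof. by move=> fl; split; [apply/cvg_ex; exists l|exact: cvg_lim]. Qed.

Lemma slope_is_derive (t0 : R) (f : R -> R) t l : t0 < t ->
  has_slope `[t0, +oo[ f t l -> is_derive t (1 : R) f l.
Proof.
move=> t0t /cvgrPdist_lt fl; apply: is_derive_cvg; apply/cvgrPdist_lt => e e0.
have := fl e e0; rewrite /within/= /dnbhs/= /within/= => /nbhs_ballP[d /= d0 fd].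
apply/nbhs_ballP; exists (Num.min d (t - t0)); first by rewrite /= lt_min d0 subr_gt0.
move=> h; rewrite /ball/= sub0r normrN lt_min => /andP[hd ht] h0.
have := fd (h + t); rewrite /= addrK [h *: 1]mulr1; apply.
- by rewrite /ball/= opprD addrCA subrr addr0 normrN.
- by rewrite addrC -subr_eq0 addrAC subrr add0r.
- rewrite in_itv/= andbT; move: ht; rewrite ltr_norml => /andP[].
  by rewrite opprB => /ltW ? _; lra.
Qed.

(** The scalar mean value theorem is applied entry by entry, which loses nothing in the max norm.
    Interior points lie beyond [t0], so slopes within the half-line are genuine derivatives
    there. *)
Lemma increment_bound m n (t0 a b : R) (F g : R -> 'M[R]_(m, n)) (c : 'M[R]_(m, n)) (e : R) :
  t0 <= a -> a < b ->
  (forall t, t0 <= t -> diff_quotient F t s @[s --> within `[t0, +oo[ t^'] --> g t) ->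
  (forall s, a <= s <= b -> `|g s - c| <= e) ->
  `|F b - F a - (b - a) *: c| <= (b - a) * e.
Proof.
move=> t0a ab dF gc.
have e0 : 0 <= e by apply: le_trans (normr_ge0 _) (gc a _); rewrite lexx ltW.
have ba : 0 < b - a by rewrite subr_gt0.
apply/mx_norm_leP => [|i j]; first by rewrite mulr_ge0// ltW.
have sl t : t0 <= t -> has_slope `[t0, +oo[ (fun s => F s i j) t (g t i j).
  move=> t0t; have /mx_cvgP/(_ i j) := dF t t0t; apply: cvg_near_eq.
  by apply: nearW => s; rewrite !mxE.
have [] := @MVT _ (fun s => F s i j) (fun s => g s i j) a b ab.
- move=> s; rewrite in_itv/= => /andP[as_ _]; apply: slope_is_derive (sl _ _).
    exact: le_lt_trans as_.
  exact: ltW (le_lt_trans t0a as_).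
- apply/ctsP => t; rewrite /= in_itv/= => /andP[at_ _].
  have t0t := le_trans t0a at_.
  have := within_dnbhs_cvg (slope_cvg (sl t t0t)); apply: cvg_trans; apply: cvg_app.
  move=> P; apply: (@filterS _ (nbhs t)) => s; rewrite /= !in_itv/= => PD /andP[as_ _].
  by apply: PD; rewrite andbT (le_trans t0a).
move=> s; rewrite in_itv/= => /andP[/ltW as_ /ltW sb] E.
rewrite !mxE E [(b - a) * _]mulrC -mulrBl normrM [leRHS]mulrC (gtr0_norm ba).
apply: ler_wpM2r; first exact: ltW.
by have := mx_entry_le (g s - c) i j; rewrite !mxE => /le_trans; apply; rewrite gc ?as_.
Qed.

Lemma diff_jac m n (g : 'cV[R]_n -> 'cV[R]_m) (x v : 'cV[R]_n) :
  'd g x v = jac g x *m v.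
Proof.
have {1}-> : v = \sum_j v j 0 *: delta_mx j 0.
  apply/matrixP => i k; rewrite ord1 summxE (bigD1 i)//= !mxE !eqxx mulr1.
  by rewrite big1 ?addr0// => j /negPf ji; rewrite !mxE eq_sym ji mulr0.
rewrite linear_sum; apply/matrixP => i k; rewrite ord1 summxE mxE.
by apply: eq_bigr => j _; rewrite linearZ !mxE mulrC.
Qed.

(** Again the scalar mean value theorem, for each entry along the segment; the factor [n] comes from
    the max norm of a matrix product. *)
Lemma mean_value_jac m n (g : 'cV[R]_n -> 'cV[R]_m) (y y' : 'cV[R]_n)
    (J : 'M[R]_(m, n)) (e : R) :
  (forall x, differentiable g x) ->
  (forall s, 0 <= s <= 1 -> `|jac g (y + s *: (y' - y)) - J| <= e) ->
  `|g y' - g y - J *m (y' - y)| <= n%:R * e * `|y' - y|.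
Proof.
move=> dg Je; set v := y' - y.
have e0 : 0 <= e by apply: le_trans (normr_ge0 _) (Je 0 _); rewrite lexx ler01.
apply/mx_norm_leP => [|i j]; first by rewrite !mulr_ge0.
rewrite ord1 {j}.
pose phi s := g (y + s *: v) i 0.
have dphi (s : R) : is_derive s (1 : R) phi ((jac g (y + s *: v) *m v) i 0).
  apply: is_derive_cvg; rewrite -diff_jac -deriveE//.
  have /mx_cvgP/(_ i 0) : (fun h => h^-1 *: ((g \o shift (y + s *: v)) (h *: v) - g (y + s *: v))) @ 0^'
      --> 'D_v g (y + s *: v) by exact: (diff_derivable (dg _)).
  apply: cvg_near_eq; apply: nearW => h; rewrite !mxE /phi/=.
  by rewrite [h *: 1]mulr1 scalerDl addrCA.
have [] := @MVT _ phi (fun s => (jac g (y + s *: v) *m v) i 0) 0 1 ltr01.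
- have phic : continuous phi.
    move=> s; apply/differentiable_continuous/derivable1_diffP.
    by have [] := dphi s.
  exact: continuous_subspaceT.
move=> s; rewrite in_itv/= => /andP[/ltW s0 /ltW s1].
have yv : y + v = y' by rewrite /v addrC subrK.
rewrite subr0 mulr1 /phi scale0r addr0 scale1r yv => E.
have -> : (g y' - g y - J *m v) i 0 = ((jac g (y + s *: v) - J) *m v) i 0.
  by rewrite mulmxBl mxE [in RHS]mxE -E !mxE.
apply: le_trans (mx_entry_le _ _ _) _; apply: le_trans (mulmx_norm_le _ _) _.
by rewrite ler_wpM2r// ler_wpM2l// Je// s0.
Qed.

End IncrementBounds.

Section Compactness.
Context {R : realType} {n : nat}.
Variables (t0 T : R).

(** Compactness in near-covering form: because the property passes to smaller radii, local radii can
    be shrunk to a common one. *)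
Lemma uniform_on_segment (P : R -> R -> Prop) :
  (forall r r' t, 0 < r' -> r' <= r -> P r t -> P r' t) ->
  (forall t, t0 <= t <= T -> exists2 d : R, 0 < d &
     forall s, t0 <= s <= T -> `|t - s| < d -> P d s) ->
  exists2 r : R, 0 < r & forall t, t0 <= t <= T -> P r t.
Proof.
move=> Pm Pl.
have cov := (iffRL (near_covering_withinP _)) ((iffLR (compact_near_coveringP _)) (@segment_compact R t0 T)).
have near_P : \forall r \near 0^'+, `[t0, T]%classic `<=` P r.
  apply: cov => t; rewrite /= in_itv/= => tT; have [d d0 Pd] := Pl t tT.
  exists (ball t d, `]0, d]%classic) => /=.
    split; first exact: nbhsx_ballx.
    near=> r; rewrite /= in_itv/=; apply/andP; split => //.
    by near: r; exact: nbhs_right_le.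
  move=> [s r] [/= ts]; rewrite !in_itv/= => /andP[r0 rd] sT.
  exact: Pm r0 rd (Pd s sT ts).
have [r [r0 Pr]] := filter_ex (filterI (nbhs_right_gt 0) near_P).
by exists r => // t tT; apply: Pr; rewrite /= in_itv.
Unshelve. all: by end_near. Qed.

Lemma bounded_on_segment {m k} (F : R -> 'M[R]_(m, k)) : t0 <= T ->
  cts `[t0, T] F -> exists2 M, 0 <= M & forall t, t0 <= t <= T -> `|F t| <= M.
Proof.
move=> t0T Fc; have [] := @EVT_max _ (fun t => `|F t|) t0 T t0T.
  by apply/ctsP => t Dt; apply: cvg_norm; exact: Fc.
by move=> c _ Mc; exists `|F c| => // t tT; apply: Mc; rewrite in_itv.
Qed.

Local Notation D := `[t0, T]%classic.

Lemma uniform_continuity_segment {m k} (F : R -> 'M[R]_(m, k)) (e : R) : 0 < e ->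
  cts D F -> exists2 d : R, 0 < d & forall s t, t0 <= s <= T -> t0 <= t <= T ->
    `|s - t| <= d -> `|F s - F t| <= e.
Proof.
move=> e0 Fc.
pose P d t := forall s, t0 <= s <= T -> `|s - t| <= d -> `|F s - F t| <= e.
have [] := @uniform_on_segment P.
- by move=> r r' t r'0 r'r Pr s sT st; apply: Pr => //; exact: le_trans st r'r.
- move=> t tT; have Dt : D t by rewrite /= in_itv.
  have e20 : 0 < e / 2 by rewrite divr_gt0.
  have /cvgrPdist_lt/(_ _ e20) := Fc t Dt.
  rewrite /within/= => /nbhs_ballP[d /= d0 Fd].
  exists (d / 2); first by rewrite divr_gt0.
  move=> s sT ts s' s'T ss'.
  have close u : t0 <= u <= T -> `|t - u| < d -> `|F t - F u| < e / 2.
    by move=> uT tu; apply: Fd => //; rewrite in_itv.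
  have h1 : `|F t - F s| < e / 2.
    by apply: close => //; apply: lt_le_trans ts _; rewrite ler_pdivrMr// ler_pMr// ler1n.
  have h2 : `|F t - F s'| < e / 2.
    apply: close => //; apply: le_lt_trans (ler_distD s _ _) _.
    by rewrite [d]splitr (distrC s) ltr_leD.
  apply: ltW; apply: le_lt_trans (ler_distD (F t) _ _) _.
  by rewrite distrC [e]splitr ltrD.
by move=> d d0 Pd; exists d => // s t sT tT st; exact: Pd.
Qed.

(** Both values are compared with [F t (x t)] at a nearby base point of the graph of [x];
    compactness is needed in time only. *)
Lemma uniform_tube {m k} (E : set (R * 'cV[R]_n)) (F : R -> 'cV[R]_n -> 'M[R]_(m, k)) (x : R -> 'cV[R]_n)
    (e : R) : (forall t y, t0 <= t <= T -> E (t, y)) -> 0 < e ->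
  cts E (fun p : R * 'cV[R]_n => F p.1 p.2) -> cts D x ->
  exists2 r : R, 0 < r & forall t, t0 <= t <= T ->
    forall y, `|y - x t| <= r -> `|F t y - F t (x t)| <= e.
Proof.
move=> inE e0 Fc xc.
have [] := @uniform_on_segment (fun r t => forall y, `|y - x t| <= r -> `|F t y - F t (x t)| <= e).
- by move=> r r' t r'0 r'r Pr y yt; apply: Pr; exact: le_trans yt r'r.
- move=> t tT; have Dt : D t by rewrite /= in_itv.
  have e20 : 0 < e / 2 by rewrite divr_gt0.
  have /cvgrPdist_lt/(_ _ e20) := Fc (t, x t) (inE t _ tT).
  rewrite /within/= => /nbhs_ballP[d /= d0 Fd].
  have d20 : 0 < d / 2 by rewrite divr_gt0.
  have /cvgrPdist_lt/(_ _ d20) := xc t Dt.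
  rewrite /within/= => /nbhs_ballP[d' /= d'0 xd].
  exists (Num.min (d / 2) d'); first by rewrite lt_min d20.
  move=> s sT; rewrite lt_min => /andP[tsd tsd'] y; rewrite le_min => /andP[yd _].
  have dd : d / 2 < d by rewrite ltr_pdivrMr// ltr_pMr// ltr1n.
  have xts : `|x t - x s| < d / 2 by apply: xd => //; rewrite in_itv.
  have close v : `|x t - v| < d -> `|F t (x t) - F s v| < e / 2.
    move=> xv; apply: (Fd (s, v)) => /=.
      by split=> /=; [exact: lt_trans tsd dd|move: xv; rewrite -[ball _ _ _]/(ball (x t) d v) mx_norm_ball].
    exact: inE.
  have h1 := close _ (lt_trans xts dd).
  have h2 : `|F t (x t) - F s y| < e / 2.
    apply: close; apply: le_lt_trans (ler_distD (x s) _ _) _.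
    by rewrite [d]splitr ltr_leD// distrC.
  apply: ltW; apply: le_lt_trans (ler_distD (F t (x t)) _ _) _.
  by rewrite distrC [e]splitr ltrD.
by move=> r r0 Pr; exists r.
Qed.

End Compactness.

(** * Error propagation *)

(** Writing [u - us] as [N^-1 N (u - us)], the part linear in [u - us] cancels. What survives is the
    Taylor remainder of [f] and a term linear in [z - zs]. *)
Lemma newton_error (F : fieldType) n (M P1 P2 J A' : 'M[F]_n) (z zs u us y ys fy fys : 'cV[F]_n) :
  let N := 1%:M - M *m J *m P2 in
  N \in unitmx -> y - ys = P1 *m (z - zs) + P2 *m (u - us) ->
  us = M *m (fys - A' *m P1 *m zs) ->
  u - invmx N *m (u - M *m (fy - A' *m P1 *m z)) - us =
  invmx N *m (M *m (fy - fys - J *m (y - ys)) + M *m ((J *m P1 - A' *m P1) *m (z - zs))).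
Proof.
move=> N Nu yE usE.
have -> : u - invmx N *m (u - M *m (fy - A' *m P1 *m z)) - us =
    invmx N *m (N *m (u - us) - (u - M *m (fy - A' *m P1 *m z))).
  by rewrite [RHS](mulmxBr (invmx N)) (mulKmx Nu) addrAC.
have gE : M *m fys = us + M *m A' *m P1 *m zs.
  by rewrite usE mulmxBr !mulmxA subrK.
congr (_ *m _); rewrite yE /N.
rewrite !(mulmxBr, mulmxDr, mulmxBl, mulmxDl, mulmxN, mulNmx, mulmxA, mul1mx) gE.
move: (M *m fy) (M *m J *m P1 *m z) (M *m J *m P1 *m zs) (M *m J *m P2 *m u)
  (M *m J *m P2 *m us) (M *m A' *m P1 *m z) (M *m A' *m P1 *m zs) => a b c d e g k.
by apply/matrixP => i j; rewrite !mxE; ring.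
Qed.

Section OneStep.
Context {R : realType} {n : nat}.
Variables (A B : R -> 'M[R]_n.+1) (C2 : R -> R) (f : R -> 'cV[R]_n.+1 -> 'cV[R]_n.+1).
Variables (tp t0 T : R) (x : R -> 'cV[R]_n.+1).
Local Notation P1 := (P1 A B C2).
Local Notation P2 := (P2 A B C2).
Local Notation Q1 := (Q1 A B C2).
Local Notation Q2 := (Q2 A B C2).
Local Notation Ginv := (Ginv A B C2).
Local Notation A' := (A' A tp).
Local Notation rhs := (z_rhs A B C2 f tp).

Definition newton_mx t (y : 'cV[R]_n.+1) : 'M[R]_n.+1 :=
  1%:M - Ginv t *m Q2 t *m jac (f t) y *m P2 t.

Let zs t := P1 t *m x t.
Let us t := P2 t *m x t.
Let rhss t := rhs t (zs t) (x t).

Variables (K r : R).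
Hypothesis K1 : 1 <= K.

Hypothesis zs_fix : forall t, t0 <= t <= T -> P1 t *m zs t = zs t.
Hypothesis us_fix : forall t, t0 <= t <= T -> P2 t *m us t = us t.
Hypothesis us_eq : forall t, t0 <= t <= T ->
  us t = Ginv t *m Q2 t *m (f t (x t) - A' t *m P1 t *m zs t).
Hypothesis Nu : forall t y, t0 <= t <= T -> newton_mx t y \in unitmx.

Hypothesis bP1 : forall t v, t0 <= t <= T -> `|P1 t *m v| <= K * `|v : 'cV_n.+1|.
Hypothesis bP2 : forall t v, t0 <= t <= T -> `|P2 t *m v| <= K * `|v : 'cV_n.+1|.
Hypothesis bM1 : forall t v, t0 <= t <= T -> `|Ginv t *m Q1 t *m v| <= K * `|v : 'cV_n.+1|.
Hypothesis bM2 : forall t v, t0 <= t <= T -> `|Ginv t *m Q2 t *m v| <= K * `|v : 'cV_n.+1|.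
Hypothesis bDr : forall t v, t0 <= t <= T -> `|drift A B C2 tp t *m v| <= K * `|v : 'cV_n.+1|.
Hypothesis bInv : forall t y v, t0 <= t <= T -> `|y - x t| <= r ->
  `|invmx (newton_mx t y) *m v| <= K * `|v : 'cV_n.+1|.
Hypothesis bJP : forall t y v, t0 <= t <= T -> `|y - x t| <= r ->
  `|(jac (f t) y *m P1 t - A' t *m P1 t) *m v| <= K * `|v : 'cV_n.+1|.
Hypothesis bTaylor : forall t y, t0 <= t <= T -> `|y - x t| <= r ->
  `|f t y - f t (x t) - jac (f t) y *m (y - x t)| <= (2 * K ^+ 3)^-1 * `|y - x t|.
Hypothesis bLip : forall t y, t0 <= t <= T -> `|y - x t| <= r ->
  `|f t y - f t (x t)| <= K * `|y - x t|.

Let K0 : 0 < K. Proof. exact: lt_le_trans K1. Qed.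

Lemma exact_split t : t0 <= t <= T -> x t = P1 t *m zs t + P2 t *m us t.
Proof.
move=> tT; rewrite zs_fix// us_fix// /zs /us -mulmxDl /Defs.P2 addrC subrK.
by rewrite mul1mx.
Qed.

Lemma state_diff t z u : t0 <= t <= T ->
  P1 t *m z + P2 t *m u - x t = P1 t *m (z - zs t) + P2 t *m (u - us t).
Proof. by move=> tT; rewrite (exact_split tT) !mulmxBr opprD addrACA. Qed.

Lemma state_bound t z u : t0 <= t <= T ->
  `|P1 t *m z + P2 t *m u - x t| <= K * (`|z - zs t| + `|u - us t|).
Proof.
move=> tT; rewrite state_diff// mulrDr; apply: le_trans (ler_normD _ _) _.
by apply: lerD; [exact: bP1|exact: bP2].
Qed.

(** Three factors [K], from the inverse, from [G^-1 Q2] and from [state_bound], cancel the Taylor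
    constant [(2 K^3)^-1] down to 1/2; this is the origin of that constant. *)
Lemma newton_bound t z u : t0 <= t <= T ->
  K * (`|z - zs t| + `|u - us t|) <= r ->
  `|newton_step A B C2 f tp t z u - us t| <=
    2^-1 * `|u - us t| + (K ^+ 3 + 1) * `|z - zs t|.
Proof.
move=> tT small; have sb := state_bound z u tT.
set y := P1 t *m z + P2 t *m u in sb *.
have yr : `|y - x t| <= r := le_trans sb small.
rewrite /newton_step -/y.
rewrite (newton_error (f t y) (Nu y tT) (state_diff z u tT) (us_eq tT)).
apply: le_trans (bInv _ tT yr) _.
have b1 : `|Ginv t *m Q2 t *m (f t y - f t (x t) - jac (f t) y *m (y - x t))| <=
    K * ((2 * K ^+ 3)^-1 * (K * (`|z - zs t| + `|u - us t|))).
  apply: le_trans (bM2 _ tT) _; apply: ler_wpM2l; first exact: ltW.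
  apply: le_trans (bTaylor tT yr) _; apply: ler_wpM2l => //.
  by rewrite invr_ge0 mulr_ge0// exprn_ge0// ltW.
have b2 : `|Ginv t *m Q2 t *m ((jac (f t) y *m P1 t - A' t *m P1 t) *m (z - zs t))| <=
    K * (K * `|z - zs t|).
  apply: le_trans (bM2 _ tT) _; apply: ler_wpM2l; first exact: ltW.
  exact: bJP.
apply: (@le_trans _ _ (K * (K * ((2 * K ^+ 3)^-1 * (K * (`|z - zs t| + `|u - us t|))) + K * (K * `|z - zs t|)))).
  by apply: ler_wpM2l; [exact: ltW|apply: le_trans (ler_normD _ _) _; exact: lerD].
have -> : K * (K * ((2 * K ^+ 3)^-1 * (K * (`|z - zs t| + `|u - us t|))) + K * (K * `|z - zs t|)) =
   2^-1 * (`|z - zs t| + `|u - us t|) + K ^+ 3 * `|z - zs t|.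
  by field; exact: lt0r_neq0.
have := normr_ge0 (z - zs t); lra.
Qed.

Lemma rhs_bound t z y : t0 <= t <= T -> `|y - x t| <= r ->
  `|rhs t z y - rhss t| <= K ^+ 2 * (`|z - zs t| + `|y - x t|).
Proof.
move=> tT yr.
have -> : rhs t z y - rhss t =
    drift A B C2 tp t *m (z - zs t) + Ginv t *m Q1 t *m (f t y - f t (x t)).
  by rewrite /rhss /z_rhs !mulmxBr opprD addrACA.
apply: le_trans (ler_normD _ _) _.
have b1 := bDr (z - zs t) tT.
have b2 : `|Ginv t *m Q1 t *m (f t y - f t (x t))| <= K * (K * `|y - x t|).
  apply: le_trans (bM1 _ tT) _; apply: ler_wpM2l; first exact: ltW.
  exact: bLip.
apply: le_trans (lerD b1 b2) _; rewrite expr2 mulrDr mulrA lerD2r.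
by rewrite -mulrA; apply: ler_wpM2l; [exact: ltW|exact: ler_peMl].
Qed.

(** In terms of [rhs] the step is Heun's method: an Euler predictor and a trapezoidal corrector,
    each followed by a Newton step from the old [u]. *)
Lemma method_stepE (h t t' : R) (s : @state R n.+1) :
  let p := rhs t (zc s) (xc s) in
  let zt := zc s + h *: p in
  let ut := newton_step A B C2 f tp t' zt (uc s) in
  let z := zc s + (h / 2) *: p +
    (h / 2) *: rhs t' zt (P1 t' *m zt + P2 t' *m ut) in
  let u := newton_step A B C2 f tp t' z (uc s) in
  method_step A B C2 f tp h t t' s = State z u (P1 t' *m z + P2 t' *m u).
Proof.
move=> p zt ut z u; rewrite /method_step.
have -> : (1%:M + h *: drift A B C2 tp t) *m zc s +
    h *: (Ginv t *m Q1 t *m f t (xc s)) = zt.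
  by rewrite mulmxDl mul1mx -scalemxAl -addrA -scalerDr.
rewrite -/ut.
have -> : (1%:M + (h / 2) *: drift A B C2 tp t) *m zc s +
    (h / 2) *: (drift A B C2 tp t' *m zt) +
    (h / 2) *: (Ginv t *m Q1 t *m f t (xc s) +
       Ginv t' *m Q1 t' *m f t' (P1 t' *m zt + P2 t' *m ut)) = z.
  rewrite /z mulmxDl mul1mx -scalemxAl -!addrA; congr (_ + _).
  rewrite -!scalerDr; congr (_ *: _).
  by rewrite addrA addrACA.
by [].
Qed.

(* The step preserves [|z_i - z| <= a] and [|u_i - u| <= newton_factor * a] with
   [a] replaced by [a * (1 + growth_rate * h)]: [c0] bounds the error of the
   right-hand side, [c1 a] and [c2 a] those of the predictors. *)
Let C := K ^+ 3 + 1.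
Let c0 := K ^+ 2 * (1 + K * (1 + 3 * C)).
Let c1 := 2 + c0.
Let c2 := 2 * C + C * c1.
Definition growth_rate : R := c0 + K ^+ 2 * (c1 + K * (c1 + c2)) + 1.
Definition smallness_factor : R := K * (c1 + c2 + 4 * C + 4).
Definition newton_factor : R := 3 * C.

(** Defects are required against the slopes at both ends, because the corrector averages them. The
    summand 1 in [growth_rate] pays for these defects, the others for the errors of the two
    evaluations of [rhs]. *)
Lemma method_step_bound (h t t' a : R) (s : @state R n.+1) :
  t0 <= t -> t' = t + h -> t' <= T -> 0 < h <= 1 -> 0 <= a ->
  smallness_factor * (a * (1 + growth_rate * h)) <= r ->
  `|us t' - us t| <= a ->
  `|zs t' - zs t - h *: rhss t| <= h * a ->
  `|zs t' - zs t - h *: rhss t'| <= h * a ->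
  `|zc s - zs t| <= a -> `|uc s - us t| <= newton_factor * a ->
  xc s = P1 t *m zc s + P2 t *m uc s ->
  let s' := method_step A B C2 f tp h t t' s in
  let a' := a * (1 + growth_rate * h) in
  [/\ `|zc s' - zs t'| <= a', `|uc s' - us t'| <= newton_factor * a' &
      xc s' = P1 t' *m zc s' + P2 t' *m uc s'].
Proof.
move=> t0t t'E t'T /andP[h0 h1] a0 small ua za za' ze ue xs s' a'.
have tT : t0 <= t <= T by rewrite t0t/= (le_trans _ t'T)// t'E lerDl ltW.
have t'I : t0 <= t' <= T by rewrite t'T andbT (le_trans t0t)// t'E lerDl ltW.
have C1 : 1 <= C by rewrite /C lerDr exprn_ge0// ltW.
have K2 : 1 <= K ^+ 2 by rewrite expr_ge1// ltW.
have c00 : 0 <= c0 by rewrite /c0 !mulr_ge0 ?addr_ge0 ?mulr_ge0 ?ltW//; lra.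
have c12 : 2 <= c1 by rewrite /c1; lra.
have c20 : 0 <= c2 by rewrite /c2; nra.
pose c3 := K ^+ 2 * (c1 + K * (c1 + c2)).
have K00 : 0 <= K := ltW K0.
have c10 : 0 <= c1 by rewrite addr_ge0.
have c30 : 0 <= c3.
  apply: mulr_ge0; first exact: le_trans K2.
  by apply: addr_ge0 => //; apply: mulr_ge0 => //; exact: addr_ge0.
have h0' : 0 <= h := ltW h0.
have g0 : 0 <= growth_rate by rewrite /growth_rate addr_ge0// addr_ge0.
have aa' : a <= a' by rewrite /a' mulrDr mulr1 lerDl !mulr_ge0.
have C0 : 0 <= C := le_trans ler01 C1.
have nfE : newton_factor = 3 * C by [].
(* Every pair of errors met below sums to at most this multiple of [a'], so all intermediate states
   stay in the tube. *)
have small_le X : X <= (c1 + c2 + 4 * C + 4) * a' -> K * X <= r.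
  move=> Xa; apply: le_trans small; rewrite /smallness_factor -mulrA.
  by apply: ler_wpM2l => //; exact: ltW.
have le_a' k : 0 <= k -> k <= c1 + c2 + 4 * C + 4 -> k * a <= (c1 + c2 + 4 * C + 4) * a'.
  by move=> k0 kc; apply: ler_pM.
rewrite nfE in ue *.
have b : `|xc s - x t| <= K * ((1 + 3 * C) * a).
  rewrite xs; apply: le_trans (state_bound _ _ tT) _; apply: ler_wpM2l; first exact: ltW.
  by apply: le_trans (lerD ze ue) _; lra.
have br : `|xc s - x t| <= r.
  by apply: le_trans b _; apply/small_le/le_a'; lra.
pose p := rhs t (zc s) (xc s).
have pb : `|p - rhss t| <= c0 * a.
  apply: le_trans (rhs_bound _ tT br) _.
  apply: (@le_trans _ _ (K ^+ 2 * (a + K * ((1 + 3 * C) * a)))).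
    by apply: ler_wpM2l (lerD ze b); exact: le_trans K2.
  by rewrite /c0 le_eqVlt; apply/orP; left; apply/eqP; ring.
pose zt := zc s + h *: p.
have ztb : `|zt - zs t'| <= c1 * a.
  have -> : zt - zs t' = (zc s - zs t) + h *: (p - rhss t) - (zs t' - zs t - h *: rhss t).
    by rewrite /zt; apply/matrixP => i j; rewrite !mxE; ring.
  apply: le_trans (ler_normB _ _) _.
  have e1 : `|zc s - zs t + h *: (p - rhss t)| <= a + h * (c0 * a).
    apply: le_trans (ler_normD _ _) _; apply: lerD => //.
    by rewrite normrZ ger0_norm// ler_wpM2l.
  apply: le_trans (lerD e1 za) _.
  have : h * (c0 * a) <= 1 * (c0 * a) by apply: ler_wpM2r => //; exact: mulr_ge0.
  have : h * a <= 1 * a by apply: ler_wpM2r.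
  rewrite /c1; lra.
have uc' : `|uc s - us t'| <= 4 * C * a.
  apply: le_trans (ler_distD (us t) _ _) _; rewrite [X in _ + X]distrC.
  apply: le_trans (lerD ue ua) _.
  have : 1 * a <= C * a by apply: ler_wpM2r.
  lra.
pose ut := newton_step A B C2 f tp t' zt (uc s).
have utb : `|ut - us t'| <= c2 * a.
  apply: le_trans (newton_bound t'I _) _.
    apply: small_le; apply: le_trans (lerD ztb uc') _.
    by rewrite -mulrDl; apply: le_a'; lra.
  have : (K ^+ 3 + 1) * `|zt - zs t'| <= C * (c1 * a) by apply: ler_wpM2l => //; lra.
  rewrite /c2; lra.
pose xt := P1 t' *m zt + P2 t' *m ut.
have xtb : `|xt - x t'| <= K * ((c1 + c2) * a).
  apply: le_trans (state_bound _ _ t'I) _; apply: ler_wpM2l; first exact: ltW.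
  by rewrite mulrDl; exact: lerD.
have xtr : `|xt - x t'| <= r.
  by apply: le_trans xtb _; apply/small_le/le_a'; lra.
pose q := rhs t' zt xt.
have qb : `|q - rhss t'| <= c3 * a.
  apply: le_trans (rhs_bound _ t'I xtr) _.
  apply: (@le_trans _ _ (K ^+ 2 * (c1 * a + K * ((c1 + c2) * a)))).
    by apply: ler_wpM2l (lerD ztb xtb); exact: le_trans K2.
  by rewrite /c3 le_eqVlt; apply/orP; left; apply/eqP; ring.
pose z := zc s + (h / 2) *: p + (h / 2) *: q.
have zb : `|z - zs t'| <= a'.
  have -> : z - zs t' = (zc s - zs t) + ((h / 2) *: (p - rhss t) + (h / 2) *: (q - rhss t'))
      - (2^-1 *: (zs t' - zs t - h *: rhss t) + 2^-1 *: (zs t' - zs t - h *: rhss t')).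
    by rewrite /z; apply/matrixP => i j; rewrite !mxE; field.
  have h20 : 0 <= h / 2 by rewrite divr_ge0.
  have h2n : `|h / 2| = h / 2 by rewrite ger0_norm.
  have i2n : `|2^-1 : R| = 2^-1 by rewrite ger0_norm// invr_ge0.
  apply: le_trans (ler_normB _ _) _.
  apply: (@le_trans _ _ ((a + (h / 2 * (c0 * a) + h / 2 * (c3 * a))) + (2^-1 * (h * a) + 2^-1 * (h * a)))).
    apply: lerD; last first.
      apply: le_trans (ler_normD _ _) _; rewrite !normrZ i2n.
      by apply: lerD; apply: ler_wpM2l => //; rewrite invr_ge0.
    apply: le_trans (ler_normD _ _) _; apply: lerD => //.
    apply: le_trans (ler_normD _ _) _; apply: lerD; rewrite normrZ.
      by rewrite (ger0_norm h20); exact: ler_wpM2l.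
    by rewrite (ger0_norm h20); exact: ler_wpM2l.
  have : 0 <= h * (c0 * a) by apply: mulr_ge0 => //; exact: mulr_ge0.
  have : 0 <= h * (c3 * a) by apply: mulr_ge0 => //; exact: mulr_ge0.
  rewrite /a' /growth_rate -/c3; lra.
pose u := newton_step A B C2 f tp t' z (uc s).
(* Origin of [3 * C]: the old [u] is within [3 C a + a <= 4 C a] of the new exact value, halving
   gives [2 C a], and the error of [z] adds [C a']. *)
have ub : `|u - us t'| <= 3 * C * a'.
  have Caa : C * a <= C * a' by apply: ler_wpM2l.
  apply: le_trans (newton_bound t'I _) _.
    apply: small_le; apply: le_trans (lerD zb uc') _.
    have a'0 : 0 <= a' := le_trans a0 aa'.
    have : 0 <= (c1 + c2) * a' by apply: mulr_ge0 => //; lra.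
    lra.
  have : (K ^+ 3 + 1) * `|z - zs t'| <= C * a' by apply: ler_wpM2l.
  lra.
have -> : s' = State z u (P1 t' *m z + P2 t' *m u) by rewrite /s' method_stepE.
by split.
Qed.

Lemma growth_rate_ge0 : 0 <= growth_rate.
Proof.
have K00 : 0 <= K := ltW K0.
have C0 : 0 <= C by rewrite addr_ge0// exprn_ge0.
have k2 : 0 <= K ^+ 2 by rewrite exprn_ge0.
have c00 : 0 <= c0.
  by apply: mulr_ge0 => //; apply: addr_ge0 => //; apply: mulr_ge0 => //;
     apply: addr_ge0 => //; exact: mulr_ge0.
have c10 : 0 <= c1 by exact: addr_ge0.
have c20 : 0 <= c2 by apply: addr_ge0; exact: mulr_ge0.
apply: addr_ge0 => //; apply: addr_ge0 => //; apply: mulr_ge0 => //.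
by apply: addr_ge0 => //; apply: mulr_ge0 => //; exact: addr_ge0.
Qed.

Lemma growth_le (h : R) (N i : nat) : 0 <= h -> N%:R * h = T - t0 -> (i <= N)%N ->
  (1 + growth_rate * h) ^+ i <= expR (growth_rate * (T - t0)).
Proof.
move=> h0 Nh iN; have gh : 0 <= growth_rate * h by rewrite mulr_ge0// growth_rate_ge0.
apply: (@le_trans _ _ ((1 + growth_rate * h) ^+ N)).
  by apply: ler_weXn2l => //; rewrite lerDl.
rewrite -Nh mulrCA expRM_natl.
apply: lerXn2r; rewrite ?nnegrE ?expR_ge0 ?addr_ge0//.
exact: expR_ge1Dx.
Qed.

Hypothesis t0T : t0 < T.

(** A discrete Gronwall argument with [a i = d (1 + growth_rate h)^i]. The initial error is 0, but
    [a 0 = d] because each step requires its bound to dominate the modulus [d]. *)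
Lemma method_bound (h d : R) (N : nat) : 0 < h <= 1 -> N%:R * h = T - t0 -> 0 <= d ->
  smallness_factor * (d * expR (growth_rate * (T - t0))) <= r ->
  (forall t, t0 <= t -> t + h <= T ->
    [/\ `|us (t + h) - us t| <= d, `|zs (t + h) - zs t - h *: rhss t| <= h * d &
        `|zs (t + h) - zs t - h *: rhss (t + h)| <= h * d]) ->
  forall i, (i <= N)%N ->
    `|x (grid t0 h i) - xc (method A B C2 f tp t0 (x t0) h i)| <=
      K * (1 + newton_factor) * (d * expR (growth_rate * (T - t0))).
Proof.
move=> h01 Nh d0 small modulus.
have h0 : 0 <= h by case/andP: h01 => /ltW.
have K00 : 0 <= K := ltW K0.
have g0 := growth_rate_ge0.
have gh : 1 <= 1 + growth_rate * h by rewrite lerDl mulr_ge0.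
have gridT i : (i <= N)%N -> t0 <= grid t0 h i <= T.
  move=> iN; rewrite /grid lerDl mulr_ge0//= -lerBrDl -Nh.
  by rewrite ler_wpM2r// ler_nat.
have C0 : 0 <= C by rewrite addr_ge0// exprn_ge0.
have nf0 : 0 <= newton_factor by exact: mulr_ge0.
have sm0 : 0 <= smallness_factor.
  have c00 : 0 <= c0.
    by apply: mulr_ge0; [exact: exprn_ge0|apply: addr_ge0 => //; apply: mulr_ge0 => //;
       apply: addr_ge0 => //; exact: mulr_ge0].
  have c10 : 0 <= c1 by exact: addr_ge0.
  have c20 : 0 <= c2 by apply: addr_ge0; exact: mulr_ge0.
  apply: mulr_ge0 => //; apply: addr_ge0 => //; apply: addr_ge0; last exact: mulr_ge0.
  exact: addr_ge0.
pose a i := d * (1 + growth_rate * h) ^+ i.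
have ad i : d <= a i by rewrite /a ler_peMr// exprn_ege1.
have main i : (i <= N)%N -> let s := method A B C2 f tp t0 (x t0) h i in
   [/\ `|zc s - zs (grid t0 h i)| <= a i, `|uc s - us (grid t0 h i)| <= newton_factor * a i &
      xc s = P1 (grid t0 h i) *m zc s + P2 (grid t0 h i) *m uc s].
  elim: i => [|i IH] iN /=.
    have -> : grid t0 h 0 = t0 by rewrite /grid mul0r addr0.
    rewrite /a expr0 mulr1 !subrr normr0; split=> //; first exact: mulr_ge0.
    by apply: exact_split; rewrite lexx ltW.
  have [ze ue xe] := IH (ltnW iN).
  have gE : grid t0 h i.+1 = grid t0 h i + h by rewrite /grid -natr1 mulrDl mul1r addrA.
  have /andP[ti _] := gridT i (ltnW iN); have /andP[_ tiT] := gridT i.+1 iN.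
  have tiT' : grid t0 h i + h <= T by rewrite -gE.
  have [m1 m2 m3] := modulus _ ti tiT'.
  have aE : a i.+1 = a i * (1 + growth_rate * h) by rewrite /a exprSr mulrA.
  rewrite aE; apply: (method_step_bound ti gE tiT h01) => //.
  - exact: le_trans (ad i).
  - apply: le_trans small; apply: ler_wpM2l => //.
    by rewrite -aE; apply: ler_wpM2l => //; exact: growth_le Nh iN.
  - by rewrite gE; exact: le_trans (ad i).
  - by rewrite gE; apply: le_trans m2 _; apply: ler_wpM2l.
  - by rewrite gE; apply: le_trans m3 _; apply: ler_wpM2l.
move=> i iN; have [ze ue ->] := main i iN.
rewrite distrC; apply: le_trans (state_bound _ _ (gridT i iN)) _.
rewrite -mulrA; apply: ler_wpM2l => //.
apply: le_trans (lerD ze ue) _; rewrite -[X in X + _]mul1r -mulrDl.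
apply: ler_wpM2l; first exact: addr_ge0.
by apply: ler_wpM2l => //; exact: growth_le Nh iN.
Qed.

End OneStep.

(** * Invertibility of the Newton matrix, uniform constants, passage to the limit *)

Lemma unitmx_inj (F : fieldType) n (N : 'M[F]_n) :
  (forall v : 'cV[F]_n, N *m v = 0 -> v = 0) -> N \in unitmx.
Proof.
move=> Ninj; rewrite unitmxE unitfE -det_tr; apply/det0P => -[v v0 vN].
move/eqP: v0; apply; apply: trmx_inj; rewrite trmx0; apply: Ninj.
by apply: trmx_inj; rewrite trmx_mul trmxK trmx0.
Qed.

Lemma enorm_le (R : realType) n (v : 'cV[R]_n) : enorm v <= n%:R * `|v|.
Proof.
have -> : enorm v = Num.sqrt (\sum_i `|v i 0| ^+ 2).
  by congr Num.sqrt; apply: eq_bigr => i _; rewrite real_normK ?num_real.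
apply: le_trans (sqrt_sum_sqr_le _ _ _ _) _ => [i|]; first exact: normr_ge0.
rewrite mulr_natl -[X in _ *+ X]card_ord -sumr_const; apply: ler_sum => i _.
exact: mx_entry_le.
Qed.

Lemma jac_mulmx (R : realType) m n p (Q : 'M[R]_(p, m)) (g : 'cV[R]_n -> 'cV[R]_m) x :
  differentiable g x -> jac (fun y => Q *m g y) x = Q *m jac g x.
Proof.
move=> dg.
have Qc : continuous (mulmx Q : 'cV[R]_m -> 'cV[R]_p).
  move=> y; exact: (@cvg_mulmx R _ (nbhs y) (nbhs_filter y) _ _ _ (fun=> Q) id Q y
    (cvg_cst Q) cvg_id).
have E : 'd (fun y => Q *m g y) x = (mulmx Q) \o 'd g x :> (_ -> _).
  have dQ y : differentiable (mulmx Q : 'cV[R]_m -> 'cV[R]_p) y.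
    exact: linear_differentiable.
  by rewrite (diff_comp dg (dQ _)) diff_lin.
apply/matrixP => i j; rewrite [LHS]mxE E /= !mxE.
by apply: eq_bigr => k _; rewrite [jac g x k j]mxE.
Qed.

Section CtsOperations.
Context {R : realType} {n : nat}.

Lemma cts_sub {T U : topologicalType} (D E : set T) (F : T -> U) :
  E `<=` D -> cts D F -> cts E F.
Proof.
move=> ED Fc t Et; apply: cvg_trans (Fc t (ED _ Et)); apply: cvg_app => P.
by apply: (@filterS _ (nbhs t)) => s PD /ED.
Qed.

Lemma cts_fst {U : topologicalType} (I : set R) (F : R -> U) :
  cts I F -> cts [set p : R * 'cV[R]_n | I p.1] (fun p => F p.1).
Proof.
move=> Fc -[t y] /= It P /(Fc t It).
rewrite /nbhs/= /within/= => H.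
exists ((fun s => I s -> P (F s)), setT) => /=; first by split => //; exact: filterT.
by move=> [s v] [/= Hs _].
Qed.

Lemma cts_graph {U : topologicalType} (I : set R) (F : R * 'cV[R]_n -> U) (x : R -> 'cV[R]_n) :
  cts [set p : R * 'cV[R]_n | I p.1] F -> cts I x -> cts I (fun t => F (t, x t)).
Proof.
move=> Fc xc t It.
apply: (@cvg_trans _ (F @ within [set p : R * 'cV[R]_n | I p.1] (nbhs (t, x t)))); last exact: Fc.
have xc' : (fun s => (s, x s)) @ within I (nbhs t) --> (t, x t).
  move=> P [[W V] /= [Wt Vx] WVP]; have := xc t It V Vx; rewrite /nbhs/= /within/=.
  move: Wt; apply: (@filterS2 _ (nbhs t)) => s Ws Hs Is; apply: WVP; split => //.
  exact: Hs.
move=> P H; have := xc' _ H; rewrite /nbhs/= /within/=.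
by apply: filterS => s Hs Is; exact: Hs.
Qed.

End CtsOperations.

Section Assembly.
Context {R : realType} {n : nat}.
Variables (t0 T : R).
Local Notation I := `[t0, T]%classic.
Local Notation E := [set p : R * 'cV[R]_n.+1 | I p.1].

Lemma op_bound m k (F : 'M[R]_(m, k)) (M : R) (v : 'cV[R]_k) :
  `|F| <= M -> `|F *m v| <= k%:R * M * `|v|.
Proof.
move=> FM; apply: le_trans (mulmx_norm_le _ _) _.
by rewrite ler_wpM2r// ler_wpM2l.
Qed.

Lemma op_bounded m k (F : R -> 'M[R]_(m, k)) : t0 <= T -> cts I F ->
  exists M, forall K, M <= K -> forall t (v : 'cV_k), t0 <= t <= T -> `|F t *m v| <= K * `|v|.
Proof.
move=> t0T /(bounded_on_segment t0T)[M M0 Mb]; exists (k%:R * M) => K MK t v tT.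
by apply: le_trans (op_bound v (Mb t tT)) _; rewrite ler_wpM2r.
Qed.

Lemma tube_bounded m k (F : R -> 'cV[R]_n.+1 -> 'M[R]_(m, k)) (x : R -> 'cV[R]_n.+1) :
  t0 <= T -> cts E (fun p => F p.1 p.2) -> cts I x ->
  exists M, exists2 r : R, 0 < r &
    forall K, M <= K -> forall t y (v : 'cV_k), t0 <= t <= T -> `|y - x t| <= r ->
      `|F t y *m v| <= K * `|v|.
Proof.
move=> t0T Fc xc.
have [M M0 Mb] := bounded_on_segment t0T (cts_graph Fc xc).
have [|r r0 Fr] := uniform_tube (E := E) (F := F) (x := x) _ ltr01 Fc xc.
  by move=> t y tT; rewrite /= in_itv.
exists (k%:R * (1 + M)); exists r => // K MK t y v tT yr.
have FM : `|F t y| <= 1 + M.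
  rewrite -[F t y](subrK (F t (x t))); apply: le_trans (ler_normD _ _) _.
  by apply: lerD; [exact: Fr|exact: Mb].
by apply: le_trans (op_bound v FM) _; rewrite ler_wpM2r.
Qed.

End Assembly.

Section Convergence.
Context {R : realType} {n : nat}.
Variables (tp : R) (f : R -> 'cV[R]_n.+1 -> 'cV[R]_n.+1).
Variables (A B : R -> 'M[R]_n.+1) (C1 C2 : R -> R).
Hypothesis f_cont : {within [set p | tp <= p.1],
  continuous (fun p : R * 'cV[R]_n.+1 => f p.1 p.2)}.
Hypothesis f_diff : forall t x, tp <= t -> differentiable (f t) x.
Hypothesis dfdx_cont : {within [set p | tp <= p.1],
  continuous (fun p : R * 'cV[R]_n.+1 => jac (f p.1) p.2)}.
Hypothesis A_C1 : C1_on `[tp, +oo[ A.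
Hypothesis B_C1 : C1_on `[tp, +oo[ B.
Hypothesis C2_gt0 : forall t, tp <= t -> 0 < C2 t.
Hypothesis C2_C1 : C1_on `[tp, +oo[ C2.
Hypothesis resolvent_bound : forall t (lam : R[i]), tp <= t ->
  real_complex R (C2 t) <= `|lam| ->
  pencil A B t lam \in unitmx /\ opnorm (invmx (pencil A B t lam)) <= C1 t.
Variables (t0 T : R).
Hypothesis tp_le_t0 : tp <= t0.
Hypothesis t0_lt_T : t0 < T.
Hypothesis Phi_invertible : forall t (z u : 'cV[R]_n.+1), t0 <= t -> t <= T ->
  invertible_between (X2 A B C2 t) (Y2 A B C2 t)
    (Phi A B C2 f t (P1 A B C2 t *m z) (P2 A B C2 t *m u)).
Variables (x0 : 'cV[R]_n.+1) (x : R -> 'cV[R]_n.+1).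
Hypothesis x_solution : is_solution A B f t0 x0 x.

Local Notation D := `[tp, +oo[%classic.
Local Notation I := `[t0, T]%classic.
Local Notation E := [set p : R * 'cV[R]_n.+1 | I p.1].
Local Notation P1 := (P1 A B C2).
Local Notation P2 := (P2 A B C2).
Local Notation Q1 := (Q1 A B C2).
Local Notation Q2 := (Q2 A B C2).
Local Notation Ginv := (Ginv A B C2).
Local Notation A' := (A' A tp).

(** A kernel vector satisfies [v = G^-1 Q2 J P2 v], hence [P1 v = 0] and [v] lies in [X2]. Since
    [G^-1 B P2 = P2], the equation reads [G^-1 Phi v = 0], and [Phi] is injective on [X2]. Any [y]
    is covered by taking [z = u = y] in the hypothesis. *)
Lemma newton_mx_unit t y : splitting A B C2 t -> tp <= t -> t0 <= t <= T ->
  newton_mx A B C2 f t y \in unitmx.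
Proof.
move=> [_ [PP Gu _ GBP GQ]] tpt /andP[t0t tT]; apply: unitmx_inj => v.
rewrite /newton_mx mulmxBl mul1mx => /eqP; rewrite subr_eq0 => /eqP vE.
have yE : P1 t *m y + P2 t *m y = y.
  by rewrite -mulmxDl /Defs.P2 addrC subrK mul1mx.
have PGQ : P1 t *m (Ginv t *m Q2 t) = 0.
  by rewrite /Defs.Q2 mulmxBr mulmx1 GQ mulmxBr mulmxA PP subrr.
have P1v : P1 t *m v = 0 by rewrite vE -!(mulmxA (Ginv t *m Q2 t)) mulmxA PGQ mul0mx.
have P2v : P2 t *m v = v by rewrite /Defs.P2 mulmxBl mul1mx P1v subr0.
set Ph := Phi A B C2 f t (P1 t *m y) (P2 t *m y).
have PhE : Ph = (Q2 t *m jac (f t) y - B t) *m P2 t.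
  by rewrite /Ph /Phi yE jac_mulmx//; exact: f_diff.
have GPh : Ginv t *m (Ph *m v) = 0.
  rewrite PhE mulmxBl mulmxBl mulmxBr !mulmxA GBP P2v -vE subrr.
  by [].
have Phv : Ph *m v = 0.
  have : G A B C2 t *m (Ginv t *m (Ph *m v)) = Ph *m v by rewrite mulKVmx.
  by rewrite GPh mulmx0.
have [_ + _] := Phi_invertible y y t0t tT.
move=> /(_ v 0); rewrite !inE mulmx0; apply => //.
  by exists v.
by exists 0 => //; rewrite mulmx0.
Qed.

Let DE t : D t = (tp <= t) :> Prop.
Proof. by rewrite /= in_itv/= andbT. Qed.

Let IE t : I t = (t0 <= t <= T) :> Prop.
Proof. by rewrite /= in_itv. Qed.

Let ID : I `<=` D.
Proof. by move=> t; rewrite IE DE => /andP[+ _]; exact: le_trans. Qed.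

Let tpI t : t0 <= t <= T -> tp <= t.
Proof. by case/andP=> + _; exact: le_trans. Qed.

Local Notation rhs := (z_rhs A B C2 f tp).
Let zs t := P1 t *m x t.
Let us t := P2 t *m x t.
Let rhss t := rhs t (zs t) (x t).
Let clI := @cts_class R R I.

Let ctsI m k (F : R -> 'M[R]_(m, k)) : mx_class (C1s D) F -> cts I F.
Proof. by move=> FC; apply: cts_sub ID _; apply/mx_cts => i j; exact: C1s_cts. Qed.

Let ctsM m k l (F : R -> 'M[R]_(m, k)) (F' : R -> 'M[R]_(k, l)) :
  cts I F -> cts I F' -> cts I (fun t => F t *m F' t).
Proof. by move=> Fc Fc'; apply/mx_cts; apply: (mxc_mul clI); exact/mx_cts. Qed.

Let ctsB m k (F F' : R -> 'M[R]_(m, k)) :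
  cts I F -> cts I F' -> cts I (fun t => F t - F' t).
Proof. by move=> Fc Fc'; apply/mx_cts; apply: (mxc_sub clI); exact/mx_cts. Qed.

Let ctsA m k (F F' : R -> 'M[R]_(m, k)) :
  cts I F -> cts I F' -> cts I (fun t => F t + F' t).
Proof. by move=> Fc Fc'; apply/mx_cts; apply: (mxc_add clI); exact/mx_cts. Qed.

Let x_cts : cts I x.
Proof.
have [/ctsP xc _ _ _] := x_solution; apply: cts_sub xc => t.
by rewrite IE /= in_itv/= andbT => /andP[].
Qed.

Let splits := splittingP A_C1 B_C1 C2_gt0 C2_C1 resolvent_bound.
Let splitt t : tp <= t -> splitting A B C2 t.
Proof. by have [+ _ _ _] := splits; apply. Qed.

Let P1_cts : cts I P1.
Proof. by have [_ h _ _] := splits; exact: ctsI. Qed.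
Let Q1_cts : cts I Q1.
Proof. by have [_ _ h _] := splits; exact: ctsI. Qed.
Let Gi_cts : cts I Ginv.
Proof. by have [_ _ _ h] := splits; exact: ctsI. Qed.
Let P2_cts : cts I P2.
Proof. by apply: ctsB => // t _; exact: cvg_cst. Qed.
Let Q2_cts : cts I Q2.
Proof. by apply: ctsB => // t _; exact: cvg_cst. Qed.
Let A'_cts : cts I A'.
Proof. by apply: cts_sub ID _; have [_ /ctsP] := A_C1. Qed.
Let P1'_cts : cts I (P1' A B C2 tp).
Proof.
apply: cts_sub ID _; have [_ h _ _] := splits.
exact: (entries_C1_on h).2.
Qed.
Let drift_cts : cts I (drift A B C2 tp).
Proof.
have B_cts : cts I B by apply: ctsI; exact: C1_on_entries.
exact (ctsM (ctsB P1'_cts (ctsM (ctsM Gi_cts Q1_cts) (ctsA A'_cts B_cts))) P1_cts).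
Qed.

Let E_sub : E `<=` [set p : R * 'cV[R]_n.+1 | tp <= p.1].
Proof. by move=> [t y] /= It; have := ID It; rewrite DE. Qed.

Let f_ctsE : cts E (fun p => f p.1 p.2).
Proof. by apply: cts_sub E_sub _; apply/ctsP. Qed.
Let jac_ctsE : cts E (fun p => jac (f p.1) p.2).
Proof. by apply: cts_sub E_sub _; apply/ctsP. Qed.

Let ctsEM m k l (F : R * 'cV[R]_n.+1 -> 'M[R]_(m, k)) (F' : R * 'cV[R]_n.+1 -> 'M[R]_(k, l)) :
  cts E F -> cts E F' -> cts E (fun t => F t *m F' t).
Proof. by move=> Fc Fc'; apply/mx_cts; apply: (mxc_mul (@cts_class _ R E)); exact/mx_cts. Qed.

Let ctsEB m k (F F' : R * 'cV[R]_n.+1 -> 'M[R]_(m, k)) :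
  cts E F -> cts E F' -> cts E (fun t => F t - F' t).
Proof. by move=> Fc Fc'; apply/mx_cts; apply: (mxc_sub (@cts_class _ R E)); exact/mx_cts. Qed.

Let newton_unit t y : t0 <= t <= T -> newton_mx A B C2 f t y \in unitmx.
Proof. by move=> tT; have tpt := tpI tT; apply: newton_mx_unit => //; exact: splitt. Qed.

Let inv_ctsE : cts E (fun p => invmx (newton_mx A B C2 f p.1 p.2)).
Proof.
apply/mx_cts; apply: (mxc_invmx (@cts_class _ R E)).
  by move=> p; rewrite -[E p]/(I p.1) IE => pT; exact: newton_unit.
have c1 : cts E (fun=> 1%:M : 'M[R]_n.+1) by move=> p _; exact: cvg_cst.
apply/mx_cts; exact (ctsEB c1
  (ctsEM (ctsEM (cts_fst (n := n.+1) (ctsM Gi_cts Q2_cts)) jac_ctsE) (cts_fst P2_cts))).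
Qed.

Let jacP_ctsE : cts E (fun p => jac (f p.1) p.2 *m P1 p.1 - A' p.1 *m P1 p.1).
Proof.
exact (ctsEB (ctsEM jac_ctsE (cts_fst P1_cts)) (cts_fst (ctsM A'_cts P1_cts))).
Qed.

Lemma step_constants : exists K r : R, [/\ 1 <= K, 0 < r,
  forall t (v : 'cV[R]_n.+1), t0 <= t <= T ->
    [/\ `|P1 t *m v| <= K * `|v|, `|P2 t *m v| <= K * `|v|,
        `|Ginv t *m Q1 t *m v| <= K * `|v|, `|Ginv t *m Q2 t *m v| <= K * `|v| &
        `|drift A B C2 tp t *m v| <= K * `|v|],
  forall t y (v : 'cV[R]_n.+1), t0 <= t <= T -> `|y - x t| <= r ->
    `|invmx (newton_mx A B C2 f t y) *m v| <= K * `|v| /\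
    `|(jac (f t) y *m P1 t - A' t *m P1 t) *m v| <= K * `|v| &
  forall t y, t0 <= t <= T -> `|y - x t| <= r ->
    `|f t y - f t (x t) - jac (f t) y *m (y - x t)| <= (2 * K ^+ 3)^-1 * `|y - x t| /\
    `|f t y - f t (x t)| <= K * `|y - x t|].
Proof.
have t0T := ltW t0_lt_T.
have [m1 b1] := op_bounded t0T P1_cts.
have [m2 b2] := op_bounded t0T P2_cts.
have [m3 b3] := op_bounded t0T (ctsM Gi_cts Q1_cts).
have [m4 b4] := op_bounded t0T (ctsM Gi_cts Q2_cts).
have [m5 b5] := op_bounded t0T drift_cts.
have [m6 [r6 r60 b6]] := tube_bounded (F := fun t y => invmx (newton_mx A B C2 f t y)) t0T inv_ctsE x_cts.
have [m7 [r7 r70 b7]] := tube_bounded (F := fun t y => jac (f t) y *m P1 t - A' t *m P1 t) t0T jacP_ctsE x_cts.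
have [m8 [r8 r80 b8]] := tube_bounded (F := fun t y => jac (f t) y) t0T jac_ctsE x_cts.
(* Each bound holds for every larger constant, so a sum serves them all. The 2 yields [m8 <= K - 1],
   reserving one unit for the Taylor remainder in the Lipschitz estimate. *)
pose K := 2 + `|m1| + `|m2| + `|m3| + `|m4| + `|m5| + `|m6| + `|m7| + `|m8|.
have [[g1 g2 g3 g4] [g5 g6 g7 g8 K1]] :
    [/\ m1 <= K, m2 <= K, m3 <= K & m4 <= K] /\ [/\ m5 <= K, m6 <= K, m7 <= K, m8 <= K - 1 & 1 <= K].
  have := (ler_norm m1, ler_norm m2, ler_norm m3, ler_norm m4).
  have := (ler_norm m5, ler_norm m6, ler_norm m7, ler_norm m8).
  have := (normr_ge0 m1, normr_ge0 m2, normr_ge0 m3, normr_ge0 m4).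
  have := (normr_ge0 m5, normr_ge0 m6, normr_ge0 m7, normr_ge0 m8).
  rewrite /K; move: `|m1| `|m2| `|m3| `|m4| `|m5| `|m6| `|m7| `|m8|.
  move=> n1 n2 n3 n4 n5 n6 n7 n8 [[[? ?] ?] ?] [[[? ?] ?] ?] [[[? ?] ?] ?] [[[? ?] ?] ?].
  by split; split; lra.
have K0 : 0 < K := lt_le_trans ltr01 K1.
have k0 : 0 < (2 * K ^+ 3)^-1 by rewrite invr_gt0 mulr_gt0// exprn_gt0.
have k1 : (2 * K ^+ 3)^-1 <= 1.
  by rewrite invf_le1 ?mulr_gt0 ?exprn_gt0//; have := exprn_ege1 3 K1; lra.
(* Jacobians at [y] and on the segment are both compared with the one at [x t], costing [2 e], and
   [mean_value_jac] multiplies by [n.+1]. The radius [r9] is thus chosen after [K]. *)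
pose e := (2 * K ^+ 3)^-1 / (2 * n.+1%:R).
have n0 : 0 < n.+1%:R :> R by rewrite ltr0n.
have e0 : 0 < e by rewrite divr_gt0// mulr_gt0.
have [|r9 r90 b9] := uniform_tube (E := E) (F := fun t y => jac (f t) y) (x := x) _ e0 jac_ctsE x_cts.
  by move=> t y tT; rewrite /= in_itv.
pose r := Num.min (Num.min r6 r7) (Num.min r8 r9).
have r0 : 0 < r by rewrite !lt_min r60 r70 r80 r90.
have rr y t : `|y - x t| <= r -> [/\ `|y - x t| <= r6, `|y - x t| <= r7, `|y - x t| <= r8 & `|y - x t| <= r9].
  by rewrite !le_min => /andP[/andP[-> ->] /andP[-> ->]].
exists K, r; split=> //.
- move=> t v tT; split; [exact: b1|exact: b2|exact: b3|exact: b4|exact: b5].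
- by move=> t y v tT /rr[? ? _ _]; split; [exact: b6|exact: b7].
move=> t y tT /rr[_ _ y8 y9].
have taylor : `|f t y - f t (x t) - jac (f t) y *m (y - x t)| <= (2 * K ^+ 3)^-1 * `|y - x t|.
  have -> : (2 * K ^+ 3)^-1 = n.+1%:R * (e + e).
    by rewrite /e; field; rewrite !lt0r_neq0.
  apply: mean_value_jac => [v|s /andP[s0 s1]]; first by apply: f_diff; exact: tpI tT.
  rewrite -[jac _ _](subrK (jac (f t) (x t))) -addrA.
  apply: le_trans (ler_normD _ _) _; apply: lerD; last by rewrite distrC; exact: b9.
  apply: b9 => //; rewrite addrAC subrr add0r normrZ ger0_norm//.
  by apply: le_trans y9; rewrite ler_piMl.
split => //.
rewrite -[f t y - _](subrK (jac (f t) y *m (y - x t))).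
apply: le_trans (ler_normD _ _) _.
have b8' := b8 _ g8 t y (y - x t) tT y8.
apply: le_trans (lerD taylor b8') _.
have : (2 * K ^+ 3)^-1 * `|y - x t| <= 1 * `|y - x t| by exact: ler_wpM2r.
lra.
Qed.

Let rhss_cts : cts I rhss.
Proof.
exact (ctsA (ctsM drift_cts (ctsM P1_cts x_cts))
  (ctsM (ctsM Gi_cts Q1_cts) (cts_graph f_ctsE x_cts))).
Qed.

(** [z' = rhss] is uniformly continuous on the segment, so over a short step it may be replaced by
    its value at either end. *)
Let modulus (d : R) : 0 < d -> exists2 h0 : R, 0 < h0 & forall h, 0 < h <= h0 ->
  forall t, t0 <= t -> t + h <= T ->
    [/\ `|us (t + h) - us t| <= d, `|zs (t + h) - zs t - h *: rhss t| <= h * d &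
        `|zs (t + h) - zs t - h *: rhss (t + h)| <= h * d].
Proof.
move=> d0.
have [h1 h10 uc] := uniform_continuity_segment d0 (ctsM P2_cts x_cts).
have [h2 h20 rc] := uniform_continuity_segment d0 rhss_cts.
exists (Num.min h1 h2); first by rewrite lt_min h10.
move=> h /andP[h0]; rewrite le_min => /andP[hh1 hh2] t t0t thT.
have tth : t < t + h by rewrite ltrDl.
have inI s : t <= s <= t + h -> t0 <= s <= T.
  by move=> /andP[ts sth]; rewrite (le_trans t0t ts) (le_trans sth thT).
have tI : t0 <= t <= T by apply: inI; rewrite lexx ltW.
have thI : t0 <= t + h <= T by apply: inI; rewrite lexx ltW.
have hE : t + h - t = h by rewrite addrC addKr.
have [_ P1C1 _ GiC1] := splits.
have dz s : t0 <= s -> diff_quotient zs s y @[y --> within `[t0, +oo[ s^'] --> rhss s.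
  by move=> /(exact_solution_split tp_le_t0 A_C1 splitt P1C1 GiC1 x_solution)[].
split.
- by apply: uc => //; rewrite hE gtr0_norm.
- have := increment_bound (c := rhss t) (e := d) t0t tth dz; rewrite hE; apply => s st.
  apply: rc => //; first exact: inI.
  case/andP: st => ts sth; rewrite ger0_norm ?subr_ge0// lerBlDl (le_trans sth)//.
  by rewrite lerD2l.
- have := increment_bound (c := rhss (t + h)) (e := d) t0t tth dz; rewrite hE; apply => s st.
  apply: rc => //; first exact: inI.
  case/andP: st => ts sth; rewrite distrC ger0_norm ?subr_ge0// lerBlDl.
  by apply: lerD.
Qed.

Lemma convergence :
  (fun N : nat => let h := (T - t0) / N%:R in
     \big[Num.max/0]_(1 <= i < N.+1)
        enorm (x (grid t0 h i) - xc (method A B C2 f tp t0 x0 h i)))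
    @ \oo --> (0 : R).
Proof.
have [_ _ _ xt0] := x_solution.
have [K [r [K1 r0 bops btube btay]]] := step_constants.
set S := smallness_factor K; set Ex := expR (growth_rate K * (T - t0)).
set W := n.+1%:R * (K * (1 + newton_factor K) * Ex).
have Ex0 : 0 < Ex := expR_gt0 _.
apply/cvgrPdist_lt => e e0.
(* The first term keeps the numerical solution in the tube, the second brings the final error below
   [e]; adding 1 keeps the denominators positive. *)
pose d := Num.min (r / (`|S * Ex| + 1)) (e / (`|W| + 1)).
have pos (y : R) : 0 < `|y| + 1 by rewrite ltr_wpDl.
have d0 : 0 < d by rewrite lt_min !divr_gt0.
have dS : S * (d * Ex) <= r.
  rewrite mulrCA mulrC; apply: (@le_trans _ _ (`|S * Ex| * d)).
    by apply: ler_wpM2r; [exact: ltW|exact: ler_norm].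
  apply: (@le_trans _ _ (`|S * Ex| * (r / (`|S * Ex| + 1)))).
    by apply: ler_wpM2l => //; rewrite ge_min lexx.
  by rewrite mulrCA ler_piMr ?ltW// ltr_pdivrMr// mul1r ltrDl.
have dW : n.+1%:R * (K * (1 + newton_factor K) * (d * Ex)) < e.
  have -> : n.+1%:R * (K * (1 + newton_factor K) * (d * Ex)) = W * d by rewrite /W; ring.
  apply: (@le_lt_trans _ _ (`|W| * (e / (`|W| + 1)))).
    apply: (@le_trans _ _ (`|W| * d)).
      by apply: ler_wpM2r; [exact: ltW|exact: ler_norm].
    by apply: ler_wpM2l => //; rewrite ge_min lexx orbT.
  by rewrite mulrCA gtr_pMr// ltr_pdivrMr// mul1r ltrDl.
have [h0 h00 modh] := modulus d0.
have Tt0 : 0 < T - t0 by rewrite subr_gt0.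
pose h1 := Num.min 1 h0.
have h10 : 0 < h1 by rewrite lt_min ltr01.
near=> N.
have NT : (T - t0) / h1 <= N%:R by near: N; exact: nbhs_infty_ger.
have N0 : 0 < N%:R :> R by apply: lt_le_trans NT; rewrite divr_gt0.
rewrite /=; set h := (T - t0) / N%:R.
have hpos : 0 < h by rewrite divr_gt0.
have hh1 : h <= h1 by rewrite ler_pdivrMr// mulrC -ler_pdivrMr.
have /andP[h_1 hh0] : (h <= 1) && (h <= h0) by rewrite -le_min.
have Nh : N%:R * h = T - t0 by rewrite mulrC divfK// gt_eqF.
(* [big_seq] records membership of the index, which supplies [i <= N]. *)
rewrite sub0r normrN big_seq.
suff /andP[b0 be] : 0 <= \big[Num.max/0]_(i <- index_iota 1 N.+1 | i \in index_iota 1 N.+1)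
    enorm (x (grid t0 h i) - xc (method A B C2 f tp t0 x0 h i)) < e.
  by rewrite ger0_norm.
apply: (big_ind (fun y => 0 <= y < e)) => [|y y' /andP[y0 ye] /andP[y'0 y'e]|i].
- by rewrite lexx.
- by rewrite le_max y0 gt_max ye y'e.
rewrite mem_index_iota ltnS => /andP[_ iN]; rewrite sqrtr_ge0/=.
apply: le_lt_trans dW; apply: le_trans (enorm_le _) _; apply: ler_wpM2l => //.
rewrite -xt0.
have fixP1 t : t0 <= t <= T -> P1 t *m (P1 t *m x t) = P1 t *m x t.
  by move=> /tpI/splitt[_ [PP _ _ _ _]]; rewrite mulmxA PP.
(apply: (method_bound (r := r)); last exact: iN) => //.
- move=> t tT; rewrite /Defs.P2 [LHS]mulmxBl mul1mx mulmxBl mul1mx mulmxBr fixP1//.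
  by rewrite subrr subr0.
- move=> t /andP[t0t _]; have [_ _ _ _] := x_solution.
  have [_ P1C1 _ GiC1] := splits.
  by have [_] := exact_solution_split tp_le_t0 A_C1 splitt P1C1 GiC1 x_solution t0t.
- by move=> t v /bops-/(_ v)[].
- by move=> t v /bops-/(_ v)[].
- by move=> t v /bops-/(_ v)[].
- by move=> t v /bops-/(_ v)[].
- by move=> t v /bops-/(_ v)[].
- by move=> t y v tT yr; have [] := btube t y v tT yr.
- by move=> t y v tT yr; have [] := btube t y v tT yr.
- by move=> t y tT yr; have [] := btay t y tT yr.
- by move=> t y tT yr; have [] := btay t y tT yr.
- by rewrite hpos.
- exact: ltW.
- by apply: modh; rewrite hpos.
Unshelve. all: by end_near. Qed.

End Convergence.

Unset Implicit Arguments.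
Set Strict Implicit.
Set Printing Implicit Defensive.

Theorem proposition3p2 (R : realType) (n : nat) (tp : R) (tp_ge0 : 0 <= tp)
    (f : R -> 'cV[R]_n -> 'cV[R]_n) (A B : R -> 'M[R]_n) (C1 C2 : R -> R)
    (f_cont : {within [set p | tp <= p.1],
                 continuous (fun p : R * 'cV[R]_n => f p.1 p.2)})
    (f_diff : forall t x, tp <= t -> differentiable (f t) x)
    (dfdx_cont : {within [set p | tp <= p.1],
                 continuous (fun p : R * 'cV[R]_n => jac (f p.1) p.2)})
    (A_C1 : C1_on `[tp, +oo[ A) (B_C1 : C1_on `[tp, +oo[ B)
    (AB_regular : forall t, tp <= t -> regular_pencil A B t)
    (C1_gt0 : forall t, tp <= t -> 0 < C1 t)
    (C2_gt0 : forall t, tp <= t -> 0 < C2 t)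
    (C2_C1 : C1_on `[tp, +oo[ C2)
    (resolvent_bound : forall t (lam : R[i]), tp <= t ->
       real_complex R (C2 t) <= `|lam| ->
       pencil A B t lam \in unitmx /\
       opnorm (invmx (pencil A B t lam)) <= C1 t)
    (cond1 : uniquely_solvable_condition A B C2 f tp \/
             basis_invertible_condition A B C2 f tp)
    (cond2 : lyapunov_condition A B C2 f tp)
    (t0 T : R) (tp_le_t0 : tp <= t0) (t0_lt_T : t0 < T)
    (Phi_invertible : forall t (z u : 'cV[R]_n), t0 <= t -> t <= T ->
       invertible_between (X2 A B C2 t) (Y2 A B C2 t)
         (Phi A B C2 f t (P1 A B C2 t *m z) (P2 A B C2 t *m u)))
    (x0 : 'cV[R]_n) (x0_consistent : consistency_manifold A B C2 f tp (t0, x0))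
    (x : R -> 'cV[R]_n) (x_solution : is_solution A B f t0 x0 x) :
  (fun N : nat => let h := (T - t0) / N%:R in
     \big[Num.max/0]_(1 <= i < N.+1)
        enorm (x (grid t0 h i) - xc (method A B C2 f tp t0 x0 h i)))
    @ \oo --> (0 : R).
Proof.
(* The argument uses the ring of matrices of size [n.+1]; in dimension 0 every error norm is the
   root of an empty sum. *)
destruct n as [|n]; last first.
  exact: (convergence f_cont f_diff dfdx_cont A_C1 B_C1 C2_gt0 C2_C1
    resolvent_bound tp_le_t0 t0_lt_T Phi_invertible x_solution).
have enorm0 (v : 'cV[R]_0) : enorm v = 0 by rewrite /enorm /dotv big_ord0 sqrtr0.
rewrite (_ : (fun N : nat => _) = fun=> 0); first exact: cvg_cst.
apply/funext => N /=; elim: (index_iota _ _) => [|i s IH]; first by rewrite big_nil.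
by rewrite big_cons IH enorm0 maxxx.
Qed.
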